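(* Let $X_1, X_2, \ldots$ be i.i.d. real random variables and let $f_1, \ldots, f_m : \mathbb R \to \mathbb R$ be measurable functions with $\mathcal K(f_i) = \mathbb E[f_i^4(X)] < \infty$ for $i = 1, \ldots, m$. Fix an integer $K \ge 1$. Then, as $N \to \infty$, $$ N^{1/2}\left[\hat{\mathbb Q}_1, \ldots, \hat{\mathbb Q}_K\right] \Rightarrow (\Xi_1, \ldots, \Xi_K), $$ where $\Xi_1, \ldots, \Xi_K$ are i.i.d. $\mathcal N_{m^2}(\mathbf 0, \mathbf Q)$ random vectors and the $m^2 \times m^2$ matrix $\mathbf Q$ is given by $$ \mathbf Q_{(ij),(i'j')} = Q(f_i, f_{i'})\,Q(f_j, f_{j'}),\quad i,j,i',j' = 1, \ldots, m, $$ i.e. $\mathbf Q = \mathcal Q \otimes \mathcal Q$.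
   Context: Let $X_1, X_2, \ldots$ be i.i.d. real random variables and $X$ a random variable with the same law as $X_1$. For measurable $f : \mathbb R \to \mathbb R$ write $m(f) = \mathbb E[f(X)]$, $Q(f) = \mathrm{Var}(f(X))$, $s(f) = Q(f)^{1/2}$, $\mathcal K(f) = \mathbb E[f^4(X)]$, and for two functions $Q(f,g) = \mathrm{Cov}(f(X), g(X))$, $C(f,g) = Q(f,g)/(s(f)s(g))$. For a sample size $N$ define $\hat m(f) = \frac1N\sum_{k=1}^N f(X_k)$, $\hat s^2(f) = \frac1N\sum_{i=1}^N (f(X_i) - \hat m(f))^2$, and for a lag $0 \le k < N$, $\hat\gamma_k(f,g) = \frac{1}{N-k}\sum_{i=1}^{N-k}(f(X_i) - \hat m(f))(g(X_{i+k}) - \hat m(g))$ and $\hat\rho_k(f,g) = \hat\gamma_k(f,g)/(\hat s(f)\hat s(g))$; for $k = 0$ the subscript is omitted. For functions $f_1, \ldots, f_m$, set $\hat{\mathbb Q}_k = [\hat\gamma_k(f_i, f_j)]_{i,j=1,\ldots,m} \in \mathbb R^{m^2}$ and $\hat{\mathbb C}_k = [\hat\rho_k(f_i, f_j)]_{i,j=1,\ldots,m} \in \mathbb R^{m^2}$, with coordinates indexed by pairs $(i,j)$ in lexicographic order; $[\hat{\mathbb Q}_1, \ldots, \hat{\mathbb Q}_K] \in \mathbb R^{m^2K}$ denotes concatenation. Let $\mathcal Q = (Q(f_i,f_j))_{i,j=1}^m$ and $\mathcal C = (C(f_i,f_j))_{i,j=1}^m$. $\otimes$ is the Kronecker product,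 so $(A \otimes B)_{(ij),(i'j')} = A_{ii'}B_{jj'}$. $\Rightarrow$ denotes convergence in distribution as $N \to \infty$. *)

(* Defs.v *)
From HB Require Import structures.
From mathcomp Require Import all_boot all_order all_algebra.
From mathcomp Require Import all_classical all_reals all_analysis.
Set Implicit Arguments. Unset Strict Implicit. Unset Printing Implicit Defensive.
Import Order.TTheory GRing.Theory Num.Theory.
Import numFieldNormedType.Exports.
Local Open Scope classical_set_scope.
Local Open Scope ring_scope.

Section defs.
Context {d : measure_display} {T : measurableType d} {R : realType}
  (P : probability T R).

Definition mutually_independent (X : nat -> T -> R) : Prop :=
  forall (J : seq nat) (B : nat -> set R), uniq J ->
    (forall n, measurable (B n)) ->
    P (\big[setI/setT]_(n <- J) (X n @^-1` B n)) =
    (\prod_(n <- J) P (X n @^-1` B n))%E.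

Definition identically_distributed (X : nat -> T -> R) : Prop :=
  forall n (B : set R), measurable B -> P (X n @^-1` B) = P (X 0 @^-1` B).

Definition iid_seq (X : nat -> T -> R) : Prop :=
  [/\ forall n, measurable_fun setT (X n),
      mutually_independent X & identically_distributed X].

Definition mean_f (X : nat -> T -> R) (f : R -> R) : R :=
  Rintegral P setT (fun t => f (X 0%N t)).

Definition cov_f (X : nat -> T -> R) (f g : R -> R) : R :=
  Rintegral P setT (fun t => (f (X 0%N t) - mean_f X f) *
                             (g (X 0%N t) - mean_f X g)).

Definition hat_m (X : nat -> T -> R) (f : R -> R) (N : nat) (t : T) : R :=
  (\sum_(k < N) f (X k t)) / N%:R.

Definition hat_gamma (X : nat -> T -> R) (f g : R -> R) (N k : nat) (t : T)
  : R :=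
  (\sum_(i < N - k) (f (X i t) - hat_m X f N t) *
                    (g (X (i + k)%N t) - hat_m X g N t)) / (N - k)%:R.
End defs.

Definition bounded_test_fun {R : realType} {K m : nat}
  (g : ('I_K -> 'I_m -> 'I_m -> R) -> R) : Prop :=
  exists M : R, forall x, `|g x| <= M.

Definition continuous_test_fun {R : realType} {K m : nat}
  (g : ('I_K -> 'I_m -> 'I_m -> R) -> R) : Prop :=
  forall x (eps : R), 0 < eps -> exists2 delta : R, 0 < delta &
    forall y, (forall k i j, `|x k i j - y k i j| < delta) ->
      `|g x - g y| < eps.

(* Gaussian random matrix-indexed vector Z = (Z_ij) ~ N_{m^2}(0, S) where
   S is indexed by pairs ((i,j),(i',j')), defined through its characteristic
   function  E[exp(i <t,Z>)] = exp(-1/2 t^T S t)  (real and imaginary parts). *)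
Definition centered_gaussian {d} {T : measurableType d} {R : realType}
  (P : probability T R) {m : nat} (Z : T -> 'I_m -> 'I_m -> R)
  (S : 'I_m -> 'I_m -> 'I_m -> 'I_m -> R) : Prop :=
  (forall i j, measurable_fun setT (fun w => Z w i j)) /\
  forall t : 'I_m -> 'I_m -> R,
    let q := \sum_(i < m) \sum_(j < m) \sum_(i' < m) \sum_(j' < m)
               t i j * t i' j' * S i j i' j' in
    let s w := \sum_(i < m) \sum_(j < m) t i j * Z w i j in
    Rintegral P setT (fun w => cos (s w)) = expR (- (q / 2)) /\
    Rintegral P setT (fun w => sin (s w)) = 0.

(* Mutual independence of K random vectors Xi_k = (Xi_k(i,j))_{i,j}: product
   rule on all measurable rectangles (a generating pi-system of sigma(Xi_k)). *)
Definition independent_vectors {d} {T : measurableType d} {R : realType}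
  (P : probability T R) {K m : nat} (Xi : T -> 'I_K -> 'I_m -> 'I_m -> R)
  : Prop :=
  forall B : 'I_K -> 'I_m -> 'I_m -> set R,
    (forall k i j, measurable (B k i j)) ->
    P (\big[setI/setT]_(k < K) \big[setI/setT]_(i < m) \big[setI/setT]_(j < m)
         ((fun w => Xi w k i j) @^-1` B k i j)) =
    (\prod_(k < K) P (\big[setI/setT]_(i < m) \big[setI/setT]_(j < m)
         ((fun w => Xi w k i j) @^-1` B k i j)))%E.

(* Main.v *)
(** Put [Y^i_n = f_i(X_n) - m(f_i)].  Up to an [O(N^{-1/2})] error in L1,
    [N^{1/2} gamma_k(f_i, f_j)] equals [N^{-1/2} sum_{a<N} Y^i_a Y^j_{a+k}].  A linear
    combination [D_a] of these products over [(k,i,j)] is a K-dependent sequence of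
    centred, pairwise uncorrelated variables, so its characteristic function is found
    by cutting [{0..N-1}] into blocks of fixed length separated by gaps of length [K]:
    the blocks are independent, and the gaps contribute a small variance once the
    blocks are long.  The limit is [exp(- Var D / 2)] with
    [Var D = sum_k sum c_kij c_ki'j' Q_ii' Q_jj'], the characteristic function of
    independent [N(0, Q (x) Q)] vectors; these exist because a Gram decomposition
    [Q = sum_v v v^T] writes a vector of covariance [Q (x) Q] as a sum of independent
    one-dimensional Gaussians times the vectors [v (x) w].  Finally, convergence of
    characteristic functions and tightness give convergence of [E g] for bounded
    continuous [g], since on a box [g] is uniformly close to a trigonometric polynomial
    with the same bound.  Complex exponentials are avoided by working with
    [E cos(<t, Z> + theta)] for every phase [theta]. *)

Require Import Defs.
From HB Require Import structures.
From mathcomp Require Import all_boot all_order all_algebra.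
From mathcomp Require Import all_classical all_reals all_analysis.
From mathcomp Require Import measurable_realfun ring lra.
Import Order.TTheory GRing.Theory Num.Theory.
Import numFieldNormedType.Exports.
Local Open Scope classical_set_scope.
Local Open Scope ring_scope.
Set Implicit Arguments. Unset Strict Implicit. Unset Printing Implicit Defensive.

(** * Expectations *)

Section expectation.
Context {d : measure_display} {T : measurableType d} {R : realType}.
Variable P : probability T R.
Implicit Types f g : T -> R.

(** Fourth moments of the [f_i] suffice because every lag is positive: the two factors of
    [Y^i_a Y^j_{a+k}] are independent, so the fourth moment of the product is a product of fourth
    moments of [Y]. Each block then admits a Lyapunov-type expansion with error [N^(-3/2)] times a
    constant that grows quickly with the block length [p]. Summed over at most [N / p] blocks this
    vanishes only for fixed [p], so the order of choices is forced: the share of the gaps decides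
    [p], and [N] is taken large afterwards. All coordinates are carried by the single finite type
    ['I_K * ('I_m * 'I_m)]. The function space over it receives no sigma-algebra: statements about
    whole vectors are handled through coordinates, through preimages of sets, or as limits of
    trigonometric polynomials. *)

Definition mean f : R := Rintegral P setT f.
Definition has_mean f : Prop := P.-integrable setT (EFin \o f).

Lemma has_mean_measurable f : has_mean f -> measurable_fun setT f.
Proof. by move=> /measurable_int /measurable_EFinP. Qed.

Lemma has_mean_le f g : measurable_fun setT f -> (forall x, `|f x| <= g x) ->
  has_mean g -> has_mean f.
Proof.
move=> mf fg; apply: le_integrable => //; first exact/measurable_EFinP.
move=> x _ /=; rewrite lee_fin; apply: le_trans (fg x) _; exact: ler_norm.
Qed.

Lemma has_mean_cst c : has_mean (fun=> c).
Proof. exact: finite_measure_integrable_cst. Qed.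

Lemma has_mean_bounded f M : measurable_fun setT f -> (forall x, `|f x| <= M) ->
  has_mean f.
Proof. by move=> mf fM; apply: has_mean_le mf fM (has_mean_cst M). Qed.

Lemma has_meanD f g : has_mean f -> has_mean g -> has_mean (fun x => f x + g x).
Proof. by move=> sf sg; have := integrableD measurableT sf sg. Qed.

Lemma has_meanB f g : has_mean f -> has_mean g -> has_mean (fun x => f x - g x).
Proof. by move=> sf sg; have := integrableB measurableT sf sg. Qed.

Lemma has_meanZ c f : has_mean f -> has_mean (fun x => c * f x).
Proof. by move=> sf; have := integrableZl measurableT c sf. Qed.

Lemma has_mean_sum I (s : seq I) (p : pred I) (F : I -> T -> R) :
  (forall i, p i -> has_mean (F i)) -> has_mean (fun x => \sum_(i <- s | p i) F i x).
Proof.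
move=> sF; have := integrable_sum measurableT s sF.
by apply: eq_integrable => // x _ /=; rewrite sumEFin.
Qed.

Lemma has_mean_norm f : has_mean f -> has_mean (fun x => `|f x|).
Proof. exact: integrable_norm. Qed.

Lemma mean_cst c : mean (fun=> c) = c.
Proof. by rewrite /mean Rintegral_cst//= probability_setT mulr1. Qed.

Lemma meanD f g : has_mean f -> has_mean g ->
  mean (fun x => f x + g x) = mean f + mean g.
Proof. exact: RintegralD. Qed.

Lemma meanB f g : has_mean f -> has_mean g ->
  mean (fun x => f x - g x) = mean f - mean g.
Proof. exact: RintegralB. Qed.

Lemma meanZ c f : has_mean f -> mean (fun x => c * f x) = c * mean f.
Proof. exact: RintegralZl. Qed.

Lemma mean_sum I (s : seq I) (p : pred I) (F : I -> T -> R) :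
  (forall i, p i -> has_mean (F i)) ->
  mean (fun x => \sum_(i <- s | p i) F i x) = \sum_(i <- s | p i) mean (F i).
Proof.
move=> sF; elim: s => [|i s IH].
  rewrite big_nil -[RHS](mean_cst 0); congr mean.
  by apply/funext => x; rewrite big_nil.
under [X in mean X]eq_fun do rewrite big_cons.
rewrite big_cons.
case: ifPn => // pi; rewrite meanD ?IH//; first exact: sF.
exact: has_mean_sum.
Qed.

Lemma mean_le f g : has_mean f -> has_mean g -> (forall x, f x <= g x) ->
  mean f <= mean g.
Proof. by move=> sf sg fg; apply: le_Rintegral. Qed.

Lemma mean_ge0 f : (forall x, 0 <= f x) -> 0 <= mean f.
Proof. by move=> f0; apply: Rintegral_ge0. Qed.

Lemma norm_mean_le f g : has_mean f -> has_mean g ->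
  (forall x, `|f x| <= g x) -> `|mean f| <= mean g.
Proof.
move=> sf sg fg; apply: le_trans (le_normr_Rintegral _ sf) _ => //.
by apply: mean_le => //; exact: has_mean_norm.
Qed.

Lemma norm_mean_bound f M : measurable_fun setT f -> (forall x, `|f x| <= M) ->
  `|mean f| <= M.
Proof.
move=> mf fM; rewrite -[leRHS]mean_cst; apply: norm_mean_le => //.
  exact: has_mean_bounded fM.
exact: has_mean_cst.
Qed.

Lemma dist_mean_le f g h : has_mean f -> has_mean g -> has_mean h ->
  (forall x, `|f x - g x| <= h x) -> `|mean f - mean g| <= mean h.
Proof.
move=> sf sg sh fg; rewrite -meanB//; apply: norm_mean_le => //.
exact: has_meanB.
Qed.

End expectation.

(** * Fubini on products of probability spaces *)

Section product.
Context {d1 d2 : measure_display} {T1 : measurableType d1} {T2 : measurableType d2}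
  {R : realType} (P1 : probability T1 R) (P2 : probability T2 R).
Local Notation P12 := (P1 \x P2)%E.

(** The inner [mean] is [fine] of an integral, faithful only where the section is integrable; this
    holds almost everywhere, which is enough under the outer integral. *)
Lemma mean_prod (f : T1 * T2 -> R) : has_mean P12 f ->
  mean P12 f = mean P1 (fun x => mean P2 (fun y => f (x, y))).
Proof.
move=> sf; rewrite /mean /Rintegral -integral12_prod_meas1//.
have := integrable_fubini_F sf; have := ae_integrable1 sf => ae1 iF.
congr fine; apply: ae_eq_integral => //.
- exact: measurable_int iF.
- apply: (@measurableT_comp _ _ _ _ _ _ EFin) => //.
  apply: measurableT_comp => //.
  exact: measurable_int iF.
- apply: filterS ae1 => x ix _ /=; rewrite fineK//.
  by apply: integrable_fin_num => //; exact: ix.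
Qed.

Lemma has_mean_prodM (f : T1 -> R) (g : T2 -> R) :
  has_mean P1 f -> has_mean P2 g -> has_mean P12 (fun z => f z.1 * g z.2).
Proof.
move=> sf sg.
have mf := has_mean_measurable sf; have mg := has_mean_measurable sg.
apply/integrable12ltyP.
  apply/measurable_EFinP; apply: measurable_funM; exact: measurableT_comp.
under eq_integral => x _ do under eq_integral => y _ do
  rewrite /= normrM EFinM.
under eq_integral => x _.
  rewrite integralZl//; last by have := has_mean_norm sg.
  over.
have /integrableP[_ fy] := sf; have /integrableP[_ gy] := sg.
rewrite ge0_integralZr//; last 2 first.
- exact/measurable_EFinP/measurableT_comp.
- exact: integral_ge0.
by apply: lte_mul_pinfty => //; rewrite ?integral_ge0// ge0_fin_numE// integral_ge0.
Qed.

Lemma mean_prodM (f : T1 -> R) (g : T2 -> R) :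
  has_mean P1 f -> has_mean P2 g ->
  mean P12 (fun z => f z.1 * g z.2) = mean P1 f * mean P2 g.
Proof.
move=> sf sg; rewrite mean_prod/=; last exact: has_mean_prodM.
under [X in mean P1 X]eq_fun do rewrite meanZ//.
by rewrite mulrC -meanZ//; congr mean; apply/funext => x; rewrite mulrC.
Qed.

End product.

(** * Image laws and independence of two variables *)

Section independence.
Context {d : measure_display} {T : measurableType d} {R : realType}
  (P : probability T R).

Lemma has_mean_distribution d' (T' : measurableType d') (X : {RV P >-> T'})
    (h : T' -> R) : measurable_fun setT h ->
  has_mean P (h \o X) <-> has_mean (distribution P X) h.
Proof.
move=> mh.
have e : (\int[distribution P X]_y `|(h y)%:E| = \int[P]_x `|(h (X x))%:E|)%E.
  rewrite ge0_integral_distribution//.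
  by apply: measurableT_comp => //; exact/measurable_EFinP.
split=> /integrableP[_ i]; apply/integrableP; split.
- exact/measurable_EFinP.
- by rewrite /= e.
- by apply/measurable_EFinP; apply: (measurableT_comp mh).
- by rewrite /= -e.
Qed.

Lemma mean_distribution d' (T' : measurableType d') (X : {RV P >-> T'})
    (h : T' -> R) : measurable_fun setT h -> has_mean P (h \o X) ->
  mean (distribution P X) h = mean P (h \o X).
Proof.
move=> mh sh; by rewrite /mean /Rintegral integral_distribution//; exact/measurable_EFinP.
Qed.

(** The product rule on rectangles identifies the law of the pair with the product of the marginal
    laws; the claim becomes Fubini for [z.1 * z.2]. *)
Lemma mean_indep (f g : T -> R) : has_mean P f -> has_mean P g ->
  (forall A B : set R, measurable A -> measurable B ->
    P (f @^-1` A `&` g @^-1` B) = (P (f @^-1` A) * P (g @^-1` B))%E) ->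
  has_mean P (fun x => f x * g x) /\
  mean P (fun x => f x * g x) = mean P f * mean P g.
Proof.
move=> sf sg ind.
have mf := has_mean_measurable sf; have mg := has_mean_measurable sg.
have mfg : measurable_fun setT (fun x => (f x, g x)) by exact: measurable_fun_pair.
pose X : {RV P >-> R} := HB.pack f (isMeasurableFun.Build _ _ _ _ f mf).
pose Y : {RV P >-> R} := HB.pack g (isMeasurableFun.Build _ _ _ _ g mg).
pose XY : {RV P >-> (R * R)%type} :=
  HB.pack (fun x => (f x, g x)) (isMeasurableFun.Build _ _ _ _ _ mfg).
have mid : measurable_fun setT (@id R) by exact: measurable_id.
have sX : has_mean (distribution P X) id by exact/(has_mean_distribution X mid).
have sY : has_mean (distribution P Y) id by exact/(has_mean_distribution Y mid).
have E : forall C : set (R * R), measurable C ->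
    (distribution P X \x distribution P Y)%E C = distribution P XY C.
  by apply: product_measure_unique => A B mA mB; exact: ind.
have mM : measurable_fun setT (fun z : R * R => z.1 * z.2).
  by apply: measurable_funM; [exact: measurable_fst|exact: measurable_snd].
have sM := has_mean_prodM sX sY; have eM := mean_prodM sX sY.
have eq_int (h : R * R -> \bar R) :
    (\int[distribution P X \x distribution P Y]_z h z =
     \int[distribution P XY]_z h z)%E.
  by apply: eq_measure_integral => C mC _; exact: E.
have sM' : has_mean (distribution P XY) (fun z => z.1 * z.2).
  have /integrableP[_ i] := sM; apply/integrableP; split.
    exact/measurable_EFinP.
  by rewrite -eq_int.
have sfg := (has_mean_distribution XY mM).2 sM'.
split=> //.
rewrite -[RHS]/(mean P (id \o X) * mean P (id \o Y)).
rewrite -[LHS](mean_distribution (X := XY) mM)// -!mean_distribution// -eM.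
by rewrite /mean /Rintegral eq_int.
Qed.
End independence.

(** * Independence of disjoint blocks of coordinates *)

Lemma in_bigsetI {T I : Type} (s : seq I) (A : I -> set T) :
  \big[setI/setT]_(i <- s) A i = [set t | all (fun i => `[< A i t >]) s].
Proof.
elim: s => [|i s IH]; first by rewrite big_nil; apply/seteqP; split.
rewrite big_cons IH; apply/seteqP; split=> t /=.
  by move=> [Ai ->]; rewrite andbT; exact/asboolP.
by move=> /andP[/asboolP].
Qed.

Section past_future.
Context {d : measure_display} {T : measurableType d} {R : realType}
  (P : probability T R) (X : nat -> T -> R).
Hypothesis mX : forall n, measurable_fun setT (X n).
Hypothesis indX : mutually_independent P X.

Definition coord_events (J : set nat) : set (set T) :=
  [set A | exists j B, [/\ J j, measurable B & A = X j @^-1` B]].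

(** Measurability for the sigma-algebra generated by the [X j] with [j] in [J]. Stating it as
    [measurable_fun] for another structure on [T] makes closure under sums, products and continuous
    maps available at once. *)
Definition depends_on (J : set nat) (f : T -> R) : Prop :=
  measurable_fun (setT : set (g_sigma_algebraType (coord_events J))) f.

(** The pi-system on which independence is checked; the list has no repetition so that
    [mutually_independent] applies to it. *)
Definition cylinder (J : set nat) : set (set T) :=
  [set A | exists s (B : nat -> set R), [/\ uniq s, (forall n, n \in s -> J n),
     (forall n, measurable (B n)) & A = \big[setI/setT]_(n <- s) (X n @^-1` B n)]].

Lemma depends_on_coord (J : set nat) j (h : R -> R) : J j -> measurable_fun setT h ->
  depends_on J (fun t => h (X j t)).
Proof.
move=> Jj mh _ B mB; rewrite setTI; apply: sub_sigma_algebra.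
exists j, (h @^-1` B); split=> //.
by rewrite -[X in measurable X]setTI; exact: mh.
Qed.

Lemma coord_events_measurable J A : <<s coord_events J >> A -> measurable A.
Proof.
move: A; apply: smallest_sub; first exact: sigma_algebra_measurable.
move=> _ [j [B [_ mB ->]]]; rewrite -[X in measurable X]setTI; exact: mX.
Qed.

Lemma depends_on_measurable J f : depends_on J f -> measurable_fun setT f.
Proof.
move=> df _ B mB; have := df measurableT B mB.
exact: coord_events_measurable.
Qed.

Lemma depends_on_sub (J J' : set nat) f : J `<=` J' -> depends_on J f -> depends_on J' f.
Proof.
move=> JJ' df _ B mB; have := df measurableT B mB.
apply: sub_smallest2r; first exact: smallest_sigma_algebra.
by move=> _ [j [C [Jj mC ->]]]; exists j, C; split=> //; exact: JJ'.
Qed.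

Lemma cylinder_measurable J A : cylinder J A -> measurable A.
Proof.
move=> [s [B [_ _ mB ->]]]; apply: bigsetI_measurable => n _.
by rewrite -[X in measurable X]setTI; exact: mX.
Qed.

Lemma cylinderT J : cylinder J setT.
Proof. by exists [::], (fun=> setT); split=> //; rewrite big_nil. Qed.

Lemma cylinder_setI J : setI_closed (cylinder J).
Proof.
move=> _ _ [s1 [B1 [u1 J1 m1 ->]]] [s2 [B2 [u2 J2 m2 ->]]].
(* The lists may overlap: constraints on a common index are intersected, and a list imposes [setT]
   on the indices it lacks. *)
exists (undup (s1 ++ s2)), (fun n => (if n \in s1 then B1 n else setT) `&`
  (if n \in s2 then B2 n else setT)); split.
- exact: undup_uniq.
- by move=> n; rewrite mem_undup mem_cat => /orP[/J1|/J2].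
- by move=> n; apply: measurableI; case: ifP.
rewrite !in_bigsetI; apply/seteqP; split=> t /=.
  move=> [/allP a1 /allP a2]; apply/allP => n _; apply/asboolP; split.
    by case: ifPn => // /a1 /asboolP.
  by case: ifPn => // /a2 /asboolP.
move=> /allP a; split; apply/allP => n ns; apply/asboolP.
  have : n \in undup (s1 ++ s2) by rewrite mem_undup mem_cat ns.
  by move=> /a /asboolP [+ _]; rewrite ns.
have : n \in undup (s1 ++ s2) by rewrite mem_undup mem_cat ns orbT.
by move=> /a /asboolP [_ +]; rewrite ns.
Qed.

Lemma coord_events_cylinder J : <<s coord_events J >> `<=` <<s cylinder J >>.
Proof.
apply: sub_smallest2r; first exact: smallest_sigma_algebra.
move=> _ [j [B [Jj mB ->]]]; exists [:: j], (fun=> B); split=> //.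
  by move=> n; rewrite inE => /eqP ->.
by rewrite big_seq1.
Qed.

Lemma cylinder_indep (J J' : set nat) A B : (forall n, J n -> ~ J' n) ->
  cylinder J A -> cylinder J' B -> P (A `&` B) = (P A * P B)%E.
Proof.
move=> JJ' [s1 [B1 [u1 J1 m1 ->]]] [s2 [B2 [u2 J2 m2 ->]]].
(* The lists are disjoint, so one family of sets serves both. *)
pose C n := if n \in s1 then B1 n else B2 n.
have e1 : \big[setI/setT]_(n <- s1) (X n @^-1` B1 n) =
    \big[setI/setT]_(n <- s1) (X n @^-1` C n).
  by apply: eq_big_seq => n ns; rewrite /C ns.
have e2 : \big[setI/setT]_(n <- s2) (X n @^-1` B2 n) =
    \big[setI/setT]_(n <- s2) (X n @^-1` C n).
  apply: eq_big_seq => n ns; rewrite /C ifF//; apply/negP => /J1 /JJ'.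
  by apply; exact: J2.
have mC n : measurable (C n) by rewrite /C; case: ifP.
rewrite e1 e2 -big_cat/= !indX ?big_cat//.
rewrite cat_uniq u1 u2 andbT; apply/hasPn => n /J2 J'n; apply/negP => /J1 /JJ'.
by apply.
Qed.

(** Uniqueness of measures: for fixed [B], the finite measures sending [A] to the probability of the
    intersection and to [P A * P B] agree on the pi-system of cylinders. *)
Lemma coord_events_indep_cylinder (J J' : set nat) A B : (forall n, J n -> ~ J' n) ->
  <<s coord_events J >> A -> cylinder J' B -> P (A `&` B) = (P A * P B)%E.
Proof.
move=> JJ' JA J'B; have mB := cylinder_measurable J'B.
pose r : {nonneg R} := NngNum (fine_ge0 (measure_ge0 P B)).
have rE : (r%:num%:E = P B)%E by rewrite /= fineK//; exact: fin_num_measure.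
rewrite muleC -rE -[LHS]/(mrestr P mB A) -[RHS]/(mscale r P A).
apply: (@g_sigma_algebra_measure_unique _ _ _ (cylinder J) _ (fun=> setT)).
- by move=> C /cylinder_measurable.
- by move=> _; exact: cylinderT.
- by apply/seteqP; split=> // t _; exists 0%N.
- exact: cylinder_setI.
- move=> C JC /=; rewrite /mrestr /mscale /= -/(r%:num) rE muleC.
  exact: (cylinder_indep JJ' JC J'B).
- by move=> _; rewrite /= /mrestr/=; rewrite ltey_eq fin_num_measure//; exact: measurableI.
- exact: coord_events_cylinder.
Qed.

(** The same uniqueness argument in the other variable, [A] being now any event of the first
    sigma-algebra. *)
Lemma coord_events_indep (J J' : set nat) A B : (forall n, J n -> ~ J' n) ->
  <<s coord_events J >> A -> <<s coord_events J' >> B ->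
  P (A `&` B) = (P A * P B)%E.
Proof.
move=> JJ' JA J'B; have mA := coord_events_measurable JA.
pose r : {nonneg R} := NngNum (fine_ge0 (measure_ge0 P A)).
have rE : (r%:num%:E = P A)%E by rewrite /= fineK//; exact: fin_num_measure.
rewrite setIC -rE -[LHS]/(mrestr P mA B) -[RHS]/(mscale r P B).
apply: (@g_sigma_algebra_measure_unique _ _ _ (cylinder J') _ (fun=> setT)).
- by move=> C /cylinder_measurable.
- by move=> _; exact: cylinderT.
- by apply/seteqP; split=> // t _; exists 0%N.
- exact: cylinder_setI.
- move=> C JC /=; rewrite /mrestr /mscale /= -/(r%:num) rE setIC.
  exact: (coord_events_indep_cylinder JJ' JA JC).
- by move=> _; rewrite /= /mrestr/=; rewrite ltey_eq fin_num_measure//; exact: measurableI.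
- exact: coord_events_cylinder.
Qed.

(** The only form in which the independence of the sample is used from here on. *)
Lemma mean_depends_on (J J' : set nat) (f g : T -> R) : (forall n, J n -> ~ J' n) ->
  depends_on J f -> depends_on J' g -> has_mean P f -> has_mean P g ->
  has_mean P (fun t => f t * g t) /\
  mean P (fun t => f t * g t) = mean P f * mean P g.
Proof.
move=> JJ' Jf J'g sf sg; apply: mean_indep => // A B mA mB.
apply: (coord_events_indep JJ'); rewrite -[X in _ X]setTI; [exact: Jf|exact: J'g].
Qed.

Hypothesis idX : identically_distributed P X.

Lemma mean_identically_distributed n (h : R -> R) : measurable_fun setT h ->
  has_mean P (fun t => h (X 0%N t)) ->
  has_mean P (fun t => h (X n t)) /\
  mean P (fun t => h (X n t)) = mean P (fun t => h (X 0%N t)).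
Proof.
move=> mh sh.
pose X0 : {RV P >-> R} := HB.pack (X 0%N) (isMeasurableFun.Build _ _ _ _ (X 0%N) (mX 0%N)).
pose Xn : {RV P >-> R} := HB.pack (X n) (isMeasurableFun.Build _ _ _ _ (X n) (mX n)).
have eq_int (u : R -> \bar R) :
    (\int[distribution P Xn]_z u z = \int[distribution P X0]_z u z)%E.
  by apply: eq_measure_integral => C mC _; exact: idX.
have s0 := (has_mean_distribution X0 mh).1 sh.
have sn : has_mean (distribution P Xn) h.
  have /integrableP[_ i] := s0; apply/integrableP; split.
    exact/measurable_EFinP.
  by rewrite eq_int.
have sn' := (has_mean_distribution Xn mh).2 sn.
split=> //.
rewrite -[LHS](mean_distribution (X := Xn) mh)// -[RHS](mean_distribution (X := X0) mh)//.
by rewrite /mean /Rintegral eq_int.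
Qed.
End past_future.

(** * Characteristic functions of K-dependent sums *)

Section elementary.
Context {R : realType}.
Implicit Types x y : R.

(** Mean value theorem on [[0, x]]. In each of the next four lemmas the derivative of the difference
    is the preceding difference, starting from [cos <= 1]. *)
Lemma ge0_derive_ge0 (f df : R -> R) : f 0 = 0 ->
  (forall x, is_derive x 1 f (df x)) -> (forall x, 0 <= x -> 0 <= df x) ->
  forall x, 0 <= x -> 0 <= f x.
Proof.
move=> f0 dfP df0 x x0.
have cf : {within `[0, x], continuous f}.
  apply: continuous_subspaceT => y; apply: differentiable_continuous.
  by apply/derivable1_diffP; case: (dfP y).
have [c c0x] := MVT_segment x0 (fun y _ => dfP y) cf.
rewrite f0 !subr0 => ->; apply: mulr_ge0 => //; apply: df0.
by move: c0x; rewrite in_itv/= => /andP[].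
Qed.

Lemma sin_ub x : 0 <= x -> sin x <= x.
Proof.
move=> x0; rewrite -subr_ge0.
apply: (@ge0_derive_ge0 (fun x => x - sin x) (fun x => 1 - cos x)) => //.
- by rewrite sin0 subrr.
Qed.

Lemma cos_lb x : 0 <= x -> 1 - x ^+ 2 / 2 <= cos x.
Proof.
move=> x0; rewrite -subr_ge0.
apply: (@ge0_derive_ge0 (fun x => cos x - (1 - x ^+ 2 / 2)) (fun x => x - sin x)) => //.
- by rewrite cos0 expr0n/= mul0r subr0 subrr.
- by move=> y; apply: is_derive_eq; rewrite /GRing.scale /=; field.
- by move=> y y0; rewrite subr_ge0 sin_ub.
Qed.

Lemma sin_lb x : 0 <= x -> x - x ^+ 3 / 6 <= sin x.
Proof.
move=> x0; rewrite -subr_ge0.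
apply: (@ge0_derive_ge0 (fun x => sin x - (x - x ^+ 3 / 6))
  (fun x => cos x - (1 - x ^+ 2 / 2))) => //.
- by rewrite sin0 expr0n/= mul0r !subr0.
- by move=> y; apply: is_derive_eq; rewrite /GRing.scale /=; field.
- by move=> y y0; rewrite subr_ge0 cos_lb.
Qed.

Lemma cos_ub x : 0 <= x -> cos x <= 1 - x ^+ 2 / 2 + x ^+ 4 / 24.
Proof.
move=> x0; rewrite -subr_ge0.
apply: (@ge0_derive_ge0 (fun x => 1 - x ^+ 2 / 2 + x ^+ 4 / 24 - cos x)
  (fun x => sin x - (x - x ^+ 3 / 6))) => //.
- by rewrite cos0 !expr0n/= !mul0r subr0 addr0 subrr.
- by move=> y; apply: is_derive_eq; rewrite /GRing.scale /=; field.
- by move=> y y0; rewrite subr_ge0 sin_lb.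
Qed.

Lemma norm_cos_taylor x : `|cos x - (1 - x ^+ 2 / 2)| <= x ^+ 4.
Proof.
have x4 : x ^+ 4 = `|x| ^+ 4 by rewrite -[RHS]normrX ger0_norm// exprn_even_ge0.
rewrite x4 -cos_norm -(real_normK (num_real x)).
have x0 := normr_ge0 x; have l := cos_lb x0; have u := cos_ub x0.
have : 0 <= `|x| ^+ 4 by rewrite exprn_ge0.
set z := `|x| in l u *; move=> z4; rewrite ger0_norm ?subr_ge0//.
lra.
Qed.

Lemma norm_sin_taylor x : `|sin x - x| <= `|x| ^+ 3.
Proof.
wlog x0 : x / 0 <= x => [h|].
  have [/h //|/ltW x0] := leP 0 x.
  by have := h (- x); rewrite oppr_ge0 sinN -opprD !normrN => ->.
have l := sin_lb x0; have u := sin_ub x0.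
rewrite ler0_norm ?subr_le0// ger0_norm//; have : 0 <= x ^+ 3 by rewrite exprn_ge0.
lra.
Qed.

Lemma norm_sin_le x : `|sin x| <= `|x|.
Proof.
wlog x0 : x / 0 <= x => [h|].
  have [/h //|/ltW x0] := leP 0 x.
  by rewrite -normrN -sinN -(normrN x) h ?oppr_ge0.
have u := sin_ub x0; rewrite (ger0_norm x0) ler_norml u andbT.
(* Sine is nonnegative up to 2; beyond 2, [sin x >= -1] is enough. *)
have [x1|x1] := leP x 2.
  have : 0 <= sin x; last lra.
  move: x0; rewrite le_eqVlt => /predU1P[<-|x0]; first by rewrite sin0.
  move: x1; rewrite le_eqVlt => /predU1P[->|x2]; last by rewrite ltW// sin2_gt0 ?x0.
  by apply: sin_ge0_pi; rewrite ler0n/= pi_ge2.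
have := sin_geN1 x; lra.
Qed.

Lemma cos_lipschitz x y : `|cos x - cos y| <= `|x - y|.
Proof.
pose a := (x + y) / 2; pose b := (x - y) / 2.
have -> : x = a + b by rewrite /a /b; field.
have -> : y = a - b by rewrite /a /b; field.
rewrite cosD cosB (_ : _ - _ - _ = - (2 * (sin a * sin b))); last by ring.
rewrite (_ : a + b - (a - b) = 2 * b); last by ring.
rewrite normrN normrM [leRHS]normrM ler_wpM2l// normrM.
by apply: le_trans (norm_sin_le b); rewrite ler_piMl ?sin_max.
Qed.

Lemma expRN_lipschitz x y : 0 <= x -> 0 <= y -> `|expR (- x) - expR (- y)| <= `|x - y|.
Proof.
wlog xy : x y / x <= y => [h x0 y0|x0 y0].
  have [xy|/ltW yx] := leP x y; first exact: h.
  by rewrite distrC [leRHS]distrC; apply: h.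
rewrite ger0_norm ?subr_ge0 ?ler_expR ?lerN2//.
rewrite (_ : expR (- y) = expR (- x) * expR (x - y)); last first.
  by rewrite -expRD; congr expR; ring.
rewrite -[X in X - _]mulr1 -mulrBr [leRHS]distrC (@ger0_norm _ (y - x)) ?subr_ge0//.
have e := expR_ge1Dx (x - y).
have e1 : expR (- x) <= 1 by rewrite -expR0 ler_expR oppr_le0.
have e0 := expR_ge0 (- x).
apply: (@le_trans _ _ (1 - expR (x - y))); last lra.
rewrite ler_piMl// subr_ge0 -expR0 ler_expR; lra.
Qed.

Lemma expRN_taylor x : 0 <= x -> `|expR (- x) - (1 - x)| <= x ^+ 2.
Proof.
move=> x0; have e := expR_ge1Dx (- x).
rewrite ger0_norm ?subr_ge0// lerBlDr expRN.
(* Use [exp (- x) <= 1 / (1 + x)] and [(1 - x + x^2) (1 + x) = 1 + x^3 >= 1]. *)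
have x1 : 0 < 1 + x by lra.
apply: (@le_trans _ _ (1 + x)^-1).
  by rewrite lef_pV2 ?posrE ?expR_gt0// expR_ge1Dx.
rewrite -[leLHS]mul1r ler_pdivrMr//.
have : 0 <= x ^+ 3 by rewrite exprn_ge0.
lra.
Qed.

End elementary.

(** * Moments up to order four *)

Section powers.
Context {d : measure_display} {T : measurableType d} {R : realType}
  (P : probability T R).
Implicit Types f g : T -> R.

Lemma norm_le_pow4 (x : R) k : (k <= 4)%N -> `|x| ^+ k <= 1 + x ^+ 4.
Proof.
move=> k4; have -> : x ^+ 4 = `|x| ^+ 4 by rewrite -[RHS]normrX ger0_norm// exprn_even_ge0.
have [x1|x1] := leP `|x| 1.
  by apply: (@le_trans _ _ 1); rewrite ?exprn_ile1// lerDl exprn_ge0.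
by apply: (@le_trans _ _ (`|x| ^+ 4)); rewrite ?ler_weXn2l ?ltW// ltrDr.
Qed.

Lemma norm_le_1Dsqr (x : R) : `|x| <= 1 + x ^+ 2.
Proof.
by rewrite -(real_normK (num_real x)); have := sqr_ge0 (`|x| - 1); have := normr_ge0 x; nra.
Qed.

Lemma normM_le_sqrD (x y : R) : `|x * y| <= x ^+ 2 + y ^+ 2.
Proof.
rewrite normrM -(real_normK (num_real x)) -(real_normK (num_real y)).
by have := sqr_ge0 (`|x| - `|y|); have := normr_ge0 x; have := normr_ge0 y; nra.
Qed.

Lemma has_meanX f k : (k <= 4)%N -> measurable_fun setT f ->
  has_mean P (fun t => f t ^+ 4) -> has_mean P (fun t => f t ^+ k).
Proof.
move=> k4 mf sf; apply: has_mean_le (has_meanD (has_mean_cst P 1) sf).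
  exact: measurable_funX.
by move=> x; rewrite normrX norm_le_pow4.
Qed.

Lemma has_meanX1 f : measurable_fun setT f ->
  has_mean P (fun t => f t ^+ 4) -> has_mean P f.
Proof. by move=> mf /(@has_meanX _ 1 isT mf). Qed.

Lemma pow4D_le (x y : R) : (x + y) ^+ 4 <= 8 * (x ^+ 4 + y ^+ 4).
Proof.
have sqrD (a b : R) : (a + b) ^+ 2 <= 2 * (a ^+ 2 + b ^+ 2).
  by have := sqr_ge0 (a - b); rewrite sqrrB sqrrD; lra.
rewrite (_ : (x + y) ^+ 4 = ((x + y) ^+ 2) ^+ 2); last by rewrite -exprM.
apply: (@le_trans _ _ ((2 * (x ^+ 2 + y ^+ 2)) ^+ 2)).
  by rewrite lerXn2r ?nnegrE ?sqr_ge0 ?mulr_ge0 ?addr_ge0 ?sqr_ge0// sqrD.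
have := sqrD (x ^+ 2) (y ^+ 2); rewrite -!exprM exprMn; lra.
Qed.

Lemma has_mean_pow4D f g : measurable_fun setT f -> measurable_fun setT g ->
  has_mean P (fun t => f t ^+ 4) -> has_mean P (fun t => g t ^+ 4) ->
  has_mean P (fun t => (f t + g t) ^+ 4).
Proof.
move=> mf mg sf sg; apply: has_mean_le (has_meanZ 8 (has_meanD sf sg)).
  by apply: measurable_funX; exact: measurable_funD.
by move=> x; rewrite ger0_norm ?exprn_even_ge0// pow4D_le.
Qed.

Lemma has_mean_pow4Z f c : has_mean P (fun t => f t ^+ 4) ->
  has_mean P (fun t => (c * f t) ^+ 4).
Proof. by move=> sf; under eq_fun do rewrite exprMn; exact: has_meanZ. Qed.

Lemma has_mean_pow4_sum I (s : seq I) (F : I -> T -> R) :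
  (forall i, measurable_fun setT (F i)) ->
  (forall i, has_mean P (fun t => F i t ^+ 4)) ->
  has_mean P (fun t => (\sum_(i <- s) F i t) ^+ 4).
Proof.
move=> mF sF; elim: s => [|i s IH].
  by under eq_fun do rewrite big_nil; exact: has_mean_cst.
under eq_fun do rewrite big_cons; apply: has_mean_pow4D => //.
exact: measurable_sum.
Qed.

Lemma has_meanM f g : measurable_fun setT f -> measurable_fun setT g ->
  has_mean P (fun t => f t ^+ 2) -> has_mean P (fun t => g t ^+ 2) ->
  has_mean P (fun t => f t * g t).
Proof.
move=> mf mg sf sg; apply: has_mean_le (has_meanD sf sg).
  exact: measurable_funM.
by move=> x; exact: normM_le_sqrD.
Qed.

End powers.

(** Each term costs a factor 8 by [pow4D_le], and [8 (1 + 16^n) <= 16^(n+1)]. The crude constant is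
    harmless: the lists in question, a block and the index set of the coordinates, do not grow with
    [N]. *)
Lemma mean_pow4_sum_le {d} {T : measurableType d} {R : realType} (P : probability T R)
    J (s : seq J) (F : J -> T -> R) (C : R) : 0 <= C ->
  (forall j, measurable_fun setT (F j)) ->
  (forall j, has_mean P (fun t => F j t ^+ 4)) ->
  (forall j, mean P (fun t => F j t ^+ 4) <= C) ->
  mean P (fun t => (\sum_(j <- s) F j t) ^+ 4) <= 16 ^+ size s * C.
Proof.
move=> C0 mF sF FC; elim: s => [|a s IH].
  under [X in mean P X]eq_fun do rewrite big_nil expr0n/=.
  by rewrite mean_cst expr0 mul1r.
have s4 (q : seq J) : has_mean P (fun t => (\sum_(j <- q) F j t) ^+ 4).
  exact: has_mean_pow4_sum.
apply: (@le_trans _ _ (mean P (fun t => 8 * (F a t ^+ 4 + (\sum_(j <- s) F j t) ^+ 4)))).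
  apply: mean_le => //; first by apply: has_meanZ; apply: has_meanD.
  by move=> t; rewrite big_cons pow4D_le.
rewrite meanZ ?meanD//; last exact: has_meanD.
have := FC a; have : 1 <= 16 ^+ size s :> R by rewrite exprn_ege1// ler1n.
by rewrite exprS; nra.
Qed.

(** * Adding one independent summand *)

Section step.
Context {d : measure_display} {T : measurableType d} {R : realType}
  (P : probability T R) (X : nat -> T -> R).
Hypothesis mX : forall n, measurable_fun setT (X n).
Hypothesis indX : mutually_independent P X.

Lemma has_mean_cos (f : T -> R) : measurable_fun setT f -> has_mean P (fun t => cos (f t)).
Proof.
move=> mf; apply: (@has_mean_bounded _ _ _ _ _ 1) => [|x]; last exact: cos_max.
by apply: measurableT_comp => //; apply: continuous_measurable_fun; exact: continuous_cos.
Qed.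

Lemma has_mean_sin (f : T -> R) : measurable_fun setT f -> has_mean P (fun t => sin (f t)).
Proof.
move=> mf; apply: (@has_mean_bounded _ _ _ _ _ 1) => [|x]; last exact: sin_max.
by apply: measurableT_comp => //; apply: continuous_measurable_fun; exact: continuous_sin.
Qed.

Lemma depends_on_cos (J : set nat) (f : T -> R) : depends_on X J f ->
  depends_on X J (fun t => cos (f t)).
Proof.
by apply: measurableT_comp; apply: continuous_measurable_fun; exact: continuous_cos.
Qed.

Lemma depends_on_sin (J : set nat) (f : T -> R) : depends_on X J f ->
  depends_on X J (fun t => sin (f t)).
Proof.
by apply: measurableT_comp; apply: continuous_measurable_fun; exact: continuous_sin.
Qed.

Lemma norm_mean_cos_le1 (f : T -> R) : measurable_fun setT f ->
  `|mean P (fun t => cos (f t))| <= 1.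
Proof.
move=> mf; apply: norm_mean_bound; last by move=> x; exact: cos_max.
exact: has_mean_measurable (has_mean_cos mf).
Qed.

Lemma norm_mean_sin_le1 (f : T -> R) : measurable_fun setT f ->
  `|mean P (fun t => sin (f t))| <= 1.
Proof.
move=> mf; apply: norm_mean_bound; last by move=> x; exact: sin_max.
exact: has_mean_measurable (has_mean_sin mf).
Qed.

(** The addition formula and independence give [A * a - B * b], where [a] is within [O(r^4)] of
    [exp (- r^2 w / 2)] by the Taylor bounds and [b] is [O(r^3)] because [U] is centred. The mean
    sine [B] need only be bounded by 1, so no companion statement for sines is required. As
    [r <= 1], everything is absorbed in [r^3]. *)
Lemma charfun_step (J J' : set nat) (V U : T -> R) (r w M th : R) :
  (forall n, J n -> ~ J' n) -> depends_on X J V -> depends_on X J' U ->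
  has_mean P (fun t => U t ^+ 4) -> mean P U = 0 ->
  mean P (fun t => U t ^+ 2) = w -> mean P (fun t => U t ^+ 4) <= M ->
  0 <= r <= 1 ->
  `|mean P (fun t => cos (V t + r * U t + th)) -
    expR (- (r ^+ 2 * w / 2)) * mean P (fun t => cos (V t + th))| <=
  r ^+ 3 * (2 * M + w ^+ 2 + w).
Proof.
move=> JJ' JV J'U s4 m1 m2 m4 /andP[r0 r1].
have mV := depends_on_measurable mX JV; have mU := depends_on_measurable mX J'U.
have mVt : measurable_fun setT (fun t => V t + th) by exact: measurable_funD.
have mrU : measurable_fun setT (fun t => r * U t) by exact: measurable_funM.
have dVt : depends_on X J (fun t => V t + th) by exact: measurable_funD.
have drU : depends_on X J' (fun t => r * U t) by exact: measurable_funM.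
set A := mean P (fun t => cos (V t + th)).
pose B := mean P (fun t => sin (V t + th)).
pose a := mean P (fun t => cos (r * U t)).
pose b := mean P (fun t => sin (r * U t)).
set e := expR _.
have -> : mean P (fun t => cos (V t + r * U t + th)) = A * a - B * b.
  have [sc ec] := mean_depends_on mX indX JJ' (depends_on_cos dVt) (depends_on_cos drU)
    (has_mean_cos mVt) (has_mean_cos mrU).
  have [ss es] := mean_depends_on mX indX JJ' (depends_on_sin dVt) (depends_on_sin drU)
    (has_mean_sin mVt) (has_mean_sin mrU).
  rewrite /A /B /a /b -ec -es -meanB//; congr mean; apply/funext => t.
  by rewrite -cosD; congr cos; rewrite addrAC.
have -> : A * a - B * b - e * A = A * (a - e) - B * b by ring.
have sU2 := has_meanX (isT : (2 <= 4)%N) mU s4.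
have ha : `|a - (1 - r ^+ 2 * w / 2)| <= r ^+ 4 * M.
  have -> : 1 - r ^+ 2 * w / 2 = mean P (fun t => 1 - (r * U t) ^+ 2 / 2).
    rewrite (_ : (fun t => _) = (fun t => 1 - (r ^+ 2 / 2) * U t ^+ 2)); last first.
      by apply/funext => t; rewrite exprMn; field.
    rewrite meanB; [|exact: has_mean_cst|exact: has_meanZ].
    by rewrite mean_cst meanZ// m2; field.
  apply: (@le_trans _ _ (mean P (fun t => (r * U t) ^+ 4))).
    apply: dist_mean_le.
    - exact: has_mean_cos.
    - apply: has_meanB; first exact: has_mean_cst.
      rewrite (_ : (fun t => _) = (fun t => (r ^+ 2 / 2) * U t ^+ 2)); last first.
        by apply/funext => t; rewrite exprMn; field.
      exact: has_meanZ.
    - exact: has_mean_pow4Z.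
    - by move=> t; exact: norm_cos_taylor.
  under [X in mean P X]eq_fun do rewrite exprMn.
  by rewrite meanZ// ler_wpM2l// exprn_ge0.
have w0 : 0 <= w by rewrite -m2; apply: mean_ge0 => t; exact: sqr_ge0.
have M0 : 0 <= M.
  by apply: le_trans m4; apply: mean_ge0 => t; rewrite exprn_even_ge0.
have he : `|e - (1 - r ^+ 2 * w / 2)| <= r ^+ 4 * w ^+ 2.
  have x0 : 0 <= r ^+ 2 * w / 2 by rewrite divr_ge0// mulr_ge0// sqr_ge0.
  apply: le_trans (expRN_taylor x0) _.
  rewrite (_ : (r ^+ 2 * w / 2) ^+ 2 = (r ^+ 4 * w ^+ 2) / 4); last by field.
  have : 0 <= r ^+ 4 * w ^+ 2 by rewrite mulr_ge0 ?exprn_ge0.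
  lra.
have hb : `|b| <= r ^+ 3 * (w + M).
  (* Since [U] has mean 0, the linear term of the sine may be subtracted. *)
  have -> : b = b - mean P (fun t => r * U t).
    by rewrite meanZ ?m1 ?mulr0 ?subr0//; exact: has_meanX1.
  apply: (@le_trans _ _ (mean P (fun t => r ^+ 3 * (U t ^+ 2 + U t ^+ 4)))).
    apply: dist_mean_le.
    - exact: has_mean_sin.
    - by apply: has_meanZ; exact: has_meanX1.
    - by apply: has_meanZ; exact: has_meanD.
    - move=> t; apply: le_trans (norm_sin_taylor _) _.
      rewrite normrM exprMn (ger0_norm r0) ler_wpM2l ?exprn_ge0//.
      have -> : U t ^+ 4 = (`|U t| ^+ 2) ^+ 2 by rewrite real_normK ?num_real// -exprM.
      rewrite -(real_normK (num_real (U t))).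
      (* The inequality [u^3 <= u^2 + u^4] follows from the square of [u (u - 1)]. *)
      have u0 := normr_ge0 (U t); set u := `|U t| in u0 *.
      have := sqr_ge0 (u * (u - 1)); have := sqr_ge0 u; rewrite -!exprM /= !exprMn.
      by nra.
  rewrite meanZ; last exact: has_meanD.
  by rewrite meanD// m2 ler_wpM2l ?exprn_ge0// lerD2l.
have r43 : r ^+ 4 <= r ^+ 3 by rewrite ler_wiXn2l.
have A1 : `|A| <= 1 by exact: norm_mean_cos_le1.
have B1 : `|B| <= 1 by exact: norm_mean_sin_le1.
have ae : `|a - e| <= r ^+ 4 * M + r ^+ 4 * w ^+ 2.
  rewrite (_ : a - e = (a - (1 - r ^+ 2 * w / 2)) - (e - (1 - r ^+ 2 * w / 2))); last by ring.
  by apply: le_trans (ler_normB _ _) _; exact: lerD.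
apply: le_trans (ler_normB _ _) _; rewrite !normrM.
apply: (@le_trans _ _ (`|a - e| + `|b|)); first by apply: lerD; rewrite ler_piMl.
apply: le_trans (lerD ae hb) _.
apply: (@le_trans _ _ (r ^+ 3 * M + r ^+ 3 * w ^+ 2 + r ^+ 3 * (w + M))); last first.
  by rewrite le_eqVlt; apply/orP; left; apply/eqP; ring.
by rewrite lerD2r lerD// ler_wpM2r// sqr_ge0.
Qed.

End step.

(** * Sums over separated blocks *)

Section clt.
Context {d : measure_display} {T : measurableType d} {R : realType}
  (P : probability T R) (X : nat -> T -> R).
Hypothesis mX : forall n, measurable_fun setT (X n).
Hypothesis indX : mutually_independent P X.
Variables (D : nat -> T -> R) (K : nat) (s2 C : R).
Hypothesis depD : forall a, depends_on X [set j | (a <= j <= a + K)%N] (D a).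
Hypothesis sD4 : forall a, has_mean P (fun t => D a t ^+ 4).
Hypothesis D1 : forall a, mean P (D a) = 0.
Hypothesis D2 : forall a b, mean P (fun t => D a t * D b t) = (a == b)%:R * s2.
Hypothesis D4 : forall a, mean P (fun t => D a t ^+ 4) <= C.

Let mD a : measurable_fun setT (D a).
Proof. exact: depends_on_measurable. Qed.

Let s2_ge0 : 0 <= s2.
Proof.
rewrite -[s2]mul1r -[1](_ : (0%N == 0%N)%:R = _)// -D2.
by apply: mean_ge0 => t; rewrite -expr2 sqr_ge0.
Qed.

Let sDD a b : has_mean P (fun t => D a t * D b t).
Proof. by apply: has_meanM => //; apply: has_meanX. Qed.

Lemma mean_sqr_sum (s : seq nat) : uniq s ->
  mean P (fun t => (\sum_(a <- s) D a t) ^+ 2) = (size s)%:R * s2.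
Proof.
move=> us.
rewrite (_ : (fun t => _) = (fun t => \sum_(a <- s) \sum_(b <- s) D a t * D b t)); last first.
  by apply/funext => t; rewrite expr2 big_distrlr.
rewrite mean_sum => [|a _]; last by apply: has_mean_sum.
rewrite (eq_big_seq (fun=> s2)).
  by rewrite big_const_seq count_predT iter_addr_0 mulr_natl.
move=> a sa /=; rewrite mean_sum => [|b _]; last exact: sDD.
rewrite (bigD1_seq a)//= D2 eqxx mul1r big1 ?addr0// => b ba.
by rewrite D2 eq_sym (negbTE ba) mul0r.
Qed.

Let msum (s : seq nat) : measurable_fun setT (fun t => \sum_(a <- s) D a t).
Proof. exact: measurable_sum. Qed.

Let ssum4 (s : seq nat) : has_mean P (fun t => (\sum_(a <- s) D a t) ^+ 4).
Proof. exact: has_mean_pow4_sum. Qed.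

Let ssum2 (s : seq nat) : has_mean P (fun t => (\sum_(a <- s) D a t) ^+ 2).
Proof. exact: (@has_meanX _ _ _ P _ 2). Qed.

Let C_ge0 : 0 <= C.
Proof. by apply: le_trans (D4 0%N); apply: mean_ge0 => t; rewrite exprn_even_ge0. Qed.

(** Pointwise [|y| <= eta + y^2 / eta], which turns the variance into an L1 bound. A small [eta]
    serves to discard the gaps; [eta = 1] later gives tightness. *)
Lemma mean_norm_sum (s : seq nat) (r eta : R) : uniq s -> 0 < eta ->
  mean P (fun t => `|r * \sum_(a <- s) D a t|) <= eta + r ^+ 2 * (size s)%:R * s2 / eta.
Proof.
move=> us eta0.
pose g t := eta + (r ^+ 2 / eta) * (\sum_(a <- s) D a t) ^+ 2.
have sg : has_mean P g by apply: has_meanD; [exact: has_mean_cst|exact: has_meanZ].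
apply: (@le_trans _ _ (mean P g)).
  apply: mean_le => //.
    by apply: has_mean_norm; apply: has_meanZ; apply: has_meanX1.
  move=> t; rewrite /g; set x := \sum_(a <- s) _.
  rewrite (_ : _ / eta * x ^+ 2 = (r * x) ^+ 2 / eta); last by rewrite exprMn; field; rewrite gt_eqF.
  rewrite -(real_normK (num_real (r * x))); set y := `|_|.
  rewrite -(ler_pM2r eta0) mulrDl divfK ?gt_eqF//.
  have y0 : 0 <= y by exact: normr_ge0.
  by have := sqr_ge0 (y - eta); nra.
rewrite meanD; [|exact: has_mean_cst|exact: has_meanZ].
rewrite mean_cst meanZ// mean_sqr_sum// lerD2l le_eqVlt; apply/orP; left; apply/eqP.
by field; rewrite gt_eqF.
Qed.

Variable p : nat.
Let L := (p + K)%N.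

(** A period has length [L = p + K]: since [D a] looks at most [K] indices ahead, the sum over block
    [b] only sees coordinates in [[b L, (b + 1) L)]. *)
Definition block (b : nat) : seq nat := [seq (b * L + a)%N | a <- iota 0 p].

Let block_uniq b : uniq (block b).
Proof. by rewrite map_inj_uniq ?iota_uniq// => x y /addnI. Qed.

Let size_block b : size (block b) = p.
Proof. by rewrite size_map size_iota. Qed.

Lemma depends_on_sum (J : set nat) (s : seq nat) : (forall a, a \in s -> depends_on X J (D a)) ->
  depends_on X J (fun t => \sum_(a <- s) D a t).
Proof.
move=> dJ.
(* Terms outside [s] are replaced by 0, because [measurable_sum] wants every summand of the family
   measurable. *)
have -> : (fun t => \sum_(a <- s) D a t) =
    (fun t => \sum_(a <- s) (if a \in s then D a t else 0)).
  by apply/funext => t; rewrite [LHS]big_seq [RHS]big_seq; apply: eq_bigr => a ->.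
apply: measurable_sum => a.
by have [/dJ|_] := boolP (a \in s); last exact: measurable_cst.
Qed.

Let depends_block b :
  depends_on X [set j | (b * L <= j < b.+1 * L)%N] (fun t => \sum_(a <- block b) D a t).
Proof.
apply: depends_on_sum => _ /mapP[a + ->]; rewrite mem_iota add0n => /andP[_ ap].
apply: depends_on_sub; last exact: depD.
move=> j /= /andP[j1 j2].
rewrite (leq_trans _ j1) ?leq_addr//=.
by apply: leq_ltn_trans j2 _; rewrite mulSn -addnA [(L + _)%N]addnC ltn_add2l ltn_add2r.
Qed.

(** One [charfun_step] per block. The errors merely add up, since an earlier error is multiplied by
    [exp (- e) <= 1]. *)
Lemma block_charfun (n : nat) (r th : R) : 0 <= r <= 1 ->
  `|mean P (fun t => cos (r * (\sum_(b < n) \sum_(a <- block b) D a t) + th)) -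
    expR (- (n%:R * (r ^+ 2 * (p%:R * s2) / 2))) * cos th| <=
  n%:R * (r ^+ 3 * (2 * (16 ^+ p * C) + (p%:R * s2) ^+ 2 + p%:R * s2)).
Proof.
move=> r01; set e := r ^+ 2 * (p%:R * s2) / 2; set B := r ^+ 3 * _.
have e0 : 0 <= e by rewrite divr_ge0// mulr_ge0 ?sqr_ge0// mulr_ge0.
elim: n => [|n IH].
  under [X in mean P X]eq_fun do rewrite big_ord0 mulr0 add0r.
  by rewrite mean_cst !mul0r oppr0 expR0 mul1r subrr normr0.
pose V t := r * (\sum_(b < n) \sum_(a <- block b) D a t).
pose U t := \sum_(a <- block n) D a t.
have dV : depends_on X [set j | (j < n * L)%N] V.
  apply: measurable_funM; first exact: measurable_cst.
  apply: measurable_sum => b; apply: depends_on_sub; last exact: depends_block.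
  move=> j /=; by move=> /andP[_] /leq_trans; apply; rewrite leq_mul2r ltn_ord orbT.
have dU : depends_on X [set j | (n * L <= j < n.+1 * L)%N] U by exact: depends_block.
have step := charfun_step mX indX (J := [set j | (j < n * L)%N]) (V := V) (U := U)
  (r := r) (w := p%:R * s2) (M := 16 ^+ p * C) th _ dV dU (ssum4 _)
  _ _ _ r01.
set A1 := mean P _.
have {}step : `|A1 - expR (- e) * mean P (fun t => cos (V t + th))| <= B.
  rewrite /A1; under [X in mean P X]eq_fun do rewrite big_ord_recr/= mulrDr.
  apply: step.
  - by move=> j /= jn /andP[]; rewrite leqNgt jn.
  - rewrite mean_sum => [|a _]; last exact: has_meanX1.
    by rewrite big1.
  - by rewrite mean_sqr_sum// size_block.
  - by rewrite -[p in leRHS](size_block n); exact: mean_pow4_sum_le.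
have -> : expR (- (n.+1%:R * e)) = expR (- e) * expR (- (n%:R * e)).
  by rewrite -expRD -natr1; congr expR; ring.
set A := mean P (fun t => cos (V t + th)) in step.
set f := expR (- (n%:R * e)) in IH *.
rewrite (_ : A1 - _ = (A1 - expR (- e) * A) + expR (- e) * (A - f * cos th)); last by ring.
apply: le_trans (ler_normD _ _) _.
rewrite -natr1 mulrDl mul1r [leRHS]addrC; apply: lerD => //.
rewrite normrM ger0_norm ?expR_ge0//; apply: le_trans IH.
by rewrite ler_piMl// -expR0 ler_expR oppr_le0.
Qed.
End clt.

Section clt_limit.
Context {d : measure_display} {T : measurableType d} {R : realType}
  (P : probability T R) (X : nat -> T -> R).
Hypothesis mX : forall n, measurable_fun setT (X n).
Hypothesis indX : mutually_independent P X.
Variables (D : nat -> T -> R) (K : nat) (s2 C : R).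
Hypothesis depD : forall a, depends_on X [set j | (a <= j <= a + K)%N] (D a).
Hypothesis sD4 : forall a, has_mean P (fun t => D a t ^+ 4).
Hypothesis D1 : forall a, mean P (D a) = 0.
Hypothesis D2 : forall a b, mean P (fun t => D a t * D b t) = (a == b)%:R * s2.
Hypothesis D4 : forall a, mean P (fun t => D a t ^+ 4) <= C.

(** [s] collects the gaps and everything after the last full period. Quotient and remainder modulo
    [p + K] recover the pair [(b, a)] from its index, so block positions are enumerated without
    repetition. *)
Lemma perm_blocks (p n N : nat) : (n * (p + K) <= N)%N ->
  exists2 s, perm_eq (iota 0 N) ([seq (b * (p + K) + a)%N | b <- iota 0 n, a <- iota 0 p] ++ s) &
    size s = (N - n * p)%N.
Proof.
set L := (p + K)%N => nN; set s0 := [seq _ | b <- _, a <- _].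
have us0 : uniq s0.
  apply: allpairs_uniq; rewrite ?iota_uniq// => -[b a] [b' a'].
  move=> /allpairsP[[b1 a1] /= []]; rewrite !mem_iota !add0n /= => _ a1p [-> ->].
  move=> /allpairsP[[b2 a2] /= []]; rewrite !mem_iota !add0n /= => _ a2p [-> ->] e.
  have L0 : (0 < L)%N by rewrite addn_gt0 (leq_ltn_trans _ a1p).
  have aL (a3 : nat) : (a3 < p)%N -> (a3 < L)%N by move=> h; rewrite ltn_addr.
  have := congr1 (divn^~ L) e; have := congr1 (modn^~ L) e.
  by rewrite !modnMDl !divnMDl// !modn_small ?divn_small ?aL// !addn0 => -> ->.
have sub x : x \in s0 -> x \in iota 0 N.
  move=> /allpairsP[[b a] /= []]; rewrite !mem_iota !add0n /= => bn ap ->.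
  apply: leq_trans nN; apply: (@leq_trans (b.+1 * L)); last by rewrite leq_mul2r bn orbT.
  by rewrite mulSn addnC ltn_add2r ltn_addr.
set s1 := [seq x <- iota 0 N | x \notin s0].
have pe : perm_eq (iota 0 N) (s0 ++ s1).
  apply: uniq_perm; rewrite ?iota_uniq//.
    rewrite cat_uniq us0 filter_uniq ?iota_uniq// andbT.
    by apply/hasPn => x; rewrite mem_filter => /andP[].
  by move=> x; rewrite mem_cat mem_filter; case: (boolP (x \in s0)) => //= /sub ->.
exists s1 => //.
have := perm_size pe; rewrite size_cat size_allpairs !size_iota => ->.
by rewrite addKn.
Qed.

Let B (p : nat) := 2 * (16 ^+ p * C) + (p%:R * s2) ^+ 2 + p%:R * s2.

(** Cosine is 1-Lipschitz, so dropping the indices outside the blocks costs at most the L1 norm of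
    their scaled sum. *)
Lemma clt_bound (p n N : nat) (r eta th : R) :
  0 <= r <= 1 -> 0 < eta -> (n * (p + K) <= N)%N ->
  `|mean P (fun t => cos (r * (\sum_(a < N) D a t) + th)) -
    expR (- (n%:R * (r ^+ 2 * (p%:R * s2) / 2))) * cos th| <=
  eta + r ^+ 2 * (N - n * p)%:R * s2 / eta + n%:R * (r ^+ 3 * B p).
Proof.
move=> r01 eta0 nN; have [s pe ss] := perm_blocks nN.
have mD a : measurable_fun setT (D a).
  exact: (depends_on_measurable mX (@depD a)).
have sumE t : \sum_(a < N) D a t =
    \sum_(b < n) \sum_(a <- block K p b) D a t + \sum_(a <- s) D a t.
  rewrite -(big_mkord xpredT (D ^~ t)) /index_iota subn0 (perm_big _ pe) big_cat/=.
  congr (_ + _); rewrite big_allpairs_dep -[iota 0 n]/(iota 0 n) -{1}(subn0 n).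
  rewrite -/(index_iota 0 n) big_mkord; apply: eq_bigr => b _.
  by rewrite big_map.
have us : uniq s.
  by have := iota_uniq 0 N; rewrite (perm_uniq pe) cat_uniq => /and3P[].
have mS (s' : seq nat) : measurable_fun setT (fun t => \sum_(a <- s') D a t).
  exact: measurable_sum.
set A := mean P _; set f := expR _ * _.
pose A0 := mean P (fun t => cos (r * (\sum_(b < n) \sum_(a <- block K p b) D a t) + th)).
have mB : measurable_fun setT (fun t => r * (\sum_(b < n) \sum_(a <- block K p b) D a t) + th).
  apply: measurable_funD => //; apply: measurable_funM => //.
  by apply: measurable_sum.
rewrite (_ : A - f = (A - A0) + (A0 - f)); last by ring.
apply: le_trans (ler_normD _ _) _; apply: lerD; last first.
  exact: (block_charfun mX indX depD sD4 D1 D2 D4).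
rewrite -ss; apply: le_trans (mean_norm_sum mX depD sD4 D2 r us eta0).
apply: dist_mean_le.
- apply: has_mean_cos; apply: measurable_funD => //; apply: measurable_funM => //.
  by apply: measurable_sum.
- exact: has_mean_cos.
- apply: has_mean_norm; apply: has_meanZ; apply: has_meanX1 => //.
  exact: has_mean_pow4_sum.
- move=> t; apply: le_trans (cos_lipschitz _ _) _; rewrite sumE le_eqVlt.
  by apply/orP; left; apply/eqP; congr (`|_|); ring.
Qed.

(** For fixed [p] the share of indices outside the blocks tends to [K / (p + K)] at most, and the
    block errors are [O(N^(-1/2))]. *)
Lemma clt_charfun th :
  mean P (fun t => cos ((Num.sqrt N%:R)^-1 * (\sum_(a < N) D a t) + th)) @[N --> \oo]
    --> expR (- (s2 / 2)) * cos th.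
Proof.
have s2_ge0 : 0 <= s2.
  rewrite -[s2]mul1r -[1](_ : (0%N == 0%N)%:R = _)// -D2.
  by apply: mean_ge0 => t; rewrite -expr2 sqr_ge0.
have C_ge0 : 0 <= C.
  by apply: le_trans (D4 0%N); apply: mean_ge0 => t; rewrite exprn_even_ge0.
apply/cvgrPdist_le => e e0.
(* Four errors of at most [eta]: the free [eta] of [mean_norm_sum], the gaps, the incomplete last
   period, and the block expansions. *)
pose eta := e / 4; have eta0 : 0 < eta by rewrite divr_gt0.
(* Coefficient of [rho] in the total: [s2 / eta] from the discarded terms, [s2 / 2] from the
   variance they take away. *)
pose a := s2 / eta + s2 / 2.
have a0 : 0 <= a by rewrite addr_ge0// divr_ge0// ltW.
have [p pP] : exists p : nat, a * K%:R / eta < p%:R.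
  exists (Num.bound (a * K%:R / eta)); apply: archi_boundP.
  by rewrite divr_ge0 ?mulr_ge0// ltW.
have p0 : (0 < p)%N.
  by rewrite -(ltr_nat R); apply: le_lt_trans pP; rewrite divr_ge0 ?mulr_ge0// ltW.
pose L := (p + K)%N; have L0 : (0 < L)%N by rewrite addn_gt0 p0.
have LR0 : 0 < L%:R :> R by rewrite ltr0n.
have B0 : 0 <= B p by rewrite /B !addr_ge0 ?mulr_ge0 ?sqr_ge0 ?exprn_ge0.
near=> N.
have N0 : (0 < N)%N by near: N; exact: nbhs_infty_gt.
have NR0 : 0 < N%:R :> R by rewrite ltr0n.
pose r : R := (Num.sqrt N%:R)^-1; pose n := (N %/ L)%N.
have r0 : 0 < r by rewrite invr_gt0 sqrtr_gt0.
have r2 : r ^+ 2 * N%:R = 1.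
  by rewrite exprVn sqr_sqrtr ?ler0n// mulVf// gt_eqF.
have r1 : r <= 1.
  rewrite invf_le1 ?sqrtr_gt0// -[leLHS]sqrtr1 ler_wsqrtr//.
  by rewrite ler1n.
have nLN : (n * L <= N)%N by exact: leq_trunc_div.
have npN : (n * p <= N)%N by apply: leq_trans nLN; rewrite leq_mul2l leq_addr orbT.
(* As [r^2 = 1 / N], this is the proportion of indices outside the blocks. *)
pose rho := r ^+ 2 * (N - n * p)%:R.
have rho0 : 0 <= rho by rewrite mulr_ge0 ?sqr_ge0.
have rn : r ^+ 2 * n%:R * L%:R <= 1.
  by rewrite -[leRHS]r2 -mulrA -natrM ler_wpM2l ?sqr_ge0 ?ler_nat.
have rhoP : rho <= K%:R / L%:R + r ^+ 2 * L%:R.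
  apply: (@le_trans _ _ (r ^+ 2 * (n * K + L)%:R)).
    rewrite ler_wpM2l ?sqr_ge0// ler_nat leq_subLR addnA -mulnDr.
    by rewrite -/L {1}(divn_eq N L) leq_add2l ltnW// ltn_pmod.
  rewrite natrD mulrDr lerD2r natrM mulrA ler_pdivlMr//.
  by rewrite mulrAC ler_piMl.
have rhoa : a * rho <= eta + a * (r ^+ 2 * L%:R).
  apply: le_trans (ler_wpM2l a0 rhoP) _; rewrite mulrDr lerD2r mulrA.
  rewrite ler_pdivrMr// -ler_pdivrMl//; apply: ltW.
  rewrite mulrC; apply: lt_le_trans pP _.
  by rewrite ler_nat leq_addr.
have hL : a * (r ^+ 2 * L%:R) <= eta.
  have -> : r ^+ 2 = N%:R^-1 by rewrite exprVn sqr_sqrtr ?ler0n.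
  rewrite mulrCA mulrC ler_pdivrMr// -ler_pdivrMl//.
  by near: N; exact: nbhs_infty_ger.
have hB : r * B p <= eta.
  rewrite mulrC ler_pdivrMr ?sqrtr_gt0// -ler_pdivrMl//.
  rewrite -(@ger0_norm _ (eta^-1 * B p)); last by rewrite mulr_ge0// invr_ge0 ltW.
  rewrite -sqrtr_sqr ler_sqrt//.
  by near: N; exact: nbhs_infty_ger.
have r01 : 0 <= r <= 1 by rewrite (ltW r0) r1.
have := @clt_bound p n N r eta th r01 eta0 nLN.
rewrite -/rho -/r.
set A := mean P _; set f := expR (- (n%:R * _)) => bnd.
have ef : `|f - expR (- (s2 / 2))| <= s2 / 2 * rho.
  apply: le_trans (expRN_lipschitz _ _) _.
  - by rewrite mulr_ge0// divr_ge0// mulr_ge0 ?sqr_ge0// mulr_ge0.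
  - by rewrite divr_ge0.
  rewrite (_ : _ - _ = - (s2 / 2 * rho)); first by rewrite normrN ger0_norm// mulr_ge0// divr_ge0.
  by rewrite /rho natrB// mulrBr r2 natrM; field.
have nr3 : n%:R * (r ^+ 3 * B p) <= r * B p.
  have -> : n%:R * (r ^+ 3 * B p) = (r ^+ 2 * n%:R) * (r * B p) by ring.
  apply: ler_piMl; first by rewrite mulr_ge0// ltW.
  have L1 : 1 <= L%:R :> R by rewrite ler1n.
  by apply: le_trans rn; rewrite ler_peMr// mulr_ge0// sqr_ge0.
rewrite distrC -/r -/A.
rewrite (_ : A - _ = (f - expR (- (s2 / 2))) * cos th + (A - f * cos th)); last by ring.
apply: le_trans (ler_normD _ _) _.
have h1 : `|(f - expR (- (s2 / 2))) * cos th| <= s2 / 2 * rho.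
  by apply: le_trans ef; rewrite normrM ler_piMr ?cos_max.
apply: le_trans (lerD h1 bnd) _.
have : eta = e / 4 by [].
have : rho * s2 / eta + s2 / 2 * rho = a * rho by rewrite /a; ring.
lra.
Unshelve. all: end_near.
Qed.

End clt_limit.

(** * Gaussian vectors *)

Section gauss.
Context {R : realType}.
Let mu : {measure set (measurableTypeR R) -> \bar R} := @lebesgue_measure R.

(** Fundamental theorem of calculus on growing intervals, with dominated convergence for the
    integrals and vanishing boundary values. *)
Lemma Rintegral_derive_eq0 (F f : R -> R) :
  (forall x : R, is_derive x 1 F (f x)) -> continuous f ->
  mu.-integrable setT (EFin \o f) ->
  F n%:R @[n --> \oo] --> 0 -> F (- n%:R) @[n --> \oo] --> 0 ->
  Rintegral mu setT f = 0.
Proof.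
move=> dF cf intf Fp Fm.
have cF : continuous F.
  by move=> x; apply: differentiable_continuous; apply/derivable1_diffP; case: (dF x).
pose I (n : nat) : set R := `[- n%:R, n%:R]%classic.
(* [n.+1] keeps the interval nondegenerate. *)
have FTC n : (\int[mu]_(x in I n.+1) (f x)%:E = (F n.+1%:R - F (- n.+1%:R))%:E)%E.
  rewrite EFinB; apply: continuous_FTC2.
  - by rewrite gtrN.
  - exact: continuous_subspaceT.
  - split; first by move=> x _; case: (dF x).
    + exact: cvg_at_right_filter (cF _).
    + exact: cvg_at_left_filter (cF _).
  - by move=> x _; rewrite derive1E; apply: derive_val.
have mf : measurable_fun setT f by apply: continuous_measurable_fun.
have [||||| _ _ cv] := @dominated_convergence _ _ _ mu setT measurableT
    (fun n x => ((f \_ (I n.+1)) x)%:E) (EFin \o f) (abse \o (EFin \o f)).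
  - move=> n; apply/measurable_EFinP/measurable_restrict => //.
      exact: measurable_itv.
    by rewrite setTI; exact: measurable_funTS.
  - exact/measurable_EFinP.
  - apply: aeW => x _; apply: cvg_near_cst; near=> n => /=.
    rewrite patchE mem_set// /I/= in_itv/= -ler_norml.
    apply: (@le_trans _ _ n%:R); last by rewrite ler_nat.
    by near: n; exact: nbhs_infty_ger.
  - exact: integrable_abse.
  - apply: aeW => x n _ /=; rewrite lee_fin patchE; case: ifP => // _.
    by rewrite normr0.
have {}cv : (F n.+1%:R - F (- n.+1%:R)) @[n --> \oo] --> Rintegral mu setT f.
  rewrite /Rintegral.
  rewrite [X in X @ _](_ : _ = fine \o (fun n => \int[mu]_x (((f \_ (I n.+1)) x)%:E))%E).
    by apply: fine_cvg; rewrite fineK//; exact: integrable_fin_num.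
  apply/funext => n /=; rewrite -[LHS]/(fine (_%:E)) -FTC integral_mkcond.
  by congr fine; apply: eq_integral => x _; rewrite restrict_EFin.
have lim0 : (F n.+1%:R - F (- n.+1%:R)) @[n --> \oo] --> 0.
  rewrite -(subr0 0); apply: cvgB.
    by rewrite (cvg_shiftS (fun n => F n%:R)).
  by rewrite (cvg_shiftS (fun n => F (- n%:R))).
exact: (cvg_unique _ cv lim0).
Unshelve. all: end_near. Qed.

Let n := normal_pdf (0 : R) 1.
Let c := normal_peak (1 : R).

Let nE x : n x = c * expR (- (x ^+ 2 / 2)).
Proof.
by rewrite /n normal_pdfE ?oner_neq0// /normal_fun subr0 expr1n mulNr.
Qed.

Let n_ge0 x : 0 <= n x. Proof. exact: normal_pdf_ge0. Qed.

Let cn : continuous n. Proof. by apply: continuous_normal_pdf; rewrite oner_neq0. Qed.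

Let dn (x : R) : is_derive x 1 n (- x * n x).
Proof.
have -> : n = (fun x => c * expR (- (x ^+ 2 / 2))) by apply/funext.
have h : is_derive x 1 (fun x : R => - (x ^+ 2 / 2)) (- x).
  by apply: is_derive_eq; rewrite /GRing.scale /=; field.
have h2 : is_derive x 1 (fun x : R => expR (- (x ^+ 2 / 2))) (- x * expR (- (x ^+ 2 / 2))).
  have := is_derive1_comp (is_derive_expR _) h.
  by rewrite mulrC.
apply: is_derive_eq.
by rewrite /GRing.scale /=; ring.
Qed.

(** A multiple of the normal density of variance 2, namely [c exp (- x^2 / 4)]: known to be
    integrable, and large enough to dominate the [t]-derivative of the integrand of [F]. *)
Let dominator := fun x => c / normal_peak (Num.sqrt 2) * normal_pdf (0 : R) (Num.sqrt 2) x.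

Let sqrt2_neq0 : Num.sqrt 2 != 0 :> R.
Proof. by rewrite sqrtr_eq0 -ltNge. Qed.

Let c_gt0 : 0 < c. Proof. by apply: normal_peak_gt0; rewrite oner_neq0. Qed.

Let dominatorE x : dominator x = c * expR (- (x ^+ 2 / 4)).
Proof.
rewrite /dominator normal_pdfE// /normal_fun subr0 sqr_sqrtr// -mulrA mulKf.
  by rewrite mulNr; do 4 f_equal; lra.
by rewrite gt_eqF// normal_peak_gt0.
Qed.

Let dominator_ub x : `|x * n x| <= dominator x.
Proof.
rewrite normrM (ger0_norm (n_ge0 x)) nE dominatorE mulrCA ler_pM2l//.
have -> : - (x ^+ 2 / 2) = - (x ^+ 2 / 4) - x ^+ 2 / 4 by field.
rewrite expRD mulrCA ler_piMr ?expR_ge0// expRN ler_pdivrMr ?expR_gt0// mul1r.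
apply: le_trans (expR_ge1Dx _).
(* This square gives [|x| <= 1 + x^2 / 4 <= exp (x^2 / 4)]. *)
have := sqr_ge0 (`|x| / 2 - 1); rewrite -(real_normK (num_real x)).
lra.
Qed.

Let int_dominator : mu.-integrable setT (EFin \o dominator).
Proof.
have := integrableZl measurableT (c / normal_peak (Num.sqrt 2))
  (integrable_normal_pdf 0 (Num.sqrt 2)).
by apply: eq_integrable.
Qed.

Let int_n : mu.-integrable setT (EFin \o n).
Proof. exact: integrable_normal_pdf. Qed.

Let F (th t : R) := Rintegral mu setT (fun x : R => cos (t * x + th) * n x).

Let dcos (t th x : R) : is_derive t 1 (fun t => cos (t * x + th) * n x) (- x * sin (t * x + th) * n x).
Proof.
have h : is_derive t 1 (fun t : R => t * x + th) x.
  by apply: is_derive_eq; rewrite /GRing.scale /=; ring.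
have h2 := is_derive1_comp (is_derive_cos _) h.
by apply: is_derive_eq; rewrite /GRing.scale /=; ring.
Qed.

Let dFx (t th x : R) : is_derive x 1 (fun x => sin (t * x + th) * n x)
  (t * cos (t * x + th) * n x - x * sin (t * x + th) * n x).
Proof.
have h : is_derive x 1 (fun x : R => t * x + th) t.
  by apply: is_derive_eq; rewrite /GRing.scale /=; ring.
have h2 := is_deriveM (is_derive1_comp (is_derive_sin _) h) (dn x).
by apply: (is_derive_eq h2); rewrite /GRing.scale /=; ring.
Qed.

Let caff (t th : R) : continuous (fun x : R => t * x + th).
Proof.
by move=> x; apply: cvgD; [apply: cvgM; [exact: cvg_cst|exact: cvg_id]|exact: cvg_cst].
Qed.

Let ccos t th : continuous (fun x : R => cos (t * x + th)).
Proof. by move=> x; apply: (continuous_comp (@caff t th x)); exact: continuous_cos. Qed.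

Let csin t th : continuous (fun x : R => sin (t * x + th)).
Proof. by move=> x; apply: (continuous_comp (@caff t th x)); exact: continuous_sin. Qed.

Let mcos t th : measurable_fun setT (fun x : R => cos (t * x + th)).
Proof.
by apply: continuous_measurable_fun; exact: ccos.
Qed.

Let msin t th : measurable_fun setT (fun x : R => sin (t * x + th)).
Proof.
by apply: continuous_measurable_fun; exact: csin.
Qed.

Let mn : measurable_fun setT n.
Proof. exact: measurable_normal_pdf. Qed.

Let norm_cos_le1 (y : R) : `|cos y| <= 1.
Proof. by rewrite ler_norml cos_geN1 cos_le1. Qed.

Let norm_sin_le1 (y : R) : `|sin y| <= 1.
Proof. by rewrite ler_norml sin_geN1 sin_le1. Qed.

Let int_cosn t th : mu.-integrable setT (EFin \o (fun x => cos (t * x + th) * n x)).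
Proof.
apply: (le_integrable measurableT _ _ int_n).
  have m := measurable_funM (mcos t th) mn.
  have m2 := (measurable_EFinP _ _).2 m.
  exact: m2.
by move=> x _ /=; rewrite lee_fin normrM ler_piMl.
Qed.

Let int_xsinn t th : mu.-integrable setT (EFin \o (fun x => x * sin (t * x + th) * n x)).
Proof.
apply: (le_integrable measurableT _ _ int_dominator).
  have m := measurable_funM (measurable_funM (@measurable_id _ _ setT) (msin t th)) mn.
  exact/measurable_EFinP.
move=> x _ /=; rewrite lee_fin; apply: le_trans (ler_norm _).
by apply: le_trans (dominator_ub _); rewrite mulrAC normrM ler_piMr.
Qed.

(** Integration by parts: the [x]-derivative of [sin (t x + th) n(x)], computed in [dFx], has
    integral 0. *)
Let ibp t th : Rintegral mu setT (fun x => x * sin (t * x + th) * n x) = t * F th t.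
Proof.
apply/esym/eqP; rewrite -subr_eq0; apply/eqP.
rewrite /F -RintegralZl// -RintegralB//; last by have := integrableZl measurableT t (int_cosn t th).
(* The boundary terms vanish because [exp (- k^2 / 2) <= 2 / (k + 1)], that is
   [k^2 - k + 1 >= 0]. *)
have ub (k : nat) (x : R) : x ^+ 2 = k%:R ^+ 2 ->
    `|sin (t * x + th) * n x| <= 2 * c * harmonic k.
  move=> xk; rewrite normrM (ger0_norm (n_ge0 x)).
  apply: (@le_trans _ _ (n x)); first by rewrite ler_piMl.
  rewrite nE (mulrAC 2 c) (mulrC _ c) ler_pM2l// xk expRN.
  rewrite /harmonic -[2 * _](invf_div k.+1%:R 2) lef_pV2 ?posrE ?expR_gt0 ?divr_gt0//.
  apply: le_trans (expR_ge1Dx _).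
  rewrite ler_pdivrMr// -natr1.
  have := sqr_ge0 (k%:R - 2^-1 : R); lra.
have lim0 (x_ : nat -> R) : (forall k, x_ k ^+ 2 = k%:R ^+ 2) ->
    sin (t * x_ k + th) * n (x_ k) @[k --> \oo] --> 0.
  move=> xk; apply: norm_cvg0.
  apply: (@squeeze_cvgr _ _ _ _ (cst 0) (fun k => 2 * c * harmonic k)).
  - by apply: nearW => k; rewrite normr_ge0 ub.
  - exact: cvg_cst.
  - by rewrite -(mulr0 (2 * c)); apply: cvgM; [exact: cvg_cst|exact: cvg_harmonic].
rewrite -[RHS](@Rintegral_derive_eq0 (fun x => sin (t * x + th) * n x)
   (fun x => t * cos (t * x + th) * n x - x * sin (t * x + th) * n x)).
- by under eq_Rintegral do rewrite mulrA.
- by move=> x; exact: dFx.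
- move=> x; apply: cvgB.
    apply: cvgM; last exact: cn.
    by apply: cvgM; [exact: cvg_cst|exact: ccos].
  apply: cvgM; last exact: cn.
  by apply: cvgM; [exact: cvg_id|exact: csin].
- have := integrableB measurableT (integrableZl measurableT t (int_cosn t th))
    (int_xsinn t th).
  move=> h; apply: eq_integrable h => // x _ /=; congr (EFin _).
  by rewrite mulrA.
- exact: lim0.
- by apply: lim0 => k; rewrite sqrrN.
Qed.

(** Differentiation under the integral sign on a neighbourhood of [t], followed by [ibp], yields the
    differential equation [F' = - t F]. *)
Let dF (t th : R) : is_derive t 1 (F th) (- t * F th t).
Proof.
pose f (t x : R) := cos (t * x + th) * n x.
have pf (s x : R) : partial1of2 f s x = - x * sin (s * x + th) * n x.
  by rewrite partial1of2E; case: (dcos s th x) => _ <-.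
have It : `]t - 1, t + 1[%classic t by rewrite /= in_itv/= ltrBlDr !ltrDl ltr01.
have intf (x : R) : `]t - 1, t + 1[%classic x -> mu.-integrable setT (EFin \o f x).
  by move=> _; exact: int_cosn.
have derf (x y : R) : `]t - 1, t + 1[%classic x -> setT y -> derivable (f ^~ y) x 1.
  by move=> _ _; case: (dcos x th y).
have dom_ge0 (y : R) : 0 <= dominator y by exact: le_trans (dominator_ub y).
have ub (x y : R) : `]t - 1, t + 1[%classic x -> setT y ->
    `|partial1of2 f x y| <= dominator y.
  move=> _ _; rewrite pf; apply: le_trans (dominator_ub _).
  by rewrite mulrAC normrM !mulNr normrN ler_piMr.
apply: DeriveDef.
  exact: (derivable_under_integral measurableT It intf derf dom_ge0 int_dominator ub).
rewrite -derive1E.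
rewrite (differentiation_under_integral measurableT It intf derf dom_ge0 int_dominator ub).
rewrite mulNr -ibp -mulN1r -(RintegralZl (-1) measurableT (int_xsinn t th)).
by apply: eq_Rintegral => x _; rewrite pf mulN1r !mulNr.
Qed.

(** By [dF] the product [F(t) exp (t^2 / 2)] has zero derivative, so it keeps its value at 0, where
    the total mass of the density leaves [cos th]. *)
Lemma normal_charfun (t th : R) :
  Rintegral mu setT (fun x : R => cos (t * x + th) * normal_pdf 0 1 x) = cos th * expR (- (t ^+ 2 / 2)).
Proof.
rewrite -[LHS]/(F th t); pose H (s : R) := F th s * expR (s ^+ 2 / 2).
have dH (s : R) : is_derive s 1 H 0.
  have h : is_derive s 1 (fun x : R => x ^+ 2 / 2) s.
    by apply: is_derive_eq; rewrite /GRing.scale /=; field.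
  have h2 := is_deriveM (dF s th) (is_derive1_comp (is_derive_expR _) h).
  by apply: (is_derive_eq h2); rewrite /GRing.scale /=; ring.
have : H t = H 0 by exact: is_derive_0_is_cst.
rewrite /H expr0n/= mul0r expR0 mulr1 expRN => HE.
have e0 : expR (t ^+ 2 / 2) != 0 by rewrite gt_eqF ?expR_gt0.
apply: (mulIf e0); rewrite HE mulfVK//.
rewrite /F (_ : (fun x => _) = (fun x => cos th * n x)); last first.
  by apply/funext => x; rewrite mul0r add0r.
rewrite RintegralZl//.
rewrite [Rintegral _ _ _](_ : _ = 1) ?mulr1//.
by rewrite /Rintegral [X in fine X](integral_normal_pdf 0 1).
Qed.

(** The Radon-Nikodym derivative is determined only almost everywhere; it agrees with [normal_pdf]
    because both have the same integral over every measurable set. *)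
Lemma integral_normal_prob (f : R -> \bar R) :
  (normal_prob (0 : R) 1).-integrable setT f ->
  (\int[normal_prob 0 1]_x f x = \int[mu]_x (f x * (normal_pdf 0 1 x)%:E))%E.
Proof.
move=> intf; have mf := measurable_int _ intf.
have dom := normal_prob_dominates (0 : R) 1.
rewrite -(Radon_Nikodym_change_of_variables dom)//.
apply: ae_eq_integral => //.
- apply: emeasurable_funM => //; apply: (measurable_int mu).
- apply: emeasurable_funM => //; exact/measurable_EFinP.
- apply: ae_eqe_mul2l => /=.
  rewrite Radon_NikodymE/=.
  case: cid => /= h [h1 h2 h3].
  apply: integral_ae_eq => //=.
  + exact/measurable_EFinP.
  + by move=> E _ mE; rewrite -h3.
Qed.

Lemma mean_normal_prob (t th : R) :
  mean (normal_prob 0 1) (fun x : R => cos (t * x + th)) =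
  cos th * expR (- (t ^+ 2 / 2)).
Proof.
rewrite -normal_charfun /mean /Rintegral integral_normal_prob//.
apply: (@has_mean_bounded _ _ _ (normal_prob 0 1) _ 1) => //; exact: mcos.
Qed.
End gauss.

(** * Gram decomposition of positive semidefinite matrices *)

Section gram.
Context {R : realType} {I : finType}.
Implicit Types (S : I -> I -> R) (t : I -> R).

Definition quad_form S t : R := \sum_i \sum_j t i * t j * S i j.

(** The form along a line parallel to the [i]-th axis. In [psd_gram] its nonnegativity is exploited
    at well chosen [c]. *)
Lemma quad_form_shift S t i c : (forall i j, S i j = S j i) ->
  quad_form S (fun k => t k + c * (k == i)%:R) =
  quad_form S t + 2 * c * (\sum_l t l * S i l) + c ^+ 2 * S i i.
Proof.
move=> Ssym; rewrite /quad_form.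
have sumd (F : I -> R) : \sum_k (k == i)%:R * F k = F i.
  rewrite (bigD1 i)//= eqxx mul1r big1 ?addr0// => k /negbTE ->.
  by rewrite mul0r.
pose a k := \sum_l t l * S k l.
have inner k : \sum_j (t k + c * (k == i)%:R) * (t j + c * (j == i)%:R) * S k j =
    t k * a k + c * (t k * S k i) + c * ((k == i)%:R * a k) + c ^+ 2 * ((k == i)%:R * S k i).
  have -> : S k i = \sum_j (j == i)%:R * S k j by rewrite sumd.
  rewrite /a !mulr_sumr -!big_split/=; apply: eq_bigr => j _; ring.
under eq_bigr do rewrite inner.
rewrite !big_split/= -!mulr_sumr !sumd -!addrA; congr (_ + _).
  by apply: eq_bigr => k _; rewrite /a mulr_sumr; apply: eq_bigr => j _; ring.
rewrite (_ : \sum_k t k * S k i = a i); first by rewrite /a; ring.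
by apply: eq_bigr => k _; rewrite Ssym.
Qed.

(** Symmetric elimination: subtracting [v v^T], with [v] the [i]-th row over the root of the pivot,
    leaves the Schur complement, still positive semidefinite and with fewer nonzero diagonal
    entries; that number is the induction measure. *)
Lemma psd_gram S : (forall i j, S i j = S j i) -> (forall t, 0 <= quad_form S t) ->
  exists vs : seq (I -> R), forall i j, S i j = \sum_(v <- vs) v i * v j.
Proof.
have [n] := ubnP #|[pred i | S i i != 0]|.
elim: n S => // n IH S Sn Ssym Spos.
case: (pickP [pred i | S i i != 0]) => [i /= Sii|S0]; last first.
  exists [::] => i j; rewrite big_nil.
  have dj : quad_form S (fun k => (k == j)%:R) = 0.
    have := quad_form_shift (fun=> 0) j 1 Ssym; rewrite {2}/quad_form.
    under eq_fun do rewrite add0r mul1r.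
    move=> ->; have /eqP -> := negbFE (S0 j).
    rewrite !big1 ?mulr0 ?addr0// => *; rewrite ?mul0r//.
    by rewrite big1// => *; rewrite !mul0r.
  have sj : \sum_l (l == j)%:R * S i l = S i j.
    rewrite (bigD1 j)//= eqxx mul1r big1 ?addr0// => k /negbTE ->.
    by rewrite mul0r.
  (* With a zero diagonal the form at [e_j + c e_i] equals [2 c S_ij]; both signs of [c] force
     [S_ij = 0]. *)
  have h c : 0 <= 2 * c * S i j.
    have := Spos (fun k => (k == j)%:R + c * (k == i)%:R).
    by rewrite quad_form_shift// dj sj add0r (eqP (negbFE (S0 i))) mulr0 addr0.
  have := h 1; have := h (-1); lra.
have Sii0 : 0 < S i i.
  rewrite lt_neqAle eq_sym Sii/=; have := Spos (fun k => 0 + 1 * (k == i)%:R).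
  rewrite quad_form_shift// /quad_form.
  rewrite !big1 ?mulr0 ?add0r ?expr1n ?mul1r// => *; rewrite ?mul0r//.
  by rewrite big1// => *; rewrite !mul0r.
pose v k := S i k / Num.sqrt (S i i).
have vv j k : v j * v k = S i j * S i k / S i i.
  rewrite /v mulrACA -invfM -expr2 sqr_sqrtr ?ltW//.
pose S' j k := S j k - v j * v k.
have [|||vs vsP] := IH S'.
- apply: (@leq_trans #|[pred i | S i i != 0]|); last by rewrite -ltnS.
  apply: proper_card.
  rewrite properE; apply/andP; split.
    apply/fintype.subsetP => k; rewrite !inE /S' vv; apply: contraNN => /eqP Skk.
    (* If [S k k = 0], the choice [c = - S i k / S i i] gives the form the value
       [- (S i k)^2 / S i i]. Hence elimination keeps zero diagonal entries zero. *)
    have Sik : S i k = 0.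
      have dk : quad_form S (fun l => (l == k)%:R) = 0.
        have := quad_form_shift (fun=> 0) k 1 Ssym; rewrite {2}/quad_form.
        under eq_fun do rewrite add0r mul1r.
        move=> ->; rewrite Skk.
        rewrite !big1 ?mulr0 ?addr0// => *; rewrite ?mul0r//.
        by rewrite big1// => *; rewrite !mul0r.
      have sk : \sum_l (l == k)%:R * S i l = S i k.
        rewrite (bigD1 k)//= eqxx mul1r big1 ?addr0// => l /negbTE ->.
        by rewrite mul0r.
      have := Spos (fun l => (l == k)%:R + - (S i k / S i i) * (l == i)%:R).
      rewrite quad_form_shift// dk sk add0r.
      rewrite (_ : _ + _ = - (S i k ^+ 2 / S i i)); last by field; rewrite gt_eqF.
      rewrite oppr_ge0 => h; apply/eqP; rewrite -sqrf_eq0 eq_le sqr_ge0 andbT.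
      by move: h; rewrite ler_pdivrMr// mul0r.
    by rewrite Skk Sik !mul0r subr0.
  apply/fintype.subsetPn; exists i; rewrite !inE//= /S' vv mulfK// subrr eqxx//.
- by move=> j k; rewrite /S' Ssym (mulrC (v j)).
(* This [c] minimizes the form along axis [i]; the minimum is the form of [S'] at [t]. *)
- move=> t; pose c := - ((\sum_l t l * S i l) / S i i).
  have := Spos (fun k => t k + c * (k == i)%:R); rewrite quad_form_shift//.
  suff -> : quad_form S' t = quad_form S t - (\sum_l t l * S i l) ^+ 2 / S i i.
    by move=> h; apply: le_trans h _; rewrite /c le_eqVlt; apply/orP; left; apply/eqP; field; rewrite gt_eqF.
  rewrite /quad_form expr2 big_distrlr/= mulr_suml -sumrB; apply: eq_bigr => j _.
  rewrite mulr_suml -sumrB; apply: eq_bigr => k _; rewrite /S' vv; ring.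
exists (v :: vs) => j k; rewrite big_cons -vsP /S'; ring.
Qed.

End gram.

(** * Gaussian vectors on product spaces *)

Section gaussian.
Context {R : realType}.

(** For fixed [x] the inner cosine has phase [f x + th]; this is why the hypothesis covers all
    phases. *)
Lemma mean_prod_cos {d1 d2} {T1 : measurableType d1} {T2 : measurableType d2}
    (P1 : probability T1 R) (P2 : probability T2 R) (f : T1 -> R) (g : T2 -> R) (b th : R) :
  measurable_fun setT f -> measurable_fun setT g ->
  (forall th', mean P2 (fun y => cos (g y + th')) = cos th' * b) ->
  mean (P1 \x P2)%E (fun z => cos (f z.1 + g z.2 + th)) =
  mean P1 (fun x => cos (f x + th)) * b.
Proof.
move=> mf mg gb.
have mfg : measurable_fun setT (fun z : T1 * T2 => f z.1 + g z.2).
  by apply: measurable_funD; apply: measurableT_comp.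
rewrite mean_prod; last by apply: has_mean_cos; exact: measurable_funD.
rewrite mulrC -meanZ; last by apply: has_mean_cos; exact: measurable_funD.
congr mean; apply/funext => x /=; rewrite mulrC -gb; congr mean.
by apply/funext => y; congr cos; ring.
Qed.

Context {I : finType}.

Definition gaussian_charfun {d} {T : measurableType d} (P : probability T R)
    (Z : T -> I -> R) (q : (I -> R) -> R) : Prop :=
  (forall i, measurable_fun setT (fun w => Z w i)) /\
  forall t th, mean P (fun w => cos (\sum_i t i * Z w i + th)) =
    cos th * expR (- (q t / 2)).

Lemma gaussian_charfun_exists (vs : seq (I -> R)) :
  exists d (T : measurableType d) (P : probability T R) (Z : T -> I -> R),
    gaussian_charfun P Z (fun t => \sum_(v <- vs) (\sum_i t i * v i) ^+ 2).
Proof.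
elim: vs => [|v vs [d [T [P [Z [mZ ZP]]]]]].
  (* Any probability space carries the zero vector. *)
  exists _, _, (normal_prob 0 1), (fun _ _ => 0); split=> [i|t th]; first exact: measurable_cst.
  rewrite big_nil mul0r oppr0 expR0 mulr1 -[RHS](mean_cst (normal_prob 0 1)).
  congr mean; apply/funext => w; rewrite big1 ?add0r// => i _.
  by rewrite mulr0.
exists _, _, (P \x normal_prob 0 1)%E, (fun z i => Z z.1 i + v i * z.2); split=> [i|t th].
  apply: measurable_funD; first by apply: measurableT_comp (mZ i) _.
  by apply: measurable_funM => //; exact: measurable_snd.
pose c := \sum_i t i * v i.
rewrite (_ : (fun w => _) = (fun z => cos (\sum_i t i * Z z.1 i + c * z.2 + th))); last first.
  apply/funext => -[x y] /=; congr (cos (_ + _)).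
  by rewrite /c mulr_suml -big_split/=; apply: eq_bigr => i _; ring.
rewrite (@mean_prod_cos _ _ _ _ P (normal_prob 0 1) (fun x => \sum_i t i * Z x i)
  (fun y => c * y) (expR (- (c ^+ 2 / 2))) th).
- by rewrite ZP big_cons -mulrA -expRD; congr (_ * expR _); rewrite -/c; field.
- by apply: measurable_sum => i; apply: measurable_funM.
- by apply: measurable_funM => //; exact: measurable_id.
- by move=> th'; rewrite mean_normal_prob.
Qed.

(** Copies are indexed by [nat] so that the induction can install copy number [K] on a new factor
    without changing the type of the others; only indices below [K] matter. Sets are constrained
    through the preimage by [Z] alone, since [I -> R] has no sigma-algebra here. *)
Lemma independent_copies {d} {T : measurableType d} (P : probability T R)
    (Z : T -> I -> R) (q : (I -> R) -> R) (K : nat) : gaussian_charfun P Z q ->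
  exists d' (T' : measurableType d') (P' : probability T' R) (Xi : T' -> nat -> I -> R),
    [/\ forall k i, measurable_fun setT (fun w => Xi w k i),
      forall S : nat -> set (I -> R), (forall k, measurable (Z @^-1` S k)) ->
        measurable (\big[setI/setT]_(k < K) ((fun w => Xi w k) @^-1` S k)) /\
        P' (\big[setI/setT]_(k < K) ((fun w => Xi w k) @^-1` S k)) =
        (\prod_(k < K) P (Z @^-1` S k))%E &
      forall (t : nat -> I -> R) th,
        mean P' (fun w => cos (\sum_(k < K) \sum_i t k i * Xi w k i + th)) =
        cos th * expR (- ((\sum_(k < K) q (t k)) / 2))].
Proof.
move=> [mZ ZP]; elim: K => [|K [d' [T' [P' [Xi [mXi indXi cfXi]]]]]].
  exists d, T, P, (fun w _ => Z w); split=> [k i|S mS|t th]; first exact: mZ.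
    by rewrite !big_ord0; split=> //; exact: probability_setT.
  rewrite big_ord0 mul0r oppr0 expR0 mulr1 -[RHS](mean_cst P).
  by congr mean; apply/funext => w; rewrite big_ord0 add0r.
exists _, _, (P' \x P)%E, (fun z k => if k == K then Z z.2 else Xi z.1 k).
split=> [k i|S mS|t th].
- case: eqVneq => _; first exact: (measurableT_comp (mZ i)).
  exact: (measurableT_comp (mXi k i)).
- have [mA PA] := indXi S mS.
  set A := \big[setI/setT]_(k < K) _ in mA PA.
  have -> : \big[setI/setT]_(k < K.+1) ((fun w : T' * T => if k == K :> nat then Z w.2 else Xi w.1 k) @^-1` S k) =
      A `*` (Z @^-1` S K).
    rewrite big_ord_recr/= eqxx /A !in_bigsetI; apply/seteqP; split=> -[x y] /=.
      move=> [/allP a ?]; split=> //; apply/allP => k kK; have := a k kK.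
      by move=> /asboolP; rewrite ltn_eqF// => h; apply/asboolP.
    move=> [/allP a ?]; split=> //; apply/allP => k kK; have := a k kK.
    by move=> /asboolP h; apply/asboolP; rewrite ltn_eqF.
  split; first by apply: measurableX => //; exact: mS.
  rewrite big_ord_recr/= -PA; apply: product_measure1E => //; exact: mS.
- rewrite (_ : (fun w => _) = (fun z => cos (\sum_(k < K) \sum_i t k i * Xi z.1 k i +
    \sum_i t K i * Z z.2 i + th))); last first.
    apply/funext => -[x y] /=; rewrite big_ord_recr/= eqxx; congr (cos (_ + _ + _)).
    by apply: eq_bigr => k _; rewrite ltn_eqF.
  rewrite (@mean_prod_cos _ _ _ _ P' P (fun x => \sum_(k < K) \sum_i t k i * Xi x k i)
    (fun y => \sum_i t K i * Z y i) (expR (- (q (t K) / 2))) th).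
  + by rewrite cfXi big_ord_recr/= -mulrA -expRD; congr (_ * expR _); field.
  + by do 2 (apply: measurable_sum => ?); apply: measurable_funM.
  + by apply: measurable_sum => i; apply: measurable_funM.
  + by move=> th'; exact: ZP.
Qed.

End gaussian.

(** * From characteristic functions to weak convergence *)

Section kernel.
Context {R : realType}.
Implicit Types (x y u : R).

(** The real form of the binomial expansion of [(exp (i y) + exp (- i y))^n], by Pascal's rule. *)
Lemma cos_pow_expand n y : 2 ^+ n * cos y ^+ n =
  \sum_(j < n.+1) 'C(n, j)%:R * cos ((n%:R - j%:R * 2) * y).
Proof.
elim: n => [|n IH].
  by rewrite big_ord_recl big_ord0 !expr0 mul0r subr0 mul0r cos0 bin0 !mulr1 addr0.
have -> : 2 ^+ n.+1 * cos y ^+ n.+1 = (2 * cos y) * (2 ^+ n * cos y ^+ n).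
  by rewrite !exprS; ring.
pose c (m j : nat) := cos ((m%:R - j%:R * 2) * y).
have cc (j : nat) : 2 * cos y * c n j = c n.+1 j + c n.+1 j.+1.
  rewrite /c (_ : (n.+1%:R - j%:R * 2) * y = (n%:R - j%:R * 2) * y + y); last by rewrite -natr1; ring.
  rewrite (_ : (n.+1%:R - j.+1%:R * 2) * y = (n%:R - j%:R * 2) * y - y); last by rewrite -!natr1; ring.
  by rewrite cosD cosB; ring.
rewrite IH mulr_sumr (eq_bigr (fun j : 'I_n.+1 => 'C(n, j)%:R * c n.+1 j + 'C(n, j)%:R * c n.+1 j.+1)); last first.
  by move=> j _; rewrite mulrCA -/(c n j) cc mulrDr.
rewrite big_split/= [RHS]big_ord_recl/= [X in X + _]big_ord_recl/=.
rewrite -!/(c _ _) !bin0 -!addrA; congr (_ + _).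
rewrite [RHS](eq_bigr (fun i : 'I_n.+1 => 'C(n, i.+1)%:R * c n.+1 i.+1 + 'C(n, i)%:R * c n.+1 i.+1)); last first.
  by move=> i _; rewrite /bump /= add1n binS natrD mulrDl.
rewrite big_split/= [X in _ = X + _]big_ord_recr/= bin_small// mul0r addr0.
by congr (_ + _); apply: eq_bigr => i _; rewrite /bump/= add1n.
Qed.

(** Multiplied by [2 sin (b / 2)], where [b = 2 pi k / N] is the step, the sum telescopes and its
    ends differ by [k] full periods. The bounds on [k] put [b / 2] inside [(0, pi)], so this factor
    is nonzero. *)
Lemma sum_cos_nodes (N k : nat) u : (0 < k < N)%N ->
  \sum_(r < N) cos (k%:R * (u - 2 * pi * r%:R / N%:R)) = 0.
Proof.
move=> /andP[k0 kN].
have N0 : 0 < N%:R :> R by rewrite ltr0n (leq_trans _ kN).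
pose b := 2 * pi * k%:R / N%:R : R.
have sb_gt0 : 0 < sin (b / 2).
  apply: sin_gt0_pi.
  have -> : b / 2 = pi * (k%:R / N%:R) by rewrite /b; field; rewrite gt_eqF.
  apply/andP; split; first by apply: mulr_gt0; [exact: pi_gt0|apply: divr_gt0 => //; rewrite ltr0n].
  by rewrite gtr_pMr ?pi_gt0// ltr_pdivrMr// mul1r ltr_nat.
have sb : sin (b / 2) != 0 by rewrite gt_eqF.
pose s (r : nat) := sin (k%:R * u - r%:R * b + b / 2).
have tele (r : nat) : 2 * sin (b / 2) * cos (k%:R * (u - 2 * pi * r%:R / N%:R)) = s r - s r.+1.
  rewrite /s (_ : _ * (u - _) = k%:R * u - r%:R * b); last by rewrite /b; field; rewrite gt_eqF.
  rewrite (_ : _ - r.+1%:R * b + b / 2 = k%:R * u - r%:R * b - b / 2); last by rewrite -natr1; field.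
  by move: (_ - _ * b) => al; rewrite sinD sinB; ring.
have sb2 : 2 * sin (b / 2) != 0 by apply: mulf_neq0 => //; exact: sb.
apply: (mulfI sb2); rewrite mulr0 mulr_sumr (eq_bigr _ (fun (r : 'I_N) _ => tele r)).
rewrite -(big_mkord xpredT (fun r => s r - s r.+1)).
rewrite (telescope_sumr_eq (fun r => - s r)) => [|//|r _]; last by rewrite opprK addrC.
rewrite opprK addrC /s mul0r subr0; apply/eqP; rewrite subr_eq0; apply/eqP.
rewrite -[RHS](periodicn (@sinD2pi R) k); congr sin.
by rewrite /b -mulrnA -(mulr_natr pi) natrM; field; rewrite gt_eqF.
Qed.

(** The unnormalized de la Vallee Poussin kernel, the [2 M]-th power of [cos (u / 2)]: a nonnegative
    trigonometric polynomial of degree [M] concentrating at 0 modulo [2 pi]. *)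
Definition cos_kernel (M : nat) u := ((1 + cos u) / 2) ^+ M.

Lemma cos_kernel_ge0 M u : 0 <= cos_kernel M u.
Proof. by rewrite exprn_ge0// divr_ge0// -lerBlDl sub0r cos_geN1. Qed.

(** The constant Fourier coefficient of [cos_kernel M]. *)
Definition cos_kernel_mass (M : nat) : R := 'C(M.*2, M)%:R / 4 ^+ M.

Lemma cos_kernel_mass_gt0 M : 0 < cos_kernel_mass M.
Proof. by rewrite divr_gt0 ?exprn_gt0// ltr0n bin_gt0 -addnn leq_addr. Qed.

(** Consecutive masses have ratio [(2 M + 1) / (2 M + 2)]; this is what makes the spread of the
    weights explicit. *)
Lemma cos_kernel_massS M :
  cos_kernel_mass M - cos_kernel_mass M.+1 = cos_kernel_mass M / (2 * M.+1%:R).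
Proof.
have e : ('C(M.+1.*2, M.+1) * M.+1 = 2 * (M.*2.+1 * 'C(M.*2, M)))%N.
  have h : 'C(M.*2.+1, M) = 'C(M.*2.+1, M.+1).
    rewrite -bin_sub; last by rewrite -addnn -addSn leq_addl.
    by congr 'C(_, _); rewrite -addnn -addSn addnK.
  rewrite (mul_bin_diag M.*2.+1 M) doubleS (binS M.*2.+1) h addnn.
  by rewrite -(mul2n 'C(_, _)) -mulnA (mulnC 'C(_, _)).
rewrite /cos_kernel_mass exprS.
have -> : 'C(M.+1.*2, M.+1)%:R = 2 * (M.*2.+1%:R * 'C(M.*2, M)%:R) / M.+1%:R :> R.
  by rewrite -[2]/(2%:R) -!natrM -e natrM mulfK// pnatr_eq0.
have -> : M.*2.+1%:R = 2 * M%:R + 1 :> R by rewrite -natr1 -mul2n natrM.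
have m0 : M%:R + 1 != 0 :> R by rewrite natr1 pnatr_eq0.
have f0 : 4 ^+ M != 0 :> R by rewrite expf_neq0.
have -> : M.+1%:R = M%:R + 1 :> R by rewrite natr1.
by field; rewrite m0 f0.
Qed.

(** The kernel has frequencies at most [M < N], and [sum_cos_nodes] kills all of them but the
    constant one, at [j = M]. *)
Lemma sum_cos_kernel (M N : nat) u : (M < N)%N ->
  \sum_(r < N) cos_kernel M (u - 2 * pi * r%:R / N%:R) = N%:R * cos_kernel_mass M.
Proof.
move=> MN.
have kE y : cos_kernel M y = 4 ^- M * \sum_(j < M.*2.+1) 'C(M.*2, j)%:R * cos ((M%:R - j%:R) * y).
  have -> : cos_kernel M y = 4 ^- M * (2 ^+ M.*2 * cos (y / 2) ^+ M.*2).
    rewrite -mul2n !exprM (_ : 2 ^+ 2 = 4); last by ring.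
    rewrite mulKf ?expf_neq0// /cos_kernel; congr (_ ^+ M).
    have := cos_mulr2n (y / 2); rewrite -[y / 2 *+ 2]mulr_natr divfK// => ->.
    by rewrite -mulr_natr; field.
  rewrite cos_pow_expand; congr (_ * _); apply: eq_bigr => j _; congr (_ * cos _).
  have -> : M.*2%:R = 2 * M%:R :> R by rewrite -mul2n natrM.
  by field.
under eq_bigr do rewrite kE.
rewrite -mulr_sumr exchange_big/=.
have MM : (M < M.*2.+1)%N by rewrite ltnS -addnn leq_addr.
rewrite (bigD1 (Ordinal MM))//= [X in _ + X]big1; last first.
  move=> j jM; rewrite -mulr_sumr.
  have : (j : nat) != M by apply: contraNN jM => /eqP e; apply/eqP/val_inj.
  rewrite neq_ltn => /orP[jlt|jgt].
    under eq_bigr do rewrite -natrB 1?ltnW//.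
    by rewrite sum_cos_nodes ?mulr0// subn_gt0 jlt (leq_ltn_trans (leq_subr _ _)).
  under eq_bigr do rewrite -cosN -mulNr opprB -natrB 1?ltnW//.
  rewrite sum_cos_nodes ?mulr0// subn_gt0 jgt/=.
  apply: leq_ltn_trans MN; rewrite leq_subLR addnn -ltnS; exact: ltn_ord.
rewrite addr0 -mulr_sumr.
under eq_bigr do rewrite subrr mul0r cos0.
by rewrite sumr_const card_ord -[_ *+ N]mulr_natl /cos_kernel_mass; ring.
Qed.

(* Replacing [g x] by [sum_r g(theta_r) * node_weight M x r] is the trigonometric
   analogue of Bernstein's operator; the values are exactly trigonometric polynomials. *)
Definition node_weight (M : nat) u (r : 'I_M.+2) :=
  cos_kernel M (u - 2 * pi * r%:R / M.+2%:R) / (M.+2%:R * cos_kernel_mass M).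
Arguments node_weight : clear implicits.

Lemma node_weight_ge0 M u r : 0 <= node_weight M u r.
Proof.
by rewrite divr_ge0 ?cos_kernel_ge0// mulr_ge0// ltW// cos_kernel_mass_gt0.
Qed.

Let mass_neq0 M : M.+2%:R * cos_kernel_mass M != 0.
Proof. by rewrite mulf_neq0 ?pnatr_eq0// gt_eqF// cos_kernel_mass_gt0. Qed.

Lemma sum_node_weight M u : \sum_r node_weight M u r = 1.
Proof. by rewrite -mulr_suml sum_cos_kernel// mulfV. Qed.

(** The kernel of order [M] times [1 - cos y] is twice the difference of the kernels of orders [M]
    and [M.+1]; with [M.+2] nodes both are summed exactly. The result plays the part of a variance
    tending to 0. *)
Lemma sum_node_weight_var M u :
  \sum_r node_weight M u r * (1 - cos (u - 2 * pi * r%:R / M.+2%:R)) = M.+1%:R^-1.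
Proof.
have e y : cos_kernel M y * (1 - cos y) = 2 * cos_kernel M y - 2 * cos_kernel M.+1 y.
  by rewrite /cos_kernel exprS; field.
under eq_bigr do rewrite mulrAC e mulrBl.
rewrite sumrB -!mulr_suml -!mulr_sumr !sum_cos_kernel// -mulrBl -!mulrBr cos_kernel_massS.
have := mass_neq0 M; rewrite mulf_eq0 negb_or => /andP[m0 m1].
have m2 : M.+1%:R != 0 :> R by rewrite pnatr_eq0.
move: m0 m1 m2; move: (M.+1%:R) (M.+2%:R) (cos_kernel_mass M) => x y z y0 z0 x0.
by field; rewrite x0 y0 z0.
Qed.
End kernel.
Arguments node_weight {R} M u r.

(** * Approximation by trigonometric polynomials *)

Section trig_poly.
Context {R : realType} {I : finType}.
Implicit Types (x y t : I -> R) (p q g : (I -> R) -> R).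

(** Only phases, sums and scalars appear as constructors, so that any statement linear in [p], such
    as convergence of expectations, reduces to single cosines. Products come from [trig_polyM]. *)
Inductive trig_poly : ((I -> R) -> R) -> Prop :=
| trig_poly_cos t th : trig_poly (fun x => cos (\sum_i t i * x i + th))
| trig_polyD p q : trig_poly p -> trig_poly q -> trig_poly (fun x => p x + q x)
| trig_polyZ c p : trig_poly p -> trig_poly (fun x => c * p x).

Lemma trig_poly_ext p q : (forall x, p x = q x) -> trig_poly p -> trig_poly q.
Proof. by move=> /funext ->. Qed.

Lemma trig_poly_cst c : trig_poly (fun=> c).
Proof.
apply: trig_poly_ext (trig_polyZ c (trig_poly_cos (fun=> 0) 0)) => x.
by rewrite big1 ?addr0 ?cos0 ?mulr1// => i _; rewrite mul0r.
Qed.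

Lemma trig_polyM p q : trig_poly p -> trig_poly q -> trig_poly (fun x => p x * q x).
Proof.
move=> tp tq; elim: tp => [t th|p1 p2 _ h1 _ h2|c p1 _ h1].
- elim: tq => [t' th'|p1 p2 _ h1 _ h2|c p1 _ h1].
  + apply: trig_poly_ext (trig_polyD
      (trig_polyZ 2^-1 (trig_poly_cos (fun i => t i + t' i) (th + th')))
      (trig_polyZ 2^-1 (trig_poly_cos (fun i => t i - t' i) (th - th')))) => x.
    pose a := \sum_i t i * x i + th; pose b := \sum_i t' i * x i + th'.
    have -> : \sum_i (t i + t' i) * x i + (th + th') = a + b.
      rewrite addrACA -big_split/=; congr (_ + _).
      by apply: eq_bigr => i _; rewrite mulrDl.
    have -> : \sum_i (t i - t' i) * x i + (th - th') = a - b.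
      rewrite /a /b opprD addrACA -sumrB; congr (_ + _).
      by apply: eq_bigr => i _; rewrite mulrBl.
    by rewrite cosD cosB -/a -/b; field.
  + by apply: trig_poly_ext (trig_polyD h1 h2) => x; rewrite mulrDr.
  + by apply: trig_poly_ext (trig_polyZ c h1) => x; rewrite mulrCA.
- by apply: trig_poly_ext (trig_polyD h1 h2) => x; rewrite mulrDl.
- by apply: trig_poly_ext (trig_polyZ c h1) => x; rewrite mulrA.
Qed.

Lemma trig_poly_sum J (s : seq J) (F : J -> (I -> R) -> R) :
  (forall j, trig_poly (F j)) -> trig_poly (fun x => \sum_(j <- s) F j x).
Proof.
move=> tF; elim: s => [|j s IH].
  by apply: trig_poly_ext (trig_poly_cst 0) => x; rewrite big_nil.
by apply: trig_poly_ext (trig_polyD (tF j) IH) => x; rewrite big_cons.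
Qed.

Lemma trig_poly_prod J (s : seq J) (F : J -> (I -> R) -> R) :
  (forall j, trig_poly (F j)) -> trig_poly (fun x => \prod_(j <- s) F j x).
Proof.
move=> tF; elim: s => [|j s IH].
  by apply: trig_poly_ext (trig_poly_cst 1) => x; rewrite big_nil.
by apply: trig_poly_ext (trig_polyM (tF j) IH) => x; rewrite big_cons.
Qed.

Lemma trig_polyX p n : trig_poly p -> trig_poly (fun x => p x ^+ n).
Proof.
move=> tp; elim: n => [|n IH]; first exact: trig_poly_cst.
by apply: trig_poly_ext (trig_polyM tp IH) => x; rewrite exprS.
Qed.

Lemma trig_poly_coord (i : I) (c th : R) : trig_poly (fun x => cos (c * x i + th)).
Proof.
apply: trig_poly_ext (trig_poly_cos (fun j => c * (j == i)%:R) th) => x.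
rewrite (bigD1 i)//= eqxx mulr1 big1 ?addr0// => j /negbTE ->.
by rewrite mulr0 mul0r.
Qed.

Lemma trig_poly_bounded p : trig_poly p -> exists M, forall x, `|p x| <= M.
Proof.
elim=> [t th|p1 p2 _ [M1 h1] _ [M2 h2]|c p1 _ [M1 h1]].
- by exists 1 => x; exact: cos_max.
- by exists (M1 + M2) => x; apply: le_trans (ler_normD _ _) _; exact: lerD.
- by exists (`|c| * M1) => x; rewrite normrM ler_wpM2l.
Qed.

Lemma trig_poly_measurable {d} {T : measurableType d} (S : T -> I -> R) p :
  (forall i, measurable_fun setT (fun w => S w i)) -> trig_poly p ->
  measurable_fun setT (fun w => p (S w)).
Proof.
move=> mS; elim=> [t th|p1 p2 _ h1 _ h2|c p1 _ h1].
- apply: measurableT_comp.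
    by apply: continuous_measurable_fun; exact: continuous_cos.
  apply: measurable_funD => //; apply: measurable_sum => i.
  exact: measurable_funM.
- exact: measurable_funD.
- exact: measurable_funM.
Qed.

Definition cont_fun g : Prop := forall x (eps : R), 0 < eps ->
  exists2 delta : R, 0 < delta &
    forall y, (forall i, `|x i - y i| < delta) -> `|g x - g y| < eps.

(** Heine-Cantor: the box is compact by Tychonoff, and a cluster point of the first components of a
    sequence of bad pairs contradicts continuity there. *)
Lemma cont_fun_unif g A eps : cont_fun g -> 0 < eps ->
  exists2 delta : R, 0 < delta & forall x y, (forall i, `|x i| <= A) ->
    (forall i, `|y i| <= A) -> (forall i, `|x i - y i| < delta) -> `|g x - g y| < eps.
Proof.
move=> cg e0; apply: contrapT => /forall2NP nd.
have /choice[xy xyP] : forall n : nat, exists xy : (I -> R) * (I -> R),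
    [/\ forall i, `|xy.1 i| <= A, forall i, `|xy.2 i| <= A,
     forall i, `|xy.1 i - xy.2 i| < n.+1%:R^-1 & eps <= `|g xy.1 - g xy.2|].
  move=> n; case: (nd n.+1%:R^-1) => [[]|]; first by rewrite invr_gt0.
  move=> /existsNP[x] /existsNP[y] /not_implyP[hx] /not_implyP[hy] /not_implyP[hxy].
  by move=> /negP; rewrite -leNgt => h; exists (x, y).
have cpt : compact [set f : prod_topology (fun _ : I => R) | forall i, `[- A, A]%classic (f i)].
  by apply: (@tychonoff I (fun=> R) (fun=> `[- A, A]%classic)) => i; exact: segment_compact.
pose u (n : nat) : prod_topology (fun _ : I => R) := (xy n).1.
have uF : (u @ \oo) [set f : prod_topology (fun _ : I => R) | forall i, `[- A, A]%classic (f i)].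
  exists 0%N => // n _ i /=; rewrite in_itv/= -ler_norml.
  by case: (xyP n) => h _ _ _; exact: h.
have [a [_ clu]] := cpt (u @ \oo) _ uF.
have [dl dl0 dlP] := cg a (eps / 2) (divr_gt0 e0 (ltr0n _ 2)).
have nbU : \forall y \near (a : prod_topology (fun _ : I => R)), forall i, `|a i - y i| < dl / 2.
  apply: (@filter_forall (prod_topology (fun _ : I => R)) I
    (fun i y => `|a i - y i| < dl / 2) (nbhs (a : prod_topology (fun _ : I => R))) _) => i.
  have := @proj_continuous I (fun=> R) i a.
  move=> /(_ _ (nbhsx_ballx (a i) _ (divr_gt0 dl0 (ltr0n _ 2)))).
  by [].
(* Restricting to late terms makes the second component of the pair close to the cluster point as
   well. *)
have nbV : (u @ \oo) [set x | exists n : nat, x = u n /\ n.+1%:R^-1 < dl / 2].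
  suff : \forall n \near \oo, n.+1%:R^-1 < dl / 2 by apply: filterS => n /= ?; exists n.
  near=> n.
  by near: n; exact: near_infty_natSinv_lt (PosNum (divr_gt0 dl0 (ltr0n _ 2))).
have [z [[n [zn nd2]] az]] := clu _ _ nbV nbU.
have [_ _ xyn gxy] := xyP n.
have h1 : `|g a - g (xy n).1| < eps / 2.
  by apply: dlP => i; rewrite -/(u n) -zn; apply: lt_le_trans (az i) _; lra.
have h2 : `|g a - g (xy n).2| < eps / 2.
  apply: dlP => i.
  rewrite (_ : a i - _ = (a i - (xy n).1 i) + ((xy n).1 i - (xy n).2 i)); last by ring.
  apply: le_lt_trans (ler_normD _ _) _; rewrite [ltRHS](splitr dl); apply: ltrD.
    by have := az i; rewrite zn.
  exact: lt_trans (xyn i) nd2.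
have : `|g (xy n).1 - g (xy n).2| < eps.
  rewrite (_ : _ - _ = - (g a - g (xy n).1) + (g a - g (xy n).2)); last by ring.
  by apply: le_lt_trans (ler_normD _ _) _; rewrite normrN [ltRHS](splitr eps); apply: ltrD.
by rewrite ltNge gxy.
Unshelve. all: end_near. Qed.

(** Cosine decreases up to [pi] and is nonpositive from there to [3 pi / 2], while [cos dl >= 0]. *)
Lemma cos_gap (dl u : R) : 0 < dl -> dl <= pi / 2 -> dl <= `|u| -> `|u| <= 3 * (pi / 2) ->
  1 - cos dl <= 1 - cos u.
Proof.
move=> dl0 dlpi dlu upi; rewrite lerD2l lerN2 -cos_norm.
have pi0 := pi_gt0 R.
have [upi'|upi'] := leP `|u| pi.
  move: dlu; rewrite le_eqVlt => /predU1P[<-//|dlu]; apply: ltW.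
  by rewrite ltr_cos ?in_itv//=; apply/andP; split; lra.
have -> : cos `|u| = - cos (`|u| - pi).
  by rewrite -[in LHS](subrK pi `|u|) cosDpi.
apply: (@le_trans _ _ 0); last by apply: cos_ge0_pihalf; apply/andP; split; lra.
by rewrite oppr_le0; apply: cos_ge0_pihalf; apply/andP; split; lra.
Qed.

(** The weights are products of one-dimensional node weights, nonnegative with sum 1, so [p]
    averages values of [g] and inherits the bound [B] off the box too. The error estimate is a
    Chebyshev inequality with [1 - cos] in the role of the squared distance. *)
Lemma trig_poly_approx g B A eps : cont_fun g -> (forall x, `|g x| <= B) ->
  0 < A -> 0 < eps ->
  exists p, [/\ trig_poly p, forall x, `|p x| <= B &
    forall x, (forall i, `|x i| <= A) -> `|g x - p x| <= eps].
Proof.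
move=> cg gB A0 eps0.
have pi0 := pi_gt0 R.
have e20 : 0 < eps / 2 by rewrite divr_gt0.
have [dl dl0 dlP] := cont_fun_unif (2 * A) cg e20.
have B0 : 0 <= B by apply: le_trans (gB (fun=> 0)).
(* Angles are [x i / lam + pi]. One period covers [[-2 A, 2 A]], twice the box, so a point of the
   box and a node differ by at most [3 pi / 2] in angle: no wrapping around. *)
pose lam := 2 * A / pi.
have lam0 : 0 < lam by rewrite divr_gt0// mulr_gt0.
have lampi : lam * pi = 2 * A by rewrite /lam divfK ?gt_eqF.
pose dl' := Num.min (dl / lam) (pi / 2).
have dl'0 : 0 < dl' by rewrite lt_min; apply/andP; split; apply: divr_gt0.
(* Lower bound, by [cos_gap], for the deviation in a coordinate where the node is at distance at
   least [dl]. *)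
pose eta := 1 - cos dl'.
have eta0 : 0 < eta.
  rewrite subr_gt0 -cos0 ltr_cos ?in_itv//= ?lexx ?ltW//=.
  have : dl' <= pi / 2 by rewrite ge_min lexx orbT.
  lra.
have [M MP] : exists M : nat, 2 * B / eta * #|I|%:R / (eps / 2) < M.+1%:R.
  exists (Num.bound (2 * B / eta * #|I|%:R / (eps / 2))).
  apply: lt_trans (archi_boundP _) _; last by rewrite ltr_nat.
  by rewrite divr_ge0 ?(ltW e20)// mulr_ge0// divr_ge0 ?(ltW eta0)// mulr_ge0.
pose pos (v : {ffun I -> 'I_M.+2}) i := lam * (2 * pi * (v i)%:R / M.+2%:R - pi) : R.
pose w (v : {ffun I -> 'I_M.+2}) x : R := \prod_i node_weight M (x i / lam + pi) (v i).
have w0 v x : 0 <= w v x by apply: prodr_ge0 => i _; exact: node_weight_ge0.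
have w1 x : \sum_v w v x = 1.
  by rewrite -(bigA_distr_bigA (fun i r => node_weight M (x i / lam + pi) r)) big1// => i _; exact: sum_node_weight.
pose dev (v : {ffun I -> 'I_M.+2}) x i := 1 - cos (x i / lam + pi - 2 * pi * (v i)%:R / M.+2%:R) : R.
have wvar x i : \sum_v w v x * dev v x i = M.+1%:R^-1.
  (* The deviation is moved into the [i]-th factor, so the sum over nodes is again a product of
     one-dimensional sums. *)
  pose F j (r : 'I_M.+2) := node_weight M (x j / lam + pi) r *
    (if j == i then 1 - cos (x i / lam + pi - 2 * pi * r%:R / M.+2%:R) else 1).
  rewrite (eq_bigr (fun v : {ffun I -> 'I_M.+2} => \prod_j F j (v j))); last first.
    move=> v _; rewrite /F big_split/=; congr (_ * _).
    by rewrite -big_mkcond/= big_pred1_eq.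
  rewrite -(bigA_distr_bigA F) (bigD1 i)//= [X in _ * X]big1 ?mulr1.
    rewrite -(sum_node_weight_var M (x i / lam + pi)); apply: eq_bigr => r _.
    by rewrite /F eqxx.
  move=> j /negbTE ji; rewrite -(sum_node_weight M (x j / lam + pi)).
  by apply: eq_bigr => r _; rewrite /F ji mulr1.
exists (fun x => \sum_v g (pos v) * w v x); split.
- apply: trig_poly_sum => v; apply: trig_polyZ; apply: trig_poly_prod => i.
  rewrite /node_weight /cos_kernel.
  set c := M.+2%:R * _.
  apply: (@trig_poly_ext (fun x => c^-1 * (2^-1 * (1 + cos (lam^-1 * x i + (pi - 2 * pi * (v i)%:R / M.+2%:R)))) ^+ M)).
    by move=> x; rewrite mulrC; congr (_ ^+ M / _); rewrite mulrC; congr ((1 + cos _) / _); rewrite addrA (mulrC lam^-1).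
  apply: trig_polyZ; apply: trig_polyX; apply: trig_polyZ; apply: trig_polyD.
    exact: trig_poly_cst.
  exact: trig_poly_coord.
- move=> x; apply: le_trans (ler_norm_sum _ _ _) _.
  rewrite -[B]mulr1 -(w1 x) mulr_sumr; apply: ler_sum => v _.
  by rewrite normrM (ger0_norm (w0 _ _)) ler_wpM2r.
move=> x xA.
rewrite -[g x]mulr1 -(w1 x) mulr_sumr -sumrB.
apply: le_trans (ler_norm_sum _ _ _) _.
(* A near node contributes at most [eps / 2] by uniform continuity; a far one at most [2 B], and its
   total deviation divided by [eta] is at least 1. *)
apply: (@le_trans _ _ (\sum_v w v x * (eps / 2 + 2 * B / eta * \sum_i dev v x i))).
  apply: ler_sum => v _; rewrite -mulrBl normrM (ger0_norm (w0 _ _)) mulrC ler_wpM2l//.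
  have dev0 i : 0 <= dev v x i by rewrite subr_ge0 cos_le1.
  have posA i : `|pos v i| <= 2 * A.
    have f0 : 0 <= (v i)%:R / M.+2%:R :> R by rewrite divr_ge0.
    have f1 : (v i)%:R / M.+2%:R <= 1 :> R.
      by rewrite ler_pdivrMr// mul1r ler_nat ltnW.
    have -> : pos v i = 2 * A * (2 * ((v i)%:R / M.+2%:R) - 1).
      by rewrite -lampi /pos; ring.
    move: f0 f1; set s := _ / _ => s0 s1.
    have := mulr_ge0 (ltW A0) s0; have := ler_wpM2l (ltW A0) s1.
    by rewrite ler_norml => *; apply/andP; split; lra.
  have [near|/existsNP[i far]] := pselect (forall i, `|x i - pos v i| < dl).
    apply: (@le_trans _ _ (eps / 2)).
      apply/ltW/dlP => // i; apply: le_trans (xA i) _; lra.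
    by rewrite lerDl mulr_ge0 ?sumr_ge0// divr_ge0 ?(ltW eta0)// mulr_ge0.
  have h1 : `|g x - g (pos v)| <= 2 * B.
    by apply: le_trans (ler_normB _ _) _; have := gB x; have := gB (pos v); lra.
  apply: le_trans h1 _.
  have h2 : eta <= \sum_i dev v x i.
    rewrite (bigD1 i)//=; apply: (@le_trans _ _ (dev v x i)); last first.
      by rewrite lerDl sumr_ge0.
    have uE : x i / lam + pi - 2 * pi * (v i)%:R / M.+2%:R = (x i - pos v i) / lam.
      have M20 : 2 + M%:R != 0 :> R by rewrite -natrD pnatr_eq0.
      by rewrite /pos; field; rewrite M20 gt_eqF.
    rewrite /dev uE; apply: cos_gap => //.
    - by rewrite ge_min lexx orbT.
    - rewrite normrM (gtr0_norm (_ : 0 < lam^-1)) ?invr_gt0//.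
      apply: (@le_trans _ _ (dl / lam)); first by rewrite ge_min lexx.
      by rewrite ler_pM2r ?invr_gt0// leNgt; apply/negP.
    - rewrite normrM (gtr0_norm (_ : 0 < lam^-1)) ?invr_gt0// ler_pdivrMr//.
      have -> : 3 * (pi / 2) * lam = 3 * A.
        rewrite (_ : 3 * (pi / 2) * lam = 3 / 2 * (lam * pi)); last by field.
        by rewrite lampi; field.
      by apply: le_trans (ler_normB _ _) _; have := xA i; have := posA i; lra.
  apply: (@le_trans _ _ (2 * B / eta * \sum_i dev v x i)); last by rewrite lerDr ltW.
  rewrite mulrAC ler_pdivlMr// ler_wpM2l// mulr_ge0//.
have -> : \sum_v w v x * (eps / 2 + 2 * B / eta * \sum_i dev v x i) =
   eps / 2 + 2 * B / eta * (#|I|%:R / M.+1%:R).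
  under eq_bigr do rewrite mulrDr (mulrCA _ (2 * B / eta)).
  rewrite big_split/= -mulr_suml w1 mul1r -mulr_sumr; congr (_ + _ * _).
  under eq_bigr do rewrite mulr_sumr.
  rewrite exchange_big/=; under eq_bigr do rewrite wvar.
  by rewrite sumr_const -[_ *+ _]mulr_natl.
rewrite {2}(splitr eps) lerD2l mulrA ler_pdivrMr// -ler_pdivrMl// mulrC.
exact: ltW.
Qed.
End trig_poly.

(** * Levy's continuity theorem *)

Section levy.
Context {R : realType} {I : finType}.
Implicit Types (g : (I -> R) -> R).

(** A pointwise limit of trigonometric polynomials of the coordinates, accurate on growing boxes. *)
Lemma cont_fun_measurable {d} {T : measurableType d} (S : T -> I -> R) g B :
  (forall i, measurable_fun setT (fun w => S w i)) -> cont_fun g ->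
  (forall x, `|g x| <= B) -> measurable_fun setT (fun w => g (S w)).
Proof.
move=> mS cg gB.
have /choice[p pP] : forall n : nat, exists p, [/\ trig_poly p, forall x, `|p x| <= B &
    forall x, (forall i, `|x i| <= n.+1%:R) -> `|g x - p x| <= n.+1%:R^-1].
  by move=> n; apply: trig_poly_approx; rewrite ?invr_gt0.
apply: (@measurable_fun_cvg _ _ _ setT (fun n w => p n (S w))).
  by move=> n; case: (pP n) => tp _ _; exact: trig_poly_measurable.
move=> w _; apply/cvgrPdist_le => e e0.
near=> n; case: (pP n) => _ _ /(_ (S w)) h.
apply: le_trans (h _) _.
  move=> i; apply: (@le_trans _ _ (\sum_i `|S w i|)).
    by rewrite (bigD1 i)//= lerDl sumr_ge0.
  apply: (@le_trans _ _ n%:R); last by rewrite ler_nat.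
  by near: n; exact: nbhs_infty_ger.
apply: ltW; near: n; exact: (near_infty_natSinv_lt (PosNum e0)).
Unshelve. all: end_near. Qed.

(** Replaces the indicator of [|x| > A]: it equals 1 there, is bounded and hence integrable for any
    law, and is at most [|x| / A], which gives Markov's inequality. *)
Definition tail (A x : R) := Num.min 1 (`|x| / A).

Lemma tail_ge0 A x : 0 < A -> 0 <= tail A x.
Proof. by move=> A0; rewrite /tail le_min ler01/= divr_ge0// ltW. Qed.

Lemma tail_measurable {d} {T : measurableType d} (S : T -> R) A : measurable_fun setT S ->
  measurable_fun setT (fun w => tail A (S w)).
Proof.
move=> mS; apply: measurable_minr; first exact: measurable_cst.
by apply: measurable_funM => //; apply: measurableT_comp.
Qed.

Lemma tail_has_mean {d} {T : measurableType d} (P : probability T R) (S : T -> R) A : 0 < A ->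
  measurable_fun setT S -> has_mean P (fun w => tail A (S w)).
Proof.
move=> A0 mS; apply: (@has_mean_bounded _ _ _ _ _ 1); first exact: tail_measurable.
by move=> x; rewrite ger0_norm ?tail_ge0// ge_min lexx.
Qed.

Lemma mean_tail_cvg {d} {T : measurableType d} (P : probability T R) (Y : T -> R) :
  measurable_fun setT Y -> mean P (fun w => tail n.+1%:R (Y w)) @[n --> \oo] --> 0.
Proof.
move=> mY.
have [||||| _ _ cv] := @dominated_convergence _ _ _ P setT measurableT
    (fun n w => (tail n.+1%:R (Y w))%:E) (EFin \o cst 0) (EFin \o cst 1).
- by move=> n; apply/measurable_EFinP; exact: tail_measurable.
- exact/measurable_EFinP.
- apply: aeW => w _; apply: cvg_EFin; first exact: nearW.
  apply/cvgrPdist_le => e e0; near=> n => /=.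
  rewrite sub0r normrN ger0_norm ?tail_ge0// ge_min; apply/orP; right.
  rewrite ler_pdivrMr// -ler_pdivrMl//; apply: (@le_trans _ _ n%:R); last by rewrite ler_nat.
  by near: n; exact: nbhs_infty_ger.
- exact: has_mean_cst.
- apply: aeW => w n _ /=; rewrite lee_fin ger0_norm ?tail_ge0// ge_min lexx//.
have z : (\int[P]_x (EFin \o cst (0%R : R)) x = 0%R%:E)%E by rewrite integral0_eq.
by rewrite z in cv; exact: fine_cvg cv.
Unshelve. all: end_near. Qed.

(** Off the box the error is at most [2 B], and some coordinate has [tail] equal to 1. *)
Lemma mean_approx {d} {T : measurableType d} (P : probability T R) (S : T -> I -> R)
    g p B A e : 0 < A ->
  (forall i, measurable_fun setT (fun w => S w i)) -> cont_fun g -> trig_poly p ->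
  (forall x, `|g x| <= B) -> (forall x, `|p x| <= B) ->
  (forall x, (forall i, `|x i| <= A) -> `|g x - p x| <= e) -> 0 <= e ->
  `|mean P (fun w => g (S w)) - mean P (fun w => p (S w))| <=
  e + 2 * B * \sum_i mean P (fun w => tail A (S w i)).
Proof.
move=> A0 mS cg tp gB pB gp e0.
have B0 : 0 <= B by apply: le_trans (gB (fun=> 0)).
have mg := cont_fun_measurable mS cg gB.
have mp := trig_poly_measurable mS tp.
have st i : has_mean P (fun w => tail A (S w i)) by exact: tail_has_mean.
pose h w := e + 2 * B * \sum_i tail A (S w i).
have sh : has_mean P h.
  by apply: has_meanD; [exact: has_mean_cst|apply: has_meanZ; exact: has_mean_sum].
have -> : e + 2 * B * \sum_i mean P (fun w => tail A (S w i)) = mean P h.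
  rewrite meanD; [|exact: has_mean_cst|apply: has_meanZ; exact: has_mean_sum].
  by rewrite mean_cst meanZ ?mean_sum//; exact: has_mean_sum.
apply: dist_mean_le => //.
- by apply: (@has_mean_bounded _ _ _ _ _ B).
- by apply: (@has_mean_bounded _ _ _ _ _ B).
move=> w; rewrite /h.
have t0 i : 0 <= tail A (S w i) by exact: tail_ge0.
have [/gp le|/existsNP[i /negP]] := pselect (forall i, `|S w i| <= A).
  by apply: le_trans le _; rewrite lerDl mulr_ge0 ?mulr_ge0// sumr_ge0.
rewrite -ltNge => Ai.
have : 1 <= \sum_i tail A (S w i).
  rewrite (bigD1 i)//=; apply: (@le_trans _ _ (tail A (S w i))); last by rewrite lerDl sumr_ge0.
  by rewrite /tail le_min lexx/= ler_pdivlMr// mul1r ltW.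
have : `|g (S w) - p (S w)| <= 2 * B.
  by apply: le_trans (ler_normB _ _) _; have := gB (S w); have := pB (S w); lra.
nra.
Qed.

(** Tightness of the sequence is an eventual L1 bound on each coordinate, used through [tail]; for
    the fixed limit [Z], [mean_tail_cvg] takes its place. *)
Theorem levy_continuity {d d'} {T : measurableType d} {T' : measurableType d'}
    (P : probability T R) (P' : probability T' R) (S : nat -> T -> I -> R)
    (Z : T' -> I -> R) (C : R) g B :
  (forall N i, measurable_fun setT (fun w => S N w i)) ->
  (forall i, measurable_fun setT (fun w => Z w i)) ->
  (forall i, \forall N \near \oo, has_mean P (fun w => S N w i) /\
     mean P (fun w => `|S N w i|) <= C) ->
  (forall t th, mean P (fun w => cos (\sum_i t i * S N w i + th)) @[N --> \oo] -->
     mean P' (fun w => cos (\sum_i t i * Z w i + th))) ->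
  cont_fun g -> (forall x, `|g x| <= B) ->
  mean P (fun w => g (S N w)) @[N --> \oo] --> mean P' (fun w => g (Z w)).
Proof.
move=> mS mZ tight cf cg gB.
have B0 : 0 <= B by apply: le_trans (gB (fun=> 0)).
have sumS N p : trig_poly p -> has_mean P (fun w => p (S N w)).
  by move=> tp; have [M pM] := trig_poly_bounded tp; apply: (@has_mean_bounded _ _ _ _ _ M) => //; apply: trig_poly_measurable.
have sumZ p : trig_poly p -> has_mean P' (fun w => p (Z w)).
  by move=> tp; have [M pM] := trig_poly_bounded tp; apply: (@has_mean_bounded _ _ _ _ _ M) => //; apply: trig_poly_measurable.
have cvp p : trig_poly p -> mean P (fun w => p (S N w)) @[N --> \oo] --> mean P' (fun w => p (Z w)).
  elim=> [t th|p1 p2 t1 h1 t2 h2|c p1 t1 h1]; first exact: cf.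
    rewrite (meanD (sumZ _ t1) (sumZ _ t2)).
    under eq_fun do rewrite (meanD (sumS _ _ t1) (sumS _ _ t2)).
    exact: cvgD.
  rewrite (meanZ c (sumZ _ t1)); under eq_fun do rewrite (meanZ c (sumS _ _ t1)).
  by apply: cvgM => //; exact: cvg_cst.
apply/cvgrPdist_le => e e0.
(* Approximation and tail for each of the two laws, plus the convergence for the polynomial. *)
pose e5 := e / 5; have e50 : 0 < e5 by rewrite divr_gt0.
have tailZ : \forall n \near \oo, 2 * B * \sum_i mean P' (fun w => tail n.+1%:R (Z w i)) <= e5.
  have : (2 * B * \sum_i mean P' (fun w => tail n.+1%:R (Z w i))) @[n --> \oo] --> 2 * B * \sum_(i : I) 0.
    apply: cvgM; first exact: cvg_cst.
    by apply: cvg_big => [|i _]; [exact: add_continuous|exact: mean_tail_cvg].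
  rewrite big1// mulr0 => /cvgrPdist_le/(_ _ e50); apply: filterS => n.
  by rewrite sub0r normrN; apply: le_trans; exact: ler_norm.
(* The box must be fixed before the polynomial, and the polynomial before [N]. *)
have [n [nZ nC]] : exists n, 2 * B * \sum_i mean P' (fun w => tail n.+1%:R (Z w i)) <= e5 /\
    2 * B * (#|I|%:R * (C / n.+1%:R)) <= e5.
  near \oo => n; exists n; split; first by near: n.
  rewrite !mulrA ler_pdivrMr// -ler_pdivrMl//.
  apply: (@le_trans _ _ n%:R); last by rewrite ler_nat.
  by near: n; exact: nbhs_infty_ger.
have [|p [tp pB gp]] := @trig_poly_approx _ _ g B n.+1%:R e5 cg gB _ e50 => //.
have tightI : \forall N \near \oo, forall i, has_mean P (fun w => S N w i) /\
    mean P (fun w => `|S N w i|) <= C by exact: filter_forall.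
near=> N.
have cp : `|mean P' (fun w => p (Z w)) - mean P (fun w => p (S N w))| <= e5.
  by near: N; move/cvgrPdist_le : (cvp p tp); exact.
have hZ := mean_approx P' (ltr0Sn _ n) mZ cg tp gB pB gp (ltW e50).
have hS := mean_approx P (ltr0Sn _ n) (mS N) cg tp gB pB gp (ltW e50).
have tS : \sum_i mean P (fun w => tail n.+1%:R (S N w i)) <= #|I|%:R * (C / n.+1%:R).
  have -> : #|I|%:R * (C / n.+1%:R) = \sum_(i : I) (C / n.+1%:R).
    by rewrite sumr_const mulr_natl.
  apply: ler_sum => i _.
  have [sN mN] : has_mean P (fun w => S N w i) /\ mean P (fun w => `|S N w i|) <= C.
    by move: i; near: N.
  apply: (@le_trans _ _ (n.+1%:R^-1 * mean P (fun w => `|S N w i|))); last first.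
    by rewrite mulrC ler_wpM2r// invr_ge0.
  rewrite -meanZ; last exact: has_mean_norm.
  apply: mean_le.
  - exact: tail_has_mean.
  - by apply: has_meanZ; exact: has_mean_norm.
  - by move=> w; rewrite /tail ge_min (mulrC n.+1%:R^-1) lexx orbT.
have tS' := ler_wpM2l (mulr_ge0 (ler0n _ 2) B0) tS.
set gZ := mean P' (fun w => g (Z w)) in hZ *; set gS := mean P (fun w => g (S N w)) in hS *.
set pZ := mean P' _ in hZ cp; set pS := mean P _ in hS cp.
rewrite (_ : gZ - gS = (gZ - pZ) + ((pZ - pS) - (gS - pS))); last by ring.
apply: le_trans (ler_normD _ _) _.
apply: le_trans (lerD hZ (ler_normB _ _)) _.
have hS' := le_trans hS (lerD (lexx e5) (le_trans tS' nC)).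
have hZ' := lerD (lexx e5) nZ.
apply: le_trans (lerD hZ' (lerD cp hS')) _.
by rewrite /e5; lra.
Unshelve. all: end_near. Qed.

End levy.

(** * Sample autocovariances *)

Section moments.
Context {d : measure_display} {T : measurableType d} {R : realType}
  (P : probability T R) (X : nat -> T -> R) (m : nat) (f : 'I_m -> R -> R) (K : nat).
Hypothesis mX : forall n, measurable_fun setT (X n).
Hypothesis indX : mutually_independent P X.
Hypothesis idX : identically_distributed P X.
Hypothesis mf : forall i, measurable_fun setT (f i).
Hypothesis sf4 : forall i, has_mean P (fun t => f i (X 0%N t) ^+ 4).

Definition centred (i : 'I_m) (n : nat) (t : T) : R := f i (X n t) - mean_f P X (f i).
Local Notation Y := centred.
Local Notation Q i j := (cov_f P X (f i) (f j)).

Let h i (x : R) := f i x - mean_f P X (f i).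
Let mh i : measurable_fun setT (h i).
Proof. exact: measurable_funB. Qed.

Let mfX i n : measurable_fun setT (fun t => f i (X n t)).
Proof. exact: measurableT_comp. Qed.

Lemma centred_depends i n : depends_on X [set n] (Y i n).
Proof. exact: (depends_on_coord _ (mh i)). Qed.

Lemma centred_measurable i n : measurable_fun setT (Y i n).
Proof. exact: (measurableT_comp (mh i)). Qed.

Let sY4_0 i : has_mean P (fun t => Y i 0%N t ^+ 4).
Proof.
apply: (@has_mean_pow4D _ _ _ P (fun t => f i (X 0%N t)) (fun=> - mean_f P X (f i))) => //.
exact: has_mean_cst.
Qed.

Let transfer (u : R -> R) n : measurable_fun setT u -> has_mean P (fun t => u (X 0%N t)) ->
  has_mean P (fun t => u (X n t)) /\
  mean P (fun t => u (X n t)) = mean P (fun t => u (X 0%N t)).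
Proof. exact: mean_identically_distributed. Qed.

Lemma centred_has_mean4 i n : has_mean P (fun t => Y i n t ^+ 4).
Proof.
have [|//] := @transfer (fun x => h i x ^+ 4) n _ (sY4_0 i).
exact: measurable_funX.
Qed.

Lemma centred_has_mean i n : has_mean P (Y i n).
Proof. exact: has_meanX1 (centred_measurable i n) (centred_has_mean4 i n). Qed.

Lemma mean_centred i n : mean P (Y i n) = 0.
Proof.
have [|_ ->] := @transfer (h i) n _ (centred_has_mean i 0); first exact: mh.
rewrite /h meanB ?mean_cst; [exact: subrr| |exact: has_mean_cst].
by apply: has_meanX1 (sf4 i).
Qed.

Lemma centred_has_meanM i j n n' : has_mean P (fun t => Y i n t * Y j n' t).
Proof.
by apply: has_meanM; try exact: centred_measurable;
  apply: (@has_meanX _ _ _ P _ 2) => //; try exact: centred_measurable;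
  exact: centred_has_mean4.
Qed.

Lemma mean_centredM i j n : mean P (fun t => Y i n t * Y j n t) = Q i j.
Proof.
have [|_ ->//] := @transfer (fun x => h i x * h j x) n _ (centred_has_meanM i j 0 0).
exact: measurable_funM.
Qed.

Lemma mean_centred_sqr i a b : mean P (fun t => Y i a t * Y i b t) = (a == b)%:R * Q i i.
Proof.
have [<-|ab] := eqVneq a b; first by rewrite mul1r mean_centredM.
have ab' n : [set a] n -> ~ [set b] n by move=> -> /eqP; rewrite (negbTE ab).
have [_ ->] := mean_depends_on mX indX ab' (@centred_depends i a) (@centred_depends i b)
  (centred_has_mean i a) (centred_has_mean i b).
by rewrite !mean_centred !mul0r.
Qed.

Local Notation I := ('I_K * ('I_m * 'I_m))%type.

(** ['I_K] counts from 0 and lags from 1, hence [l.1.+1]. *)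
Definition lagged (l : I) (a : nat) (t : T) : R :=
  Y l.2.1 a t * Y l.2.2 (a + l.1.+1)%N t.
Local Notation V := lagged.

Lemma lagged_depends l a : depends_on X [set j | (a <= j <= a + K)%N] (V l a).
Proof.
apply: measurable_funM.
  apply: depends_on_sub; last exact: centred_depends.
  by move=> n /= ->; rewrite leqnn leq_addr.
apply: depends_on_sub; last exact: centred_depends.
by move=> n /= ->; rewrite leq_addr leq_add2l ltn_ord.
Qed.

Lemma lagged_measurable l a : measurable_fun setT (V l a).
Proof. by apply: measurable_funM; exact: centred_measurable. Qed.

Let split_indep a b (u v : R -> R) i j : a != b -> measurable_fun setT u -> measurable_fun setT v ->
  has_mean P (fun t => u (Y i a t)) -> has_mean P (fun t => v (Y j b t)) ->
  has_mean P (fun t => u (Y i a t) * v (Y j b t)) /\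
  mean P (fun t => u (Y i a t) * v (Y j b t)) =
    mean P (fun t => u (Y i a t)) * mean P (fun t => v (Y j b t)).
Proof.
move=> ab mu mv.
have ab' n : [set a] n -> ~ [set b] n by move=> -> /eqP; rewrite (negbTE ab).
apply: (mean_depends_on mX indX ab').
  by apply: (depends_on_coord _ (measurableT_comp mu (mh i))).
by apply: (depends_on_coord _ (measurableT_comp mv (mh j))).
Qed.

Let neq_lag a k : a != (a + k.+1)%N.
Proof. by rewrite -[X in X != _]addn0 eqn_add2l. Qed.

(** The lag is positive, so the factors are independent and fourth moments of [Y] are enough. The
    value does not depend on [a]. *)
Lemma lagged_pow4 l a : has_mean P (fun t => V l a t ^+ 4) /\
  mean P (fun t => V l a t ^+ 4) =
    mean P (fun t => Y l.2.1 0 t ^+ 4) * mean P (fun t => Y l.2.2 0 t ^+ 4).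
Proof.
have mp : measurable_fun setT (fun x : R => x ^+ 4) by exact: measurable_funX.
have [s e] := split_indep (neq_lag a l.1) mp mp (centred_has_mean4 l.2.1 a) (centred_has_mean4 l.2.2 _).
under eq_fun do rewrite exprMn.
split; first exact: s.
rewrite e; congr (_ * _).
  by have [|_ ->] := @transfer (fun x => h l.2.1 x ^+ 4) a _ (sY4_0 _); first exact: measurable_funX.
by have [|_ ->] := @transfer (fun x => h l.2.2 x ^+ 4) (a + l.1.+1) _ (sY4_0 _); first exact: measurable_funX.
Qed.

Lemma mean_lagged l a : mean P (V l a) = 0.
Proof.
have [_ e] := split_indep (neq_lag a l.1) (@measurable_id _ _ setT) (@measurable_id _ _ setT) (centred_has_mean l.2.1 a) (centred_has_mean l.2.2 _).
by rewrite [LHS]e !mean_centred mul0r.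
Qed.

Lemma lagged_has_mean2 l a : has_mean P (fun t => V l a t ^+ 2).
Proof. apply: (@has_meanX _ _ _ P _ 2) => //; [exact: lagged_measurable|by case: (lagged_pow4 l a)]. Qed.

Let sY2 i n : has_mean P (fun t => Y i n t ^+ 2).
Proof. apply: (@has_meanX _ _ _ P _ 2) => //; [exact: centred_measurable|exact: centred_has_mean4]. Qed.

(** Index [a] is strictly the earliest of the four: its centred factor is independent of the other
    three. *)
Lemma mean_laggedM_lt l l' a b : (a < b)%N -> mean P (fun t => V l a t * V l' b t) = 0.
Proof.
move=> ab.
have J n : [set a] n -> ~ [set n | (a < n)%N] n by move=> ->; rewrite /= ltnn.
have dW : depends_on X [set n | (a < n)%N] (fun t => Y l.2.2 (a + l.1.+1)%N t * V l' b t).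
  apply: measurable_funM.
    apply: depends_on_sub; last exact: centred_depends.
    by move=> n /= ->; rewrite addnS ltnS leq_addr.
  apply: depends_on_sub; last exact: lagged_depends.
  by move=> n /= /andP[/(leq_trans ab)].
have sW : has_mean P (fun t => Y l.2.2 (a + l.1.+1)%N t * V l' b t).
  by apply: has_meanM; [exact: centred_measurable|exact: lagged_measurable|exact: sY2|exact: lagged_has_mean2].
have [_ e] := mean_depends_on mX indX J (@centred_depends l.2.1 a) dW (centred_has_mean _ a) sW.
rewrite (_ : (fun t => _) = (fun t => Y l.2.1 a t * (Y l.2.2 (a + l.1.+1)%N t * V l' b t))).
  by rewrite e mean_centred mul0r.
by apply/funext => t; rewrite mulrA.
Qed.

(** With a common start, the factor with the larger lag is strictly the latest and splits off. *)
Lemma mean_laggedM_lag_lt (l l' : I) a : (l.1 < l'.1)%N -> mean P (fun t => V l a t * V l' a t) = 0.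
Proof.
move=> ll'; pose b := (a + l'.1.+1)%N.
have J n : [set n | (n < b)%N] n -> ~ [set b] n by move=> /= + e; rewrite e ltnn.
have dW : depends_on X [set n | (n < b)%N] (fun t => V l a t * Y l'.2.1 a t).
  apply: measurable_funM; last first.
    apply: depends_on_sub; last exact: centred_depends.
    by move=> n /= ->; rewrite /b addnS ltnS leq_addr.
  apply: measurable_funM.
    apply: depends_on_sub; last exact: centred_depends.
    by move=> n /= ->; rewrite /b addnS ltnS leq_addr.
  apply: depends_on_sub; last exact: centred_depends.
  by move=> n /= ->; rewrite /b ltn_add2l ltnS.
have sW : has_mean P (fun t => V l a t * Y l'.2.1 a t).
  by apply: has_meanM; [exact: lagged_measurable|exact: centred_measurable|exact: lagged_has_mean2|exact: sY2].
have [_ e] := mean_depends_on mX indX J dW (@centred_depends l'.2.2 b) sW (centred_has_mean _ b).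
rewrite (_ : (fun t => _) = (fun t => (V l a t * Y l'.2.1 a t) * Y l'.2.2 b t)).
  by rewrite e mean_centred mulr0.
by apply/funext => t; rewrite -mulrA.
Qed.

(** Zero between different lags, the source of the independence of the limits; the matrix of the
    theorem at equal lags. *)
Definition lagged_cov (l l' : I) : R :=
  (l.1 == l'.1)%:R * (Q l.2.1 l'.2.1 * Q l.2.2 l'.2.2).

Lemma mean_laggedM l l' a b :
  mean P (fun t => V l a t * V l' b t) = (a == b)%:R * lagged_cov l l'.
Proof.
have C (l1 l2 : I) a1 a2 : mean P (fun t => V l1 a1 t * V l2 a2 t) = mean P (fun t => V l2 a2 t * V l1 a1 t).
  by congr mean; apply/funext => t; rewrite mulrC.
case: (ltngtP a b) => [ab|ba|<-].
- by rewrite mean_laggedM_lt// mul0r.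
- by rewrite C mean_laggedM_lt// mul0r.
rewrite mul1r /lagged_cov.
have [e|ne] := eqVneq l.1 l'.1; last first.
  rewrite mul0r; move: ne; rewrite -val_eqE neq_ltn => /orP[lt|gt].
    by rewrite mean_laggedM_lag_lt.
  by rewrite C mean_laggedM_lag_lt.
(* Equal start and lag: the factors regroup into a pair at [a] and a pair at [b']. *)
rewrite mul1r; pose b' := (a + l.1.+1)%N.
have J n : [set a] n -> ~ [set b'] n by move=> -> /eqP; rewrite (negbTE (neq_lag a l.1)).
have d1 : depends_on X [set a] (fun t => Y l.2.1 a t * Y l'.2.1 a t).
  by apply: measurable_funM; exact: centred_depends.
have d2 : depends_on X [set b'] (fun t => Y l.2.2 b' t * Y l'.2.2 b' t).
  by apply: measurable_funM; exact: centred_depends.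
have [_ E] := mean_depends_on mX indX J d1 d2 (centred_has_meanM _ _ a a) (centred_has_meanM _ _ b' b').
rewrite -(mean_centredM l.2.1 l'.2.1 a) -(mean_centredM l.2.2 l'.2.2 b') -E.
by congr mean; apply/funext => t; rewrite /lagged -e -/b'; ring.
Qed.

End moments.

(** * Replacing sample autocovariances by sums of lagged products *)

Section reduction.
Context {d : measure_display} {T : measurableType d} {R : realType}
  (P : probability T R) (X : nat -> T -> R) (m : nat) (f : 'I_m -> R -> R) (K : nat).
Hypothesis mX : forall n, measurable_fun setT (X n).
Hypothesis indX : mutually_independent P X.
Hypothesis idX : identically_distributed P X.
Hypothesis mf : forall i, measurable_fun setT (f i).
Hypothesis sf4 : forall i, has_mean P (fun t => f i (X 0%N t) ^+ 4).

Local Notation Y := (centred P X f).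
Local Notation Q i j := (cov_f P X (f i) (f j)).
Local Notation I := ('I_K * ('I_m * 'I_m))%type.
Local Notation V := (@lagged _ _ _ P X m f K).

Definition scaled_gamma (N : nat) (t : T) (l : I) : R :=
  Num.sqrt N%:R * hat_gamma X (f l.2.1) (f l.2.2) N l.1.+1 t.

Definition scaled_sum (N : nat) (t : T) (l : I) : R :=
  (Num.sqrt N%:R)^-1 * \sum_(a < N) V l a t.

Let mY i n : measurable_fun setT (Y i n). Proof. exact: centred_measurable. Qed.
Let mV l a : measurable_fun setT (V l a). Proof. exact: lagged_measurable. Qed.
Let mfX i n : measurable_fun setT (fun t => f i (X n t)).
Proof. exact: measurableT_comp. Qed.

Lemma scaled_gamma_measurable N l : measurable_fun setT (fun t => scaled_gamma N t l).
Proof.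
apply: measurable_funM => //; apply: measurable_funM => //.
have mm i : measurable_fun setT (hat_m X (f i) N).
  by apply: measurable_funM => //; exact: measurable_sum.
by apply: measurable_sum => a; apply: measurable_funM; exact: measurable_funB.
Qed.

(** The window has length 0, so that [mean_sqr_sum] also covers sums of [Y]. *)
Let depY i a : depends_on X [set j | (a <= j <= a + 0)%N] (Y i a).
Proof.
apply: depends_on_sub; last exact: centred_depends.
by move=> n /= ->; rewrite addn0 leqnn.
Qed.

Let sV4 l a : has_mean P (fun t => V l a t ^+ 4).
Proof. by case: (lagged_pow4 mX indX idX mf sf4 l a). Qed.

Let sY4 i a : has_mean P (fun t => Y i a t ^+ 4). Proof. exact: centred_has_mean4. Qed.

Let sqrY i (s : seq nat) : uniq s ->
  has_mean P (fun t => (\sum_(a <- s) Y i a t) ^+ 2) /\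
  mean P (fun t => (\sum_(a <- s) Y i a t) ^+ 2) = (size s)%:R * Q i i.
Proof.
move=> us; split; last first.
  apply: (mean_sqr_sum mX (@depY i) (sY4 i)) => // a b; exact: mean_centred_sqr.
apply: (@has_meanX _ _ _ P _ 2) => //; first exact: measurable_sum.
exact: has_mean_pow4_sum.
Qed.

Let sqrV l (s : seq nat) : uniq s ->
  has_mean P (fun t => (\sum_(a <- s) V l a t) ^+ 2) /\
  mean P (fun t => (\sum_(a <- s) V l a t) ^+ 2) = (size s)%:R * lagged_cov P X f l l.
Proof.
move=> us; split; last first.
  apply: (mean_sqr_sum mX (@lagged_depends _ _ _ P X m f K mf l) (sV4 l)) => // a b.
  exact: mean_laggedM.
apply: (@has_meanX _ _ _ P _ 2) => //; first exact: measurable_sum.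
exact: has_mean_pow4_sum.
Qed.

(** Three corrections: the normalization [N - k], the last [k] products, and the empirical centring.
    The latter consists of products of two averages of variance [O(1 / N)], so it remains
    [O(N^(-1/2))] after scaling by [N^(1/2)]. *)
Lemma scaled_gamma_close (l : I) : exists2 C : R, 0 <= C & forall N : nat, (0 < N)%N -> (2 * K <= N)%N ->
  has_mean P (fun t => scaled_gamma N t l) /\
  mean P (fun t => `|scaled_gamma N t l - scaled_sum N t l|) <= C * (Num.sqrt N%:R)^-1.
Proof.
have aux (c r' a1 a2 a3 a4 q1 q2 : R) : c * a1 <= r' * q1 -> c * a2 <= r' * q2 ->
    c * a3 <= 2 * r' * q1 -> c * a4 <= 2 * r' * q2 ->
    c * ((a1 + a2) + (a2 + a3) + (a1 + a4)) <= (4 * q1 + 4 * q2) * r' by lra.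
have n1 (x : R) : `|x| <= 1 + x ^+ 2 by exact: norm_le_1Dsqr.
have n2 (x x' : R) : `|x * x'| <= x ^+ 2 + x' ^+ 2 by exact: normM_le_sqrD.
pose i := l.2.1; pose j := l.2.2; pose k : nat := l.1.+1.
pose s2 := lagged_cov P X f l l.
have Q0 i' : 0 <= Q i' i'.
  rewrite -(mean_centredM mX idX mf sf4 i' i' 0).
  by apply: mean_ge0 => t; rewrite -expr2 sqr_ge0.
have s20 : 0 <= s2.
  have := mean_laggedM mX indX idX mf sf4 l l 0 0; rewrite eqxx mul1r -/s2 => <-.
  by apply: mean_ge0 => t; rewrite -expr2 sqr_ge0.
(* One summand for each correction, in that order; each 4 is [1 + 1 + 2], from two averages over [N]
   terms and one over [n]. *)
exists (k%:R * (1 + s2) + (1 + k%:R * s2) + (4 * Q i i + 4 * Q j j)).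
  by rewrite !addr_ge0 ?mulr_ge0 ?addr_ge0 ?mulr_ge0 ?Q0.
move=> N N0 KN.
have kK : (k <= K)%N by rewrite /k ltn_ord.
pose n := (N - k)%N.
have n0 : (0 < n)%N.
  rewrite subn_gt0; apply: leq_trans KN; rewrite mul2n -addnn -addn1 leq_add//.
  exact: leq_trans kK.
have nN : (n <= N)%N by exact: leq_subr.
have k2N : (2 * k <= N)%N by apply: leq_trans KN; rewrite leq_mul2l.
have kN : (k <= N)%N by apply: leq_trans k2N; rewrite leq_pmull.
(* At least half of the terms remain, so [1 / n <= 2 / N]. *)
have n2N : (N <= 2 * n)%N.
  by rewrite /n mulnBr leq_subRL ?leq_mul2l// (mul2n N) -addnn leq_add2r.
have NR : 0 < N%:R :> R by rewrite ltr0n.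
have nR : 0 < n%:R :> R by rewrite ltr0n.
pose s : R := Num.sqrt N%:R; pose r : R := s^-1.
have s0 : 0 < s by rewrite sqrtr_gt0.
have r0 : 0 < r by rewrite invr_gt0.
have ss : s ^+ 2 = N%:R by rewrite sqr_sqrtr ?ler0n.
have sN : s = r * N%:R by rewrite -ss /r expr2 mulKf ?gt_eqF.
have NnK : N%:R = n%:R + k%:R :> R.
  by rewrite -natrD subnK.
pose sA := iota 0 n; pose sR := iota n k; pose sN' := iota 0 N.
pose sK := [seq (a + k)%N | a <- iota 0 n].
have usK : uniq sK by rewrite map_inj_uniq ?iota_uniq// => a b /addIn.
pose A t := \sum_(a <- sA) V l a t; pose rest t := \sum_(a <- sR) V l a t.
pose y t := (\sum_(a <- sN') Y i a t) / N%:R; pose z t := (\sum_(a <- sN') Y j a t) / N%:R.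
pose b1 t := (\sum_(a <- sA) Y i a t) / n%:R; pose b2 t := (\sum_(a <- sK) Y j a t) / n%:R.
have sumord (F : nat -> R) p : \sum_(a < p) F a = \sum_(a <- iota 0 p) F a.
  by rewrite -(big_mkord xpredT) /index_iota subn0.
have hatE i' t : hat_m X (f i') N t = mean_f P X (f i') + (\sum_(a <- sN') Y i' a t) / N%:R.
  rewrite /hat_m (sumord (fun a => f i' (X a t))) /centred sumrB big_const_seq count_predT iter_addr_0 size_iota.
  by rewrite -[_ *+ N]mulr_natr; field; rewrite gt_eqF.
have gE t : hat_gamma X (f i) (f j) N k t = A t / n%:R - z t * b1 t - y t * b2 t + y t * z t.
  rewrite /hat_gamma -/n (sumord (fun a => (f i (X a t) - _) * (f j (X (a + k)%N t) - _))).
  rewrite (eq_bigr (fun a => V l a t - z t * Y i a t - y t * Y j (a + k)%N t + y t * z t)); last first.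
    move=> a _; rewrite !hatE -/(y t) -/(z t) /lagged -/i -/j -/k /centred; ring.
  rewrite !big_split/= !sumrN big_const_seq count_predT iter_addr_0 size_iota.
  rewrite -[y t * z t *+ n]mulr_natr -!mulr_sumr /b1 /b2 /sK big_map /A -/sA; field; rewrite gt_eqF//.
have iN : iota 0 N = sA ++ sR by rewrite /sA /sR -{1}(subnK kN) iotaD.
have sumE t : \sum_(a < N) V l a t = A t + rest t.
  by rewrite (sumord (fun a => V l a t)) iN big_cat.
(* The coefficient of [A] is [s / n - r], which equals [k r / n] because [s = r N] and
   [N = n + k]. *)
have dE t : scaled_gamma N t l - scaled_sum N t l =
    k%:R * r / n%:R * A t - r * rest t + s * (y t * z t - z t * b1 t - y t * b2 t).
  rewrite /scaled_gamma /scaled_sum -/i -/j -/k gE sumE -/s -/r sN NnK; field; rewrite gt_eqF//.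
have [sA2 eA2] := sqrV l (iota_uniq 0 n); have [sR2 eR2] := sqrV l (iota_uniq n k).
have mVs (q : seq nat) : measurable_fun setT (fun t => \sum_(a <- q) V l a t) by exact: measurable_sum.
have mYs i' (q : seq nat) c : measurable_fun setT (fun t => (\sum_(a <- q) Y i' a t) / c).
  by apply: measurable_funM => //; exact: measurable_sum.
have sq i' (q : seq nat) (c : nat) : (0 < c)%N -> (size q <= c)%N -> uniq q ->
    has_mean P (fun t => ((\sum_(a <- q) Y i' a t) / c%:R) ^+ 2) /\
    mean P (fun t => ((\sum_(a <- q) Y i' a t) / c%:R) ^+ 2) <= Q i' i' / c%:R.
  move=> c0 qc uq; have [s1 e1] := sqrY i' uq.
  have E t : ((\sum_(a <- q) Y i' a t) / c%:R) ^+ 2 = c%:R ^- 2 * (\sum_(a <- q) Y i' a t) ^+ 2.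
    by rewrite exprMn exprVn mulrC.
  split; first by under eq_fun do rewrite E; exact: has_meanZ.
  under [X in mean P X]eq_fun do rewrite E.
  rewrite meanZ// e1 mulrA (mulrC (Q i' i')) ler_wpM2r//.
  by rewrite expr2 invfM -mulrA ler_piMr ?invr_ge0// mulrC ler_pdivrMr ?ltr0n// mul1r ler_nat.
have [sy ey] := sq i sN' N N0 (eq_leq (size_iota _ _)) (iota_uniq _ _).
have [sz ez] := sq j sN' N N0 (eq_leq (size_iota _ _)) (iota_uniq _ _).
have [sb1 eb1] := sq i sA n n0 (eq_leq (size_iota _ _)) (iota_uniq _ _).
have [|sb2 eb2] := sq j sK n n0 _ usK; first by rewrite size_map size_iota.
pose G t := k%:R * r / n%:R * (1 + A t ^+ 2) + r * (1 + rest t ^+ 2) +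
  s * ((y t ^+ 2 + z t ^+ 2) + (z t ^+ 2 + b1 t ^+ 2) + (y t ^+ 2 + b2 t ^+ 2)).
have sG1 : has_mean P (fun t => (y t ^+ 2 + z t ^+ 2) + (z t ^+ 2 + b1 t ^+ 2) + (y t ^+ 2 + b2 t ^+ 2)).
  by apply: has_meanD; [apply: has_meanD; exact: has_meanD|exact: has_meanD].
have sA2' : has_mean P (fun t => 1 + A t ^+ 2) by apply: has_meanD => //; exact: has_mean_cst.
have sR2' : has_mean P (fun t => 1 + rest t ^+ 2) by apply: has_meanD => //; exact: has_mean_cst.
have sG : has_mean P G.
  by apply: has_meanD; [apply: has_meanD|]; apply: has_meanZ.
have mg : measurable_fun setT (fun t => scaled_gamma N t l) by exact: scaled_gamma_measurable.
have mw : measurable_fun setT (fun t => scaled_sum N t l).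
  by apply: measurable_funM => //; exact: measurable_sum.
have le_G t : `|scaled_gamma N t l - scaled_sum N t l| <= G t.
  rewrite dE; apply: le_trans (ler_normD _ _) _; apply: lerD.
    apply: le_trans (ler_normB _ _) _; apply: lerD.
      have c0 : 0 <= k%:R * r / n%:R by rewrite divr_ge0// mulr_ge0// ltW.
      by rewrite normrM (ger0_norm c0) ler_wpM2l.
    by rewrite normrM (gtr0_norm r0) ler_wpM2l// ltW.
  rewrite normrM gtr0_norm// ler_wpM2l ?(ltW s0)//.
  apply: le_trans (ler_normB _ _) _; apply: lerD => //.
  by apply: le_trans (ler_normB _ _) _; apply: lerD.
have sd : has_mean P (fun t => scaled_gamma N t l - scaled_sum N t l).
  by apply: has_mean_le sG => //; exact: measurable_funB.
have sw : has_mean P (fun t => scaled_sum N t l).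
  apply: has_meanZ; apply: has_mean_sum => a _.
  exact: has_meanX1.
split.
  rewrite (_ : (fun t => _) = (fun t => (scaled_gamma N t l - scaled_sum N t l) + scaled_sum N t l)).
    exact: has_meanD.
  by apply/funext => t; rewrite subrK.
apply: (@le_trans _ _ (mean P G)); first by apply: mean_le => //; exact: has_mean_norm.
rewrite /G meanD; [|by apply: has_meanD; apply: has_meanZ|exact: has_meanZ].
rewrite meanD; [|exact: has_meanZ|exact: has_meanZ].
rewrite !meanZ// !meanD//; try exact: has_mean_cst; try by do ?apply: has_meanD.
rewrite !mean_cst eA2 eR2 !size_iota -/s2 -/r.
have h1 : k%:R * r / n%:R * (1 + n%:R * s2) <= k%:R * (1 + s2) * r.
  rewrite (_ : _ * (1 + _) = k%:R * r * (n%:R^-1 + s2)); last by field; rewrite gt_eqF.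
  rewrite [leRHS]mulrAC ler_wpM2l ?mulr_ge0 ?(ltW r0)// lerD2r invf_le1//.
  by rewrite ler1n.
have sn : s / n%:R <= 2 * r.
  rewrite ler_pdivrMr// sN -mulrA (mulrCA 2) ler_wpM2l ?(ltW r0)//.
  by rewrite -natrM ler_nat.
have sNr : s / N%:R = r by rewrite sN mulfK// gt_eqF.
have hQ i' : s * (Q i' i' / N%:R) = r * Q i' i' by rewrite mulrCA sNr mulrC.
have hq i' : s * (Q i' i' / n%:R) <= 2 * r * Q i' i'.
  by rewrite mulrCA mulrC ler_wpM2r.
rewrite 2!mulrDl; apply: lerD; first by apply: lerD; [exact: h1|rewrite mulrC].
apply: aux; first by rewrite -hQ ler_wpM2l// ltW.
- by rewrite -hQ ler_wpM2l// ltW.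
- by apply: le_trans (hq i); rewrite ler_wpM2l// ltW.
- by apply: le_trans (hq j); rewrite ler_wpM2l// ltW.
Qed.

End reduction.

(** * Limit of the characteristic functions and tightness *)

Section limit.
Context {d : measure_display} {T : measurableType d} {R : realType}
  (P : probability T R) (X : nat -> T -> R) (m : nat) (f : 'I_m -> R -> R) (K : nat).
Hypothesis mX : forall n, measurable_fun setT (X n).
Hypothesis indX : mutually_independent P X.
Hypothesis idX : identically_distributed P X.
Hypothesis mf : forall i, measurable_fun setT (f i).
Hypothesis sf4 : forall i, has_mean P (fun t => f i (X 0%N t) ^+ 4).

Local Notation I := ('I_K * ('I_m * 'I_m))%type.
Local Notation V := (@lagged _ _ _ P X m f K).
Local Notation scaled_gamma := (@scaled_gamma _ _ _ X m f K).
Local Notation scaled_sum := (@scaled_sum _ _ _ P X m f K).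

Let mV l a : measurable_fun setT (V l a). Proof. exact: lagged_measurable. Qed.
Let sV4 l a : has_mean P (fun t => V l a t ^+ 4).
Proof. by case: (lagged_pow4 mX indX idX mf sf4 l a). Qed.
Let sV l a : has_mean P (V l a). Proof. exact: has_meanX1. Qed.
Let sVV l l' a b : has_mean P (fun t => V l a t * V l' b t).
Proof. by apply: has_meanM => //; apply: has_meanX. Qed.

Let comb (c : I -> R) (a : nat) (t : T) : R := \sum_l c l * V l a t.

Definition comb_var (c : I -> R) : R :=
  \sum_l \sum_l' c l * c l' * lagged_cov P X f l l'.

Let mcomb c a : measurable_fun setT (comb c a).
Proof. by apply: measurable_sum => l; exact: measurable_funM. Qed.

Let comb_depends c a : depends_on X [set j | (a <= j <= a + K)%N] (comb c a).
Proof.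
apply: measurable_sum => l; apply: measurable_funM; first exact: measurable_cst.
exact: lagged_depends.
Qed.

Let comb_has_mean4 c a : has_mean P (fun t => comb c a t ^+ 4).
Proof.
apply: has_mean_pow4_sum => l; first exact: measurable_funM.
exact: has_mean_pow4Z.
Qed.

Let mean_comb c a : mean P (comb c a) = 0.
Proof.
rewrite mean_sum => [|l _]; last exact: has_meanZ.
by rewrite big1// => l _; rewrite meanZ// mean_lagged ?mulr0.
Qed.

Let mean_combM c a b : mean P (fun t => comb c a t * comb c b t) = (a == b)%:R * comb_var c.
Proof.
rewrite (_ : (fun t => _) = (fun t => \sum_l \sum_l' (c l * c l') * (V l a t * V l' b t))); last first.
  apply/funext => t; rewrite /comb big_distrlr/=.
  by apply: eq_bigr => l _; apply: eq_bigr => l' _; ring.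
rewrite mean_sum => [|l _]; last by apply: has_mean_sum => l' _; exact: has_meanZ.
rewrite /comb_var mulr_sumr; apply: eq_bigr => l _.
rewrite mean_sum => [|l' _]; last exact: has_meanZ.
rewrite mulr_sumr; apply: eq_bigr => l' _.
by rewrite meanZ// (mean_laggedM mX indX idX mf sf4) mulrCA.
Qed.

(** Uniform in [a] by [lagged_pow4]; [C0] is a sum only to bound all summands at once. *)
Let comb_pow4 c : exists C, forall a, mean P (fun t => comb c a t ^+ 4) <= C.
Proof.
pose k i := mean P (fun t => centred P X f i 0 t ^+ 4).
have k0 i : 0 <= k i by apply: mean_ge0 => t; rewrite exprn_even_ge0.
pose C0 := \sum_(l : I) c l ^+ 4 * (k l.2.1 * k l.2.2).
have t0 (l : I) : 0 <= c l ^+ 4 * (k l.2.1 * k l.2.2).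
  by apply: mulr_ge0; [rewrite exprn_even_ge0|exact: mulr_ge0].
exists (16 ^+ size (index_enum (Finite.clone _ I)) * C0) => a.
apply: mean_pow4_sum_le.
- exact: sumr_ge0.
- by move=> l; exact: measurable_funM.
- by move=> l; exact: has_mean_pow4Z.
- move=> l; under [X in mean P X]eq_fun do rewrite exprMn.
  rewrite meanZ//; have [_ ->] := lagged_pow4 mX indX idX mf sf4 l a.
  by rewrite /C0 (bigD1 l)//= lerDl sumr_ge0.
Qed.

Lemma scaled_sum_comb c N t :
  \sum_l c l * scaled_sum N t l = (Num.sqrt N%:R)^-1 * \sum_(a < N) comb c a t.
Proof.
rewrite /comb exchange_big mulr_sumr; apply: eq_bigr => l _.
by rewrite -mulr_sumr mulrCA.
Qed.

Lemma scaled_sum_charfun c th :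
  mean P (fun t => cos (\sum_l c l * scaled_sum N t l + th)) @[N --> \oo] -->
    expR (- (comb_var c / 2)) * cos th.
Proof.
have [C hC] := comb_pow4 c.
under eq_fun do under [X in mean P X]eq_fun do rewrite scaled_sum_comb.
apply: (clt_charfun mX indX (@comb_depends c) (comb_has_mean4 c) (mean_comb c) (mean_combM c) hC).
Qed.

Let near_close (l : I) : exists2 C : R, 0 <= C & \forall N \near \oo,
  has_mean P (fun t => scaled_gamma N t l) /\
  mean P (fun t => `|scaled_gamma N t l - scaled_sum N t l|) <= C * (Num.sqrt N%:R)^-1.
Proof.
have [C C0 hC] := scaled_gamma_close mX indX idX mf sf4 l.
exists C => //; near=> N; apply: hC; near: N; [exact: nbhs_infty_gt|exact: nbhs_infty_ge].
Unshelve. all: end_near. Qed.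

Let cvg_isqrt : (Num.sqrt (N%:R : R))^-1 @[N --> \oo] --> 0.
Proof.
apply/cvgrPdist_le => e e0; near=> N.
have N0 : (0 < N)%N by near: N; exact: nbhs_infty_gt.
rewrite sub0r normrN ger0_norm ?invr_ge0// -(invrK e) lef_pV2 ?posrE ?invr_gt0 ?sqrtr_gt0 ?ltr0n//.
have ei0 : 0 <= e^-1 by rewrite invr_ge0 ltW.
rewrite -(ger0_norm ei0) -sqrtr_sqr ler_sqrt ?ler0n//.
by near: N; exact: nbhs_infty_ger.
Unshelve. all: end_near. Qed.

Let smeas N l : measurable_fun setT (fun t => scaled_sum N t l).
Proof. by apply: measurable_funM => //; exact: measurable_sum. Qed.

Let gmeas N l : measurable_fun setT (fun t => scaled_gamma N t l).
Proof. exact: scaled_gamma_measurable. Qed.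

Let ssum N l : has_mean P (fun t => scaled_sum N t l).
Proof. by apply: has_meanZ; apply: has_mean_sum => a _. Qed.

(** A Slutsky argument: cosine is 1-Lipschitz, so L1 closeness transfers the limit. *)
Lemma scaled_gamma_charfun c th :
  mean P (fun t => cos (\sum_l c l * scaled_gamma N t l + th)) @[N --> \oo] -->
    expR (- (comb_var c / 2)) * cos th.
Proof.
have /choice[C hC] : forall l, exists C : R, 0 <= C /\ \forall N \near \oo,
    has_mean P (fun t => scaled_gamma N t l) /\
    mean P (fun t => `|scaled_gamma N t l - scaled_sum N t l|) <= C * (Num.sqrt N%:R)^-1.
  by move=> l; have [C C0 h] := near_close l; exists C.
suff d0 : (mean P (fun t => cos (\sum_l c l * scaled_gamma N t l + th)) -
      mean P (fun t => cos (\sum_l c l * scaled_sum N t l + th))) @[N --> \oo] --> 0.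
  rewrite -[X in _ --> X]add0r.
  rewrite [X in X @ _](_ : _ = (fun N => (mean P (fun t => cos (\sum_l c l * scaled_gamma N t l + th)) -
      mean P (fun t => cos (\sum_l c l * scaled_sum N t l + th))) +
      mean P (fun t => cos (\sum_l c l * scaled_sum N t l + th)))).
    by apply: cvgD => //; exact: scaled_sum_charfun.
  by apply/funext => N; rewrite subrK.
have ub : \forall N \near \oo, `|mean P (fun t => cos (\sum_l c l * scaled_gamma N t l + th)) -
      mean P (fun t => cos (\sum_l c l * scaled_sum N t l + th))| <=
    (\sum_l `|c l| * C l) * (Num.sqrt N%:R)^-1.
  have hI : \forall N \near \oo, forall l, has_mean P (fun t => scaled_gamma N t l) /\
      mean P (fun t => `|scaled_gamma N t l - scaled_sum N t l|) <= C l * (Num.sqrt N%:R)^-1.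
    by apply: filter_forall => l; case: (hC l).
  apply: filterS hI => N hN.
  have sd l : has_mean P (fun t => `|scaled_gamma N t l - scaled_sum N t l|).
    by apply: has_mean_norm; apply: has_meanB => //; case: (hN l).
  apply: (@le_trans _ _ (mean P (fun t => \sum_l `|c l| * `|scaled_gamma N t l - scaled_sum N t l|))).
    apply: dist_mean_le.
    - apply: has_mean_cos; apply: measurable_funD => //.
      by apply: measurable_sum => l; exact: measurable_funM.
    - apply: has_mean_cos; apply: measurable_funD => //.
      by apply: measurable_sum => l; exact: measurable_funM.
    - by apply: has_mean_sum => l _; exact: has_meanZ.
    - move=> t; apply: le_trans (cos_lipschitz _ _) _.
      rewrite (_ : _ - _ = \sum_l c l * (scaled_gamma N t l - scaled_sum N t l)).
        by apply: le_trans (ler_norm_sum _ _ _) _; apply: ler_sum => l _; rewrite normrM.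
      rewrite opprD addrACA subrr addr0 -sumrB; apply: eq_bigr => l _.
      by rewrite mulrBr.
  rewrite mean_sum => [|l _]; last exact: has_meanZ.
  rewrite mulr_suml; apply: ler_sum => l _; rewrite meanZ// -mulrA ler_wpM2l//.
  by case: (hN l).
apply: norm_cvg0.
apply: (@squeeze_cvgr _ _ _ _ (cst 0) (fun N => (\sum_l `|c l| * C l) * (Num.sqrt N%:R)^-1)).
- by apply: filterS ub => N ->; rewrite normr_ge0.
- exact: cvg_cst.
- rewrite -[X in _ --> X](mulr0 (\sum_l `|c l| * C l)).
  by apply: cvgM => //; exact: cvg_cst.
Qed.

(** The scaled sum has variance [lagged_cov l l] for every [N > 0], hence a bounded L1 norm; L1
    closeness does the rest. *)
Lemma scaled_gamma_tight : exists C : R, forall l : I, \forall N \near \oo,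
  has_mean P (fun t => scaled_gamma N t l) /\ mean P (fun t => `|scaled_gamma N t l|) <= C.
Proof.
have /choice[C hC] : forall l, exists C : R, 0 <= C /\ \forall N \near \oo,
    has_mean P (fun t => scaled_gamma N t l) /\
    mean P (fun t => `|scaled_gamma N t l - scaled_sum N t l|) <= C * (Num.sqrt N%:R)^-1.
  by move=> l; have [C C0 h] := near_close l; exists C.
have cov0 l : 0 <= lagged_cov P X f l l :> R.
  have := mean_laggedM mX indX idX mf sf4 l l 0 0; rewrite eqxx mul1r => <-.
  by apply: mean_ge0 => t; rewrite -expr2 sqr_ge0.
pose B l := C l + (1 + lagged_cov P X f l l).
have B0 l : 0 <= B l by rewrite !addr_ge0//; case: (hC l).
exists (\sum_l B l) => l; have [C0 hN] := hC l; near=> N.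
have [sg dg] : has_mean P (fun t => scaled_gamma N t l) /\
    mean P (fun t => `|scaled_gamma N t l - scaled_sum N t l|) <= C l * (Num.sqrt N%:R)^-1.
  by near: N.
have N0 : (0 < N)%N by near: N; exact: nbhs_infty_gt.
split=> //.
apply: (@le_trans _ _ (B l)); last by rewrite [leRHS](bigD1 l)//= lerDl sumr_ge0.
have sd : has_mean P (fun t => `|scaled_gamma N t l - scaled_sum N t l|).
  by apply: has_mean_norm; exact: has_meanB.
have sn := has_mean_norm (ssum N l).
apply: (@le_trans _ _ (mean P (fun t => `|scaled_gamma N t l - scaled_sum N t l| + `|scaled_sum N t l|))).
  apply: mean_le; [exact: has_mean_norm|exact: has_meanD|].
  by move=> t; rewrite -{1}(subrK (scaled_sum N t l) (scaled_gamma N t l)); exact: ler_normD.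
rewrite meanD//; apply: lerD.
  apply: le_trans dg _; rewrite ler_piMr// invf_le1 ?sqrtr_gt0 ?ltr0n//.
  by rewrite -[leLHS]sqrtr1 ler_wsqrtr// ler1n.
have := mean_norm_sum mX (@lagged_depends _ _ _ P X m f K mf l) (sV4 l) (mean_laggedM mX indX idX mf sf4 l l)
  (Num.sqrt N%:R)^-1 (iota_uniq 0 N) ltr01.
rewrite size_iota exprVn sqr_sqrtr// mulVf ?mul1r ?divr1 ?pnatr_eq0 -?lt0n//.
move=> h; apply: le_trans h; rewrite le_eqVlt; apply/orP; left; apply/eqP.
congr mean; apply/funext => t; rewrite /scaled_sum.
by rewrite -(big_mkord xpredT (fun a => V l a t)) /index_iota subn0.
Unshelve. all: end_near. Qed.

End limit.

(** * Construction of the limit and conclusion *)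

Definition ord_extend {A : Type} {K : nat} (F : 'I_K -> A) (a0 : A) (k : nat) : A :=
  if insub k is Some k' then F k' else a0.

Lemma ord_extendE {A : Type} {K : nat} (F : 'I_K -> A) (a0 : A) (k : 'I_K) :
  ord_extend F a0 k = F k.
Proof. by rewrite /ord_extend valK. Qed.

Lemma bigsetI_ordE {T : Type} {n : nat} (A : 'I_n -> set T) :
  \big[setI/setT]_(i < n) A i = [set t | forall i, A i t].
Proof.
rewrite in_bigsetI; apply/seteqP; split=> t /=.
  by move=> /allP h i; apply/asboolP/h; rewrite mem_index_enum.
by move=> h; apply/allP => i _; exact/asboolP.
Qed.

(** Gram vectors of a Kronecker square are the products of pairs of Gram vectors: the sums over [v]
    and [w] separate. *)
Lemma sum_sqr_kronecker {R : realType} {m : nat} (Q : 'I_m -> 'I_m -> R) (vs : seq ('I_m -> R))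
    (t : 'I_m * 'I_m -> R) : (forall i j, Q i j = \sum_(v <- vs) v i * v j) ->
  \sum_(u <- [seq (fun x : 'I_m * 'I_m => v x.1 * w x.2) | v <- vs, w <- vs]) (\sum_x t x * u x) ^+ 2 =
  \sum_x \sum_y t x * t y * (Q x.1 y.1 * Q x.2 y.2).
Proof.
move=> QE; rewrite big_allpairs_dep.
transitivity (\sum_(v <- vs) \sum_(w <- vs) \sum_x \sum_y
    t x * t y * ((v x.1 * v y.1) * (w x.2 * w y.2))).
  apply: eq_bigr => v _; apply: eq_bigr => w _; rewrite expr2 big_distrlr/=.
  by apply: eq_bigr => x _; apply: eq_bigr => y _; ring.
under eq_bigr do rewrite exchange_big.
rewrite exchange_big/=; apply: eq_bigr => x _.
under eq_bigr do rewrite exchange_big.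
rewrite exchange_big/=; apply: eq_bigr => y _.
rewrite !QE big_distrlr mulr_sumr; apply: eq_bigr => v _.
by rewrite mulr_sumr.
Qed.

Lemma sum4_pair {R : realType} {m : nat} (S : 'I_m -> 'I_m -> 'I_m -> 'I_m -> R)
    (t : 'I_m -> 'I_m -> R) :
  \sum_(i < m) \sum_(j < m) \sum_(i' < m) \sum_(j' < m) t i j * t i' j' * S i j i' j' =
  \sum_(x : 'I_m * 'I_m) \sum_(y : 'I_m * 'I_m)
    t x.1 x.2 * t y.1 y.2 * S x.1 x.2 y.1 y.2.
Proof.
rewrite pair_bigA/=; apply: eq_bigr => x _.
by rewrite pair_bigA.
Qed.

(** The quadratic form is the second moment of [\sum_i t i * Y i], hence nonnegative. *)
Lemma cov_psd_gram {d} {T : measurableType d} {R : realType} (P : probability T R)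
    (X : nat -> T -> R) (m : nat) (f : 'I_m -> R -> R) :
  (forall n, measurable_fun setT (X n)) -> identically_distributed P X ->
  (forall i, measurable_fun setT (f i)) ->
  (forall i, has_mean P (fun t => f i (X 0%N t) ^+ 4)) ->
  exists vs : seq ('I_m -> R), forall i j, cov_f P X (f i) (f j) = \sum_(v <- vs) v i * v j.
Proof.
move=> mX idX mf sf4; apply: psd_gram => [i j|t].
  by apply: eq_Rintegral => w _; rewrite mulrC.
pose Y i w := centred P X f i 0 w.
have sYY i j : has_mean P (fun w => Y i w * Y j w) by exact: centred_has_meanM.
rewrite (_ : quad_form _ t = mean P (fun w => (\sum_i t i * Y i w) ^+ 2)).
  by apply: mean_ge0 => w; exact: sqr_ge0.
rewrite (_ : (fun w => _) = (fun w => \sum_i \sum_j (t i * t j) * (Y i w * Y j w))); last first.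
  apply/funext => w; rewrite expr2 big_distrlr/=.
  by apply: eq_bigr => i _; apply: eq_bigr => j _; ring.
rewrite mean_sum => [|i _]; last by apply: has_mean_sum => j _; exact: has_meanZ.
apply: eq_bigr => i _; rewrite mean_sum => [|j _]; last exact: has_meanZ.
by apply: eq_bigr => j _; rewrite meanZ// (mean_centredM mX idX mf sf4).
Qed.

Theorem theorem1 (d : measure_display) (T : measurableType d) (R : realType)
  (P : probability T R) (X : nat -> T -> R) (m : nat) (f : 'I_m -> R -> R)
  (K : nat) :
  iid_seq P X ->
  (forall i, measurable_fun setT (f i)) ->
  (forall i, P.-integrable setT (fun t => ((f i (X 0%N t)) ^+ 4)%:E)) ->
  (0 < K)%N ->
  exists (d' : measure_display) (T' : measurableType d')
         (P' : probability T' R) (Xi : T' -> 'I_K -> 'I_m -> 'I_m -> R),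
    independent_vectors P' Xi /\
    (forall k : 'I_K, centered_gaussian P' (fun w => Xi w k)
       (fun i j i' j' => cov_f P X (f i) (f i') * cov_f P X (f j) (f j'))) /\
    forall g : ('I_K -> 'I_m -> 'I_m -> R) -> R,
      bounded_test_fun g -> continuous_test_fun g ->
      (fun N : nat => Rintegral P setT (fun t =>
          g (fun k i j => Num.sqrt (N%:R) *
                          hat_gamma X (f i) (f j) N k.+1 t)))
        @ \oo --> Rintegral P' setT (fun w => g (Xi w)).
Proof.
move=> [mX indX idX] mf sf4 _.
have [vs vsP] := cov_psd_gram mX idX mf sf4.
pose vs2 := [seq (fun x : 'I_m * 'I_m => v x.1 * w x.2) | v <- vs, w <- vs].
have [d0 [T0 [P0 [Z0 gZ]]]] := gaussian_charfun_exists vs2.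
have [d' [T' [P' [Xi [mXi indXi cfXi]]]]] := independent_copies K gZ.
exists d', T', P', (fun w k i j => Xi w k (i, j)).
pose q (t : 'I_m * 'I_m -> R) := \sum_(u <- vs2) (\sum_x t x * u x) ^+ 2.
have qE t : q t = \sum_x \sum_y t x * t y *
    (cov_f P X (f x.1) (f y.1) * cov_f P X (f x.2) (f y.2)).
  exact: (@sum_sqr_kronecker R m (fun i j => cov_f P X (f i) (f j))).
have cfXi_ord (t : 'I_K -> 'I_m * 'I_m -> R) th :
    mean P' (fun w => cos (\sum_(k < K) \sum_x t k x * Xi w k x + th)) =
    cos th * expR (- ((\sum_(k < K) q (t k)) / 2)).
  have := cfXi (ord_extend t (fun=> 0)) th.
  rewrite (_ : \sum_(k < K) _ = \sum_(k < K) q (t k)); last first.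
    by apply: eq_bigr => k _; rewrite ord_extendE.
  move=> <-; congr mean; apply/funext => w; congr (cos (_ + _)).
  by apply: eq_bigr => k _; rewrite ord_extendE.
split; [|split].
- move=> B mB.
  pose S k := [set x : 'I_m * 'I_m -> R | forall i j, B k i j (x (i, j))].
  have mS k : measurable (Z0 @^-1` S k).
    rewrite (_ : _ @^-1` _ = \big[setI/setT]_(i < m) \big[setI/setT]_(j < m)
        ((fun w => Z0 w (i, j)) @^-1` B k i j)).
      apply: bigsetI_measurable => i _; apply: bigsetI_measurable => j _.
      rewrite -[X in measurable X]setTI.
      exact: (gZ.1 (i, j) measurableT _ (mB k i j)).
    rewrite bigsetI_ordE; apply/seteqP; split=> w /= h i.
      by rewrite bigsetI_ordE => j /=; exact: h.
    by move=> j; have := h i; rewrite bigsetI_ordE => /(_ j).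
  have SE (k : 'I_K) : \big[setI/setT]_(i < m) \big[setI/setT]_(j < m)
      ((fun w => Xi w k (i, j)) @^-1` B k i j) = (fun w => Xi w k) @^-1` S k.
    rewrite bigsetI_ordE; apply/seteqP; split=> w /= h i.
      by move=> j; have := h i; rewrite bigsetI_ordE => /(_ j).
    by rewrite bigsetI_ordE => j /=; exact: h.
  (* The marginal law of copy [k]: all other copies are left unconstrained. *)
  have PS (k : 'I_K) : P' ((fun w => Xi w k) @^-1` S k) = P0 (Z0 @^-1` S k).
    pose Sk (k' : nat) := if k' == k then S k else setT.
    have [|_ e] := indXi Sk.
      by move=> k'; rewrite /Sk; case: eqP => // _; rewrite preimage_setT.
    have <- : \big[setI/setT]_(k' < K) ((fun w => Xi w k') @^-1` Sk k') =
        (fun w => Xi w k) @^-1` S k.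
      rewrite bigsetI_ordE; apply/seteqP; split=> w /=.
        by move=> /(_ k); rewrite /Sk eqxx.
      by move=> h k'; rewrite /Sk; case: eqP => // /val_inj ->.
    rewrite e (bigD1 k)//= big1 ?mule1 /Sk ?eqxx// => k' /negbTE k'k.
    by rewrite val_eqE k'k preimage_setT probability_setT.
  (* The copies are indexed by [nat]; [setT] is the default from [K] on. *)
  have [|_ e] := indXi (ord_extend S setT).
    by move=> k; rewrite /ord_extend; case: insubP => // _; rewrite preimage_setT.
  rewrite (eq_bigr (fun k : 'I_K => (fun w => Xi w k) @^-1` (ord_extend S setT k))); last first.
    by move=> k _; rewrite SE ord_extendE.
  rewrite e; apply: eq_bigr => k _.
  by rewrite ord_extendE SE PS.
- move=> k; split=> [i j|t]; first exact: mXi.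
  move=> q' s.
  (* The joint characteristic function at arguments vanishing off lag [k] is the marginal one. *)
  pose tk (k' : 'I_K) (x : 'I_m * 'I_m) := if k' == k then t x.1 x.2 else 0.
  have q0 : q (fun=> 0) = 0.
    by rewrite /q big1// => u _; rewrite big1 ?expr0n// => x _; rewrite mul0r.
  have cf th : mean P' (fun w => cos (s w + th)) = cos th * expR (- (q' / 2)).
    have -> : q' = \sum_(k' < K) q (tk k').
      rewrite (bigD1 k)//= big1 ?addr0 => [|k' /negbTE k'k]; last first.
        by rewrite -[RHS]q0; congr q; apply/funext => x; rewrite /tk k'k.
      rewrite qE /q' (sum4_pair (fun i j i' j' => cov_f P X (f i) (f i') * cov_f P X (f j) (f j'))).
      by apply: eq_bigr => x _; apply: eq_bigr => y _; rewrite /tk eqxx.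
    rewrite -cfXi_ord; congr mean; apply/funext => w; congr (cos (_ + _)).
    rewrite (bigD1 k)//= [X in _ + X]big1 ?addr0 => [|k' /negbTE k'k]; last first.
      by rewrite big1// => x _; rewrite /tk k'k mul0r.
    rewrite /s pair_bigA; apply: eq_bigr => -[i j] _.
    by rewrite /tk eqxx.
  split.
    have := cf 0; rewrite cos0 mul1r => <-; rewrite /mean; congr Rintegral.
    by apply/funext => w; rewrite addr0.
  (* The phase [- pi / 2] turns the cosine into a sine. *)
  have := cf (- (pi / 2)); rewrite cosN cos_pihalf mul0r => <-; rewrite /mean; congr Rintegral.
  by apply/funext => w; rewrite cosBpihalf.
- move=> g [B gB] cg.
  pose g' (x : 'I_K * ('I_m * 'I_m) -> R) := g (fun k i j => x (k, (i, j))).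
  have cg' : cont_fun g'.
    move=> x eps eps0; have [delta delta0 h] := cg (fun k i j => x (k, (i, j))) eps eps0.
    by exists delta => // y xy; apply: h => k i j; exact: xy.
  have [C tight] := @scaled_gamma_tight _ _ _ _ _ _ _ K mX indX idX mf sf4.
  apply: (@levy_continuity _ _ _ _ _ _ P P' (@scaled_gamma _ _ _ X m f K)
    (fun w l => Xi w l.1 l.2) C g' B).
  + by move=> N l; exact: scaled_gamma_measurable.
  + by move=> l; exact: mXi.
  + exact: tight.
  + move=> t th.
    have -> : mean P' (fun w => cos (\sum_l t l * Xi w l.1 l.2 + th)) =
        expR (- (comb_var P X f t / 2)) * cos th.
      have := cfXi_ord (fun k x => t (k, x)) th.
      have -> : \sum_(k < K) q (fun x => t (k, x)) = comb_var P X f t.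
        rewrite /comb_var.
        (* The sum over all index pairs is grouped by lags; cross terms vanish, leaving one form [q]
           per lag, as for independent vectors. *)
        transitivity (\sum_(k < K) \sum_x \sum_(k' < K) \sum_y
            t (k, x) * t (k', y) * lagged_cov P X f (k, x) (k', y)); last first.
          by rewrite pair_bigA; apply: eq_bigr => -[k x] _; rewrite pair_bigA; apply: eq_bigr => -[k' y] _.
        apply: eq_bigr => k _; rewrite qE; apply: eq_bigr => x _.
        rewrite (bigD1 k)//= [X in _ = _ + X]big1 ?addr0 => [|k' k'k]; last first.
          rewrite big1// => y _; rewrite /lagged_cov/= eq_sym (negbTE k'k).
          by rewrite mul0r mulr0.
        by apply: eq_bigr => y _; rewrite /lagged_cov/= eqxx mul1r.
      rewrite mulrC => <-; congr mean; apply/funext => w; congr (cos (_ + _)).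
      by rewrite pair_bigA; apply: eq_bigr => -[k x] _.
    exact: scaled_gamma_charfun.
  + exact: cg'.
  + by move=> x; exact: gB.
Qed.
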